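(* Let $\nu\ge 0$, $d\ge 1$, $0\le \gamma\le 2$, $\beta\ge 0$, $\lambda>1$. There is a constant $C>0$ depending only on $(\nu,d,\gamma,\beta,\lambda)$ such that the following holds. Let $v=v(t,x):[0,\infty)\times\mathbb R^d\to\mathbb R^d$ be a given vector field (not necessarily divergence-free), and let $\theta=\theta(t,x)$ be a smooth solution of $$\partial_t\theta+v\cdot\nabla\theta+\nu\,\mathcal A\theta=0,\quad (t,x)\in(0,\infty)\times\mathbb R^d,\qquad \theta(0,x)=\theta_0(x),$$ where $\mathcal A=\frac{|\nabla|^{\gamma}}{\log^{\beta}(\lambda+|\nabla|)}$, and assume that $\theta$ decays at spatial infinity, i.e. for any fixed $t\ge 0$, $$\lim_{|x|\to\infty}\theta(t,x)=0.$$ Then $$\|\theta(t)\|_{\infty}\le e^{Ct}\,\|\theta_0\|_{\infty},\qquad \forall\, t\ge 0.$$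
   Context: $\theta$ is a scalar function. The operator $\mathcal A$ is the Fourier multiplier acting in the space variable $x\in\mathbb R^d$ given by $$\widehat{\mathcal A f}(\xi)=\frac{|\xi|^{\gamma}}{\log^{\beta}(\lambda+|\xi|)}\,\hat f(\xi),\qquad \xi\in\mathbb R^d,$$ where $\log^\beta(y)=(\log y)^\beta$ and $\hat f(\xi)=\int_{\mathbb R^d}f(x)e^{-i\xi\cdot x}\,dx$. $\|\cdot\|_\infty$ denotes the $L^\infty(\mathbb R^d)$ norm in $x$.
   Formalization: A smooth solution is additionally required to have t ↦ ‖θ(t)‖_∞ continuous on [0,∞); with decay only for each fixed t the claim fails (ν=0, θ_0=0, a bump χ(x_1−1/(t−1),…) entering from infinity at t=1 with smooth unbounded v). *)

(* Defs.v *)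
From HB Require Import structures.
From mathcomp Require Import all_boot all_order all_algebra.
From mathcomp Require Import complex.
From mathcomp Require Import all_classical all_reals all_analysis.

Set Implicit Arguments.
Unset Strict Implicit.
Unset Printing Implicit Defensive.

Import Order.TTheory GRing.Theory Num.Theory.
Import numFieldNormedType.Exports.

Local Open Scope classical_set_scope.
Local Open Scope complex_scope.
Local Open Scope ring_scope.

(* The library has the Borel sigma-algebra on n.-tuple R but no Lebesgue
   measure on it: it is built here as the n-fold product of the
   one-dimensional one, transported along (x, t) |-> x :: t. *)
Definition tcons (R : realType) (n : nat)
    (p : measurableTypeR R * n.-tuple (measurableTypeR R)) :
    n.+1.-tuple (measurableTypeR R) :=
  [tuple of p.1 :: p.2].

Fixpoint leb (R : realType) (n : nat) :
    set (n.-tuple (measurableTypeR R)) -> \bar R :=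
  match n with
  | 0 => dirac [tuple]
  | n'.+1 => pushforward (product_measure1 (@lebesgue_measure R)
                            (@leb R n')) (@tcons R n')
  end.

Lemma measurable_tcons (R : realType) (n : nat) :
  measurable_fun [set: measurableTypeR R * n.-tuple (measurableTypeR R)]
    (@tcons R n).
Proof.
exact: (measurable_cons (@measurable_fst _ _ _ _) (@measurable_snd _ _ _ _)).
Qed.

Lemma measurable_thead (R : realType) (n : nat) :
  measurable_fun [set: n.+1.-tuple (measurableTypeR R)]
    (fun t => (thead t, [tuple of behead t])).
Proof.
apply/measurable_fun_pairP; split => /=.
  exact: measurable_tnth.
exact: measurable_behead.
Qed.

Lemma tconsK (R : realType) (n : nat) :
  cancel (@tcons R n) (fun t => (thead t, [tuple of behead t])).
Proof. by case=> x t; rewrite /tcons/= theadE; congr (_, _); apply/val_inj. Qed.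

(* Not exported by the library, where it is local to a section. *)
Lemma sigma_finite_product (R : realType) d1 d2 (T1 : measurableType d1)
    (T2 : measurableType d2) (m1 : {sigma_finite_measure set T1 -> \bar R})
    (m2 : {sigma_finite_measure set T2 -> \bar R}) :
  sigma_finite setT (product_measure1 m1 m2).
Proof.
have /sigma_finiteP[F [TF ndF Foo]] := sigma_finiteT m1.
have /sigma_finiteP[G [TG ndG Goo]] := sigma_finiteT m2.
exists (fun n => F n `*` G n).
  rewrite -setXTT TF TG predeqE => -[x y]; split.
    move=> [/= [n _ Fnx] [k _ Gky]]; exists (maxn n k) => //; split.
    - by move: x Fnx; exact/subsetPset/ndF/leq_maxl.
    - by move: y Gky; exact/subsetPset/ndG/leq_maxr.
  by move=> [n _ []/= ? ?]; split; exists n.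
move=> k; have [? ?] := Foo k; have [? ?] := Goo k.
split; first exact: measurableX.
by rewrite product_measure1E// lte_mul_pinfty// ge0_fin_numE.
Qed.

Lemma leb_measure (R : realType) (n : nat) :
  exists mu : {sigma_finite_measure set (n.-tuple (measurableTypeR R)) -> \bar R},
    mu = @leb R n :> (set _ -> \bar R).
Proof.
elim: n => [|n [mu /= <-]].
  by eexists (dirac [tuple] : {sigma_finite_measure set _ -> \bar R}).
pose pm : {measure
    set (measurableTypeR R * n.-tuple (measurableTypeR R))%type -> \bar R} :=
  (@lebesgue_measure R \x mu)%E.
pose m : {measure set _ -> \bar R} :=
  @measure_function_pushforward__canonical__measure_function_Measure
    _ _ _ _ R pm _ (@measurable_tcons R n).
have sm : sigma_finite setT m.
  have [F FT Ffin] := sigma_finite_product (@lebesgue_measure R) mu.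
  pose g (t : n.+1.-tuple (measurableTypeR R)) :=
    (thead t, [tuple of behead t]).
  exists (fun i => g @^-1` F i) => [|i].
    by rewrite -preimage_bigcup -FT preimage_setT.
  have [mF Foo] := Ffin i; split.
    by rewrite -[X in measurable X]setTI; exact: measurable_thead.
  rewrite /m /= /pushforward -comp_preimage.
  rewrite (_ : _ \o _ = id) ?preimage_id//.
  by apply/funext => p; exact: tconsK.
pose sfm := Measure_isSigmaFinite.Build _ _ _ m sm.
pose mu' : {sigma_finite_measure set _ -> \bar R} := HB.pack (m : set _ -> \bar R) m sfm.
by exists mu'.
Qed.

Section leb_instances.
Context (R : realType) (n : nat).

Let leb0 : @leb R n set0 = 0%E :> \bar R.
Proof. by have [mu <-] := @leb_measure R n. Qed.

Let leb_ge0 (A : set (n.-tuple (measurableTypeR R))) : (0 <= @leb R n A)%E.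
Proof. by have [mu <-] := @leb_measure R n. Qed.

Let leb_additive : semi_sigma_additive (@leb R n).
Proof.
have [mu <-] := @leb_measure R n.
exact: measure_semi_sigma_additive.
Qed.

HB.instance Definition _ := isMeasure.Build _ _ _ (@leb R n)
  leb0 leb_ge0 leb_additive.

Let leb_sigma_finite : sigma_finite setT (@leb R n).
Proof.
by have [mu <-] := @leb_measure R n; exact: sigma_finiteT.
Qed.

HB.instance Definition _ := Measure_isSigmaFinite.Build _ _ _ (@leb R n)
  leb_sigma_finite.

End leb_instances.
Lemma lebS (R : realType) (n : nat) :
  @leb R n.+1 =
  pushforward (product_measure1 (@lebesgue_measure R) (@leb R n)) (@tcons R n).
Proof. by []. Qed.

Lemma leb_prod (R : realType) (n : nat) (A : 'I_n -> set (measurableTypeR R)) :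
  (forall i, measurable (A i)) ->
  leb [set t | forall i, A i (tnth t i)] =
  (\prod_(i < n) lebesgue_measure (A i))%E.
Proof.
elim: n A => [|n IHn] A mA.
  by rewrite big_ord0 /= diracE mem_set//; case.
rewrite big_ord_recl -IHn// lebS /pushforward.
have [mu muE] := @leb_measure R n; rewrite -muE.
rewrite -product_measure1E//; last first.
  rewrite (_ : [set t | _] =
      \bigcap_(i in [set: 'I_n]) ((@tnth n _)^~ i @^-1` A (lift ord0 i))).
    apply: fin_bigcap_measurable => // i _.
    by rewrite -[X in measurable X]setTI; exact: measurable_tnth.
  by apply/seteqP; split => t /= At i; [move=> _|]; apply: At.
congr product_measure1; apply/seteqP; split => -[x t] /=.
  move=> At; split => [|i]; first exact: (At ord0).
  by have := At (lift ord0 i); rewrite tnthS.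
move=> [Ax At] i; have [j ->|->//] := unliftP ord0 i.
by rewrite tnthS; exact: At.
Qed.

Definition rV_of_tuple (R : realType) (d : nat)
    (t : d.-tuple (measurableTypeR R)) : 'rV[R]_d :=
  \row_i tnth t i.

Definition Rd_integral (R : realType) (d : nat) (f : 'rV[R]_d -> R) : R :=
  \int[@leb R d]_t f (rV_of_tuple t).

Definition Linfty_norm (R : realType) (d : nat) (f : 'rV[R]_d -> R) : \bar R :=
  Lnorm (@leb R d) +oo%E (fun t => (f (rV_of_tuple t))%:E).

(* The norm of the library on 'rV[R]_d is the maximum norm. *)
Definition dotmul (R : realType) (d : nat) (x y : 'rV[R]_d) : R :=
  \sum_(i < d) x 0 i * y 0 i.

Definition euclidean_norm (R : realType) (d : nat) (x : 'rV[R]_d) : R :=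
  Num.sqrt (dotmul x x).

Definition Rd_cintegral (R : realType) (d : nat) (F : 'rV[R]_d -> R[i]) : R[i] :=
  Rd_integral (fun x => complex.Re (F x)) +i*
  Rd_integral (fun x => complex.Im (F x)).

Definition cexpi (R : realType) (a : R) : R[i] := cos a +i* sin a.

Definition fourier (R : realType) (d : nat) (f : 'rV[R]_d -> R)
    (xi : 'rV[R]_d) : R[i] :=
  Rd_cintegral (fun x => (f x)%:C * cexpi (- dotmul xi x)).

Definition inverse_fourier (R : realType) (d : nat) (F : 'rV[R]_d -> R[i])
    (x : 'rV[R]_d) : R[i] :=
  (((2 * pi) ^+ d)^-1)%:C *
  Rd_cintegral (fun xi => F xi * cexpi (dotmul xi x)).

Definition fourier_multiplier (R : realType) (d : nat) (m : 'rV[R]_d -> R)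
    (f : 'rV[R]_d -> R) : 'rV[R]_d -> R[i] :=
  inverse_fourier (fun xi => (m xi)%:C * fourier f xi).

Definition A_symbol (R : realType) (d : nat) (gamma beta lambda : R)
    (xi : 'rV[R]_d) : R :=
  euclidean_norm xi `^ gamma / ln (lambda + euclidean_norm xi) `^ beta.

(* C^oo on the open set U: all iterated directional derivatives exist and are
   continuous at the points of U. *)
Definition iter_derive (R : realType) (V : normedModType R) (f : V -> R)
    (vs : seq V) : V -> R :=
  foldr (fun v g => 'D_v g) f vs.

Definition smooth_on (R : realType) (V : normedModType R) (U : set V)
    (f : V -> R) : Prop :=
  forall (vs : seq V) (p : V), U p ->
    {for p, continuous (iter_derive f vs)} /\
    forall v : V, derivable (iter_derive f vs) p v.

Definition test_function (R : realType) (d : nat) (phi : 'rV[R]_d -> R) : Prop :=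
  smooth_on setT phi /\
  exists r : R, forall x, r < euclidean_norm x -> phi x = 0.

(* The Fourier integral of a function that merely tends to 0 at infinity need
   not exist.  For such f, A f is defined by duality, A being symmetric (its
   symbol is real and even): g is the continuous function with
   <g, phi> = <f, A phi> for all phi in C_c^oo, where A phi is given by the
   Fourier integrals.  (A phi is integrable, so the right-hand side makes sense
   for every bounded continuous f.) *)
Definition is_A_of (R : realType) (d : nat) (gamma beta lambda : R)
    (f g : 'rV[R]_d -> R) : Prop :=
  continuous g /\
  forall phi : 'rV[R]_d -> R, test_function phi ->
    (Rd_integral (fun x => g x * phi x))%:C =
    Rd_cintegral (fun x =>
      (f x)%:C * fourier_multiplier (A_symbol gamma beta lambda) phi x).

Definition time_derivative (R : realType) (d : nat)
    (theta : R -> 'rV[R]_d -> R) (t : R) (x : 'rV[R]_d) : R :=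
  derive1 (fun s => theta s x) t.

Definition gradient (R : realType) (d : nat) (f : 'rV[R]_d -> R)
    (x : 'rV[R]_d) : 'rV[R]_d :=
  \row_i 'D_(delta_mx 0 i) f x.

Definition decays_at_infinity (R : realType) (d : nat) (f : 'rV[R]_d -> R) : Prop :=
  forall e : R, 0 < e ->
    exists r : R, forall x, r <= euclidean_norm x -> `|f x| < e.

(* The third clause, continuity of the norm of t |-> theta(t) in L^oo, is not a
   consequence of the joint regularity and of the decay of each theta(t): with
   a smooth unbounded v, a bump chi(x - 1/(t-1)), t > 1, can enter from
   infinity at t = 1 and solves the equation with nu = 0 and theta0 = 0. *)
Definition smooth_solution (R : realType) (d : nat)
    (nu gamma beta lambda : R) (v : R -> 'rV[R]_d -> 'rV[R]_d)
    (theta : R -> 'rV[R]_d -> R) (theta0 : 'rV[R]_d -> R) : Prop :=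
  [/\ smooth_on [set p : R * 'rV[R]_d | 0 < p.1] (fun p => theta p.1 p.2),
      {within [set p : R * 'rV[R]_d | 0 <= p.1],
        continuous (fun p : R * 'rV[R]_d => theta p.1 p.2)},
      {within `[0, +oo[, continuous (fun t : R => Linfty_norm (theta t))},
      forall x, theta 0 x = theta0 x &
      exists Atheta : R -> 'rV[R]_d -> R,
        forall t : R, 0 < t ->
          is_A_of gamma beta lambda (theta t) (Atheta t) /\
          forall x, time_derivative theta t x
                    + dotmul (v t x) (gradient (theta t) x)
                    + nu * Atheta t x = 0].

(* Main.v *)
Require Import Defs.
From mathcomp Require Import all_boot all_order all_algebra.
From mathcomp Require Import complex.
From mathcomp Require Import all_classical all_reals all_analysis.
From mathcomp Require Import measurable_realfun ess_sup_inf.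
From mathcomp Require Import ring lra.

(** The sup norm can only grow through the nonlocal term. At a point where
    [|theta t|] attains its maximum [M] the gradient vanishes, so the equation
    reduces there to [d_t theta = - nu * A theta], and the claim follows if the
    sign of [theta] times [A theta] is at least [- C0 * M] at some such point, with
    [C0] independent of [theta]. When [beta = 0] this holds with [C0 = 0], because
    [- |nabla|^gamma] generates averages; the logarithm destroys this exact
    positivity, but not the bound with [C0 = 2 * lambda^gamma * (ln lambda)^(-beta)].

    The bound comes from the structure of the symbol. Write [s = |xi|].
    - A multiplier [cos (xi . y)] is the average of two translations, hence does not
      increase suprema ([sup_contractive_cos]). Functions of such averages with
      nonnegative Taylor coefficients have the same property, with constant their
      value at frequency [0] ([sup_contractive_am]). Replacing [s^2] by the lattice
      Laplacian, which is an affine function of an average of cosines, and letting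
      the mesh go to [0], gives many radial examples.
    - For [a <= g <= 2] the symbol [s^g (lambda + s)^(-a)] is a limit of differences
      [q(0) - q] with [q] of this kind, so its operator is nonnegative at a maximum
      ([almost_accretive_profile]). For [a >= g] the symbol is a difference of two
      multipliers each of which increases suprema by at most [lambda^(g-a)]
      ([almost_accretive_profile_bounded]).
    - Since [ln t] is the limit of [n (1 - t^(-1/n))] and [(1 - y)^(-beta)] has
      nonnegative Taylor coefficients, [(ln t)^(-beta)] is a limit of combinations
      of negative powers [t^(-a)] with nonnegative weights
      ([log_symbol_approximation]). Adding up the losses for the individual powers
      gives [C0] ([almost_accretive_log_symbol]).

    The function [A theta] is only known through its pairings with test functions,
    and [theta] has no Fourier transform, so the bound is transported by duality.
    For an integrable [h] the function [x |-> int h * bump_x], with [bump_x] a bump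
    centred at [x], is a superposition of waves to which the previous bound
    applies; at its maximum [x0] it bounds [int h * A bump_x0] from below
    ([pairing_at_max]). Choosing [h] to be [1] near [x] and minus the sign of
    [A bump_x] elsewhere shows that [A bump_x] is integrable, uniformly in [x]
    ([multiplier_kernel_integrable]). Hence a decaying [theta] may be replaced by its
    restriction to a large cube, and letting the bumps shrink yields a maximum point
    of [theta] where the bound holds ([A_at_max]).

    Finally, let [C = nu * C0 + 1] and consider the norm multiplied by
    [exp (- C t)]. If it exceeded its initial value it would have a maximum at
    a positive time, and there the equation at the extremal point contradicts the
    growth that the maximum in time imposes. *)

Set Implicit Arguments.
Unset Strict Implicit.
Unset Printing Implicit Defensive.

Import Order.TTheory GRing.Theory Num.Theory.
Import numFieldNormedType.Exports.

Local Open Scope classical_set_scope.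
Local Open Scope ring_scope.

(** * Absolutely monotone functions on the unit interval *)

(** Equivalently, [F] is given on [0, 1] by a power series with nonnegative
    coefficients. Approximation by polynomials is the form that passes to
    limits and that can be evaluated on a multiplier. *)
Definition absolutely_monotone (R : realType) (F : R -> R) : Prop :=
  forall e : R, 0 < e -> exists2 p : {poly R}, (forall i, 0 <= p`_i) &
    forall y, 0 <= y <= 1 -> `|F y - p.[y]| <= e.

Section absolutely_monotone_theory.
Context {R : realType}.
Implicit Types (F G : R -> R) (p q : {poly R}) (c e y z : R).

Lemma horner_ge0 p y : (forall i, 0 <= p`_i) -> 0 <= y -> 0 <= p.[y].
Proof.
by move=> p0 y0; rewrite horner_coef sumr_ge0// => i _; rewrite mulr_ge0// exprn_ge0.
Qed.

Lemma ler_horner p y z : (forall i, 0 <= p`_i) -> 0 <= y <= z -> p.[y] <= p.[z].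
Proof.
move=> p0 /andP[y0 yz]; rewrite !horner_coef ler_sum// => i _.
by rewrite ler_wpM2l// lerXn2r ?nnegrE// (le_trans y0).
Qed.

Lemma am_ge0 F y : absolutely_monotone F -> 0 <= y <= 1 -> 0 <= F y.
Proof.
move=> aF y01; rewrite leNgt; apply/negP => Fy.
have [|p p0 /(_ _ y01)] := aF (- F y / 2); first lra.
have : 0 <= p.[y] by apply: horner_ge0 => //; case/andP: y01.
by rewrite ler_norml; lra.
Qed.

Lemma am_le F y z : absolutely_monotone F -> 0 <= y -> y <= z -> z <= 1 -> F y <= F z.
Proof.
move=> aF y0 yz z1; apply/ler_addgt0Pr => e e0.
have [|p p0 pF] := aF (e / 2); first lra.
have y01 : 0 <= y <= 1 by lra.
have z01 : 0 <= z <= 1 by lra.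
have : p.[y] <= p.[z] by apply: ler_horner => //; rewrite y0.
by have := pF _ y01; have := pF _ z01; rewrite !ler_norml; lra.
Qed.

Lemma am_closed F :
  (forall e, 0 < e -> exists2 G, absolutely_monotone G &
     forall y, 0 <= y <= 1 -> `|F y - G y| <= e) ->
  absolutely_monotone F.
Proof.
move=> FG e e0; have [|G aG GF] := FG (e / 2); first lra.
have [|p p0 pG] := aG (e / 2); first lra.
exists p => // y y01; have := GF _ y01; have := pG _ y01.
by rewrite !ler_norml; lra.
Qed.

Lemma am_ext F G : (forall y, 0 <= y <= 1 -> F y = G y) ->
  absolutely_monotone F -> absolutely_monotone G.
Proof.
move=> FG aF; apply: am_closed => e e0; exists F => // y y01.
by rewrite FG// subrr normr0 ltW.
Qed.

Lemma am_poly p : (forall i, 0 <= p`_i) -> absolutely_monotone (horner p).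
Proof. by move=> p0 e e0; exists p => // y _; rewrite subrr normr0 ltW. Qed.

Lemma am_cst c : 0 <= c -> absolutely_monotone (fun=> c : R).
Proof.
move=> c0; apply: (@am_ext (horner c%:P)) => [y _|]; first by rewrite hornerC.
by apply: am_poly => i; rewrite coefC; case: ifP.
Qed.

Lemma am_id : absolutely_monotone (fun y : R => y).
Proof.
apply: (@am_ext (horner 'X)) => [y _|]; first by rewrite hornerX.
by apply: am_poly => i; rewrite coefX; case: eqP.
Qed.

Lemma amD F G : absolutely_monotone F -> absolutely_monotone G ->
  absolutely_monotone (fun y => F y + G y).
Proof.
move=> aF aG e e0.
have [|p p0 pF] := aF (e / 2); first lra.
have [|q q0 qG] := aG (e / 2); first lra.
exists (p + q) => [i|y y01]; first by rewrite coefD addr_ge0.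
have := pF _ y01; have := qG _ y01.
by rewrite hornerD !ler_norml; lra.
Qed.

(** [F] and [G] are increasing, hence bounded by their values at [1], which
    controls the error of the product of the approximations. *)
Lemma amM F G : absolutely_monotone F -> absolutely_monotone G ->
  absolutely_monotone (fun y => F y * G y).
Proof.
move=> aF aG e e0.
have F0 : 0 <= F 1 by apply: am_ge0 => //; rewrite ler01 lexx.
have G0 : 0 <= G 1 by apply: am_ge0 => //; rewrite ler01 lexx.
pose K := F 1 + G 1 + 1.
have K1 : 1 <= K by rewrite /K; lra.
(* the product errs by at most d * K, where K also absorbs the error on F *)
pose d := Num.min 1 (e / (2 * K)).
have d0 : 0 < d by rewrite lt_min ltr01 divr_gt0// mulr_gt0//; lra.
have d1 : d <= 1 by rewrite ge_min lexx.
have dK : d * K <= e / 2.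
  have : d <= e / (2 * K) by rewrite ge_min lexx orbT.
  by rewrite ler_pdivlMr; nra.
have [p p0 pF] := aF d d0.
have [q q0 qG] := aG d d0.
exists (p * q) => [i|y y01].
  by rewrite coefM sumr_ge0// => j _; rewrite mulr_ge0.
rewrite hornerM.
have FyK : 0 <= F y <= F 1 by rewrite am_ge0//= am_le//; lra.
have GyK : 0 <= G y <= G 1 by rewrite am_ge0//= am_le//; lra.
have -> : F y * G y - p.[y] * q.[y] =
  (F y - p.[y]) * G y + (F y - (F y - p.[y])) * (G y - q.[y]) by ring.
have h1 := pF _ y01; have h2 := qG _ y01.
apply: (le_trans (ler_normD _ _)); rewrite !normrM.
have GG : `|G y| <= G 1 by rewrite ger0_norm; lra.
have FF : `|F y - (F y - p.[y])| <= F 1 + 1.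
  by apply: (le_trans (ler_normB _ _)); rewrite ger0_norm; lra.
have A : `|F y - p.[y]| * `|G y| <= d * G 1 by rewrite ler_pM.
have B : `|F y - (F y - p.[y])| * `|G y - q.[y]| <= (F 1 + 1) * d by rewrite ler_pM.
apply: (le_trans (lerD A B)).
have -> : d * G 1 + (F 1 + 1) * d = d * K by rewrite /K; ring.
lra.
Qed.

Lemma am_sum n (F : nat -> R -> R) : (forall i, absolutely_monotone (F i)) ->
  absolutely_monotone (fun y => \sum_(0 <= i < n) F i y).
Proof.
move=> aF; elim: n => [|n ih].
  by apply: (am_ext _ (am_cst (lexx 0))) => y _; rewrite big_geq.
by apply: (am_ext _ (amD ih (aF n))) => y _; rewrite big_nat_recr.
Qed.

Lemma amX F n : absolutely_monotone F -> absolutely_monotone (fun y => F y ^+ n).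
Proof.
move=> aF; elim: n => [|n ih]; first by apply: am_ext (am_cst ler01) => y _; rewrite expr0.
by apply: (am_ext _ (amM aF ih)) => y _; rewrite exprS.
Qed.

Lemma amZ c F : 0 <= c -> absolutely_monotone F ->
  absolutely_monotone (fun y => c * F y).
Proof. by move=> c0 aF; exact: (amM (am_cst c0) aF). Qed.

(** Geometric series in [F / c]; its remainder is largest at [1]. *)
Lemma am_inv c F : absolutely_monotone F -> F 1 < c ->
  absolutely_monotone (fun y => (c - F y)^-1).
Proof.
move=> aF F1c; apply: am_closed => e e0.
have F10 : 0 <= F 1 by apply: am_ge0 => //; rewrite ler01 lexx.
have c0 : 0 < c by exact: le_lt_trans F1c.
pose z := F 1 / c.
have z0 : 0 <= z by rewrite divr_ge0// ltW.
have z1 : `|z| < 1 by rewrite ger0_norm// ltr_pdivrMr// mul1r.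
have [n _ /(_ n (leqnn n)) /= zn] : \forall n \near \oo, z ^+ n / (c - F 1) < e.
  have : (fun n => z ^+ n / (c - F 1)) @ \oo --> 0.
    by rewrite -[X in _ --> X](mul0r (c - F 1)^-1); apply: cvgMr_tmp; exact: cvg_expr.
  by move/cvgr_lt; apply.
exists (fun y => \sum_(0 <= k < n) c^-1 ^+ k.+1 * F y ^+ k).
  by apply: am_sum => k; apply: amZ; [rewrite exprn_ge0// invr_ge0 ltW|exact: amX].
move=> y y01.
have Fy0 : 0 <= F y by exact: am_ge0.
have FyF1 : F y <= F 1 by apply: am_le => //; lra.
have -> : \sum_(0 <= k < n) c^-1 ^+ k.+1 * F y ^+ k =
   (1 - (F y / c) ^+ n) / (c - F y).
  have -> : \sum_(0 <= k < n) c^-1 ^+ k.+1 * F y ^+ k =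
      c^-1 * \sum_(k < n) (F y / c) ^+ k.
    rewrite big_mkord mulr_sumr; apply: eq_bigr => k _.
    by rewrite expr_div_n exprS exprVn; ring.
  have /(congr1 (fun x => x / (c - F y))) := subrX1 (F y / c) n.
  set u := _ ^+ n => h; rewrite (_ : (1 - u) / _ = - ((u - 1) / (c - F y))); last ring.
  rewrite h; set v := \sum_(_ < _) _.
  by field; lra.
rewrite (_ : _ - _ = (F y / c) ^+ n / (c - F y)); last by set u := _ ^+ n; ring.
rewrite ger0_norm; last first.
  by rewrite divr_ge0 ?exprn_ge0// ?divr_ge0 ?(ltW c0)//; lra.
apply/ltW/(le_lt_trans _ zn); rewrite ler_pM//.
- by rewrite exprn_ge0// divr_ge0// ltW.
- by rewrite invr_ge0; lra.
- by rewrite lerXn2r ?nnegrE ?divr_ge0// ?(ltW c0)// ler_pM2r ?invr_gt0.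
- by rewrite lef_pV2 ?posrE; lra.
Qed.

(** The remainders of the exponential series are increasing in [F y], so that
    convergence at [1] implies uniform convergence. *)
Lemma am_expR F : absolutely_monotone F -> absolutely_monotone (fun y => expR (F y)).
Proof.
move=> aF; apply: am_closed => e e0.
have F10 : 0 <= F 1 by apply: am_ge0 => //; rewrite ler01 lexx.
have cB (x : R) : series (exp_coeff x) @ \oo --> expR x by exact: is_cvg_series_exp_coeff.
have [n _ /(_ n (leqnn n)) /= hn] :
    \forall n \near \oo, expR (F 1) - e < series (exp_coeff (F 1)) n.
  by apply: cvgr_gt; [exact: cB|lra].
exists (fun y => series (exp_coeff (F y)) n).
  apply: am_sum => k; apply: (am_ext (F := fun y => (k`!%:R)^-1 * F y ^+ k)).
    by move=> y _; rewrite /exp_coeff/= mulrC.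
  by apply: amZ; [rewrite invr_ge0|exact: amX].
move=> y y01.
have Fy0 : 0 <= F y by exact: am_ge0.
have FyF1 : F y <= F 1 by apply: am_le => //; lra.
have sle m : (n <= m)%N ->
    0 <= series (exp_coeff (F y)) m - series (exp_coeff (F y)) n <=
    series (exp_coeff (F 1)) m - series (exp_coeff (F 1)) n.
  move=> nm; rewrite /series/= !sub_series_geq//.
  rewrite sumr_ge0//= => [|k _]; last by rewrite exp_coeff_ge0.
  rewrite ler_sum// => k _; rewrite /exp_coeff/= ler_wpM2r ?invr_ge0//.
  by rewrite lerXn2r ?nnegrE.
have c1 (x : R) : (fun m => series (exp_coeff x) m - series (exp_coeff x) n) @ \oo -->
    expR x - series (exp_coeff x) n by apply: cvgB; [exact: cB|exact: cvg_cst].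
have h0 : 0 <= expR (F y) - series (exp_coeff (F y)) n.
  refine (cvgr_to_ge (c1 (F y)) _).
  by exists n => // m /= /sle/andP[].
have h1 : expR (F y) - series (exp_coeff (F y)) n <=
    expR (F 1) - series (exp_coeff (F 1)) n.
  refine (ler_cvg_to (c1 (F y)) (c1 (F 1)) _).
  by exists n => // m /= /sle/andP[].
by rewrite ger0_norm//; lra.
Qed.

Lemma poly_primitive p : (forall i, 0 <= p`_i) ->
  exists2 q : {poly R}, q^`() = p & forall i, 0 <= q`_i.
Proof.
move=> p0; exists (\poly_(i < (size p).+1) (p`_i.-1 / i%:R * (i != 0)%:R)).
  apply/polyP => i; rewrite coef_deriv coef_poly ltnS.
  case: ltnP => [_|ip]; last by rewrite mul0rn nth_default.
  by rewrite /= mulr1 -[LHS]mulr_natr divfK.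
move=> i; rewrite coef_poly; case: ifP => // _.
by rewrite !mulr_ge0 ?invr_ge0.
Qed.

(** Integration preserves the sign of the coefficients, and by the mean value
    theorem an error [e] on the derivative costs at most [e] on the unit
    interval. *)
Lemma am_primitive F G : 0 <= F 0 -> absolutely_monotone G ->
  (forall y, 0 <= y <= 1 -> is_derive y (1 : R) F (G y)) -> absolutely_monotone F.
Proof.
move=> F0 aG dF e e0; have [p p0 pG] := aG e e0.
have [q qp q0] := poly_primitive p0.
pose r := q + (F 0 - q.[0])%:P.
have rE y : r.[y] = q.[y] - q.[0] + F 0 by rewrite hornerD hornerC; ring.
have q00 : q.[0] = q`_0 by rewrite horner_coef0.
exists r => [i|y y01].
  rewrite coefD coefC; case: eqP => [->|_]; last by rewrite addr0.
  by rewrite q00; lra.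
have dFr z : 0 <= z <= 1 -> is_derive z (1 : R) (F - horner r) (G z - p.[z]).
  move=> z01; have dr : is_derive z (1 : R) (horner r) p.[z].
    apply: (is_derive_eq (is_derive_poly r z)).
    by rewrite derivD derivC addr0 qp.
  exact: (is_deriveB (dF _ z01) dr).
have y0 : 0 <= y by case/andP: y01.
have [||c] := @MVT_segment R (F - horner r) (fun z => G z - p.[z]) 0 y y0.
- by move=> z; rewrite in_itv/= => z0y; apply: dFr; lra.
- apply: derivable_within_continuous => z; rewrite in_itv/= => z0y.
  by have [|] := dFr z; first lra.
rewrite in_itv/= => c0y; rewrite !fctE !rE subrr add0r subrr subr0 => ->.
rewrite normrM subr0 (ger0_norm y0).
have := pG c; rewrite -[X in _ -> _ <= X]mulr1 => h.
by rewrite ler_pM// ?h; lra.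
Qed.
End absolutely_monotone_theory.

(** * Sup-contractive and almost accretive multipliers *)

Section real_integrals.
Context d (T : measurableType d) (R : realType) (mu : {measure set T -> \bar R}).
Implicit Types f g : T -> R.

Lemma integrable_bounded_by f g : measurable_fun setT f ->
  mu.-integrable setT (EFin \o g) -> (forall t, `|f t| <= g t) ->
  mu.-integrable setT (EFin \o f).
Proof.
move=> mf ig fg; apply: le_integrable ig => //=; first exact/measurable_EFinP.
by move=> t _; rewrite lee_fin (le_trans (fg t))// ler_norm.
Qed.

Lemma integrable_measurable f : mu.-integrable setT (EFin \o f) -> measurable_fun setT f.
Proof. by move=> /integrableP[/measurable_EFinP]. Qed.

Lemma integrable_addr f g : mu.-integrable setT (EFin \o f) ->
  mu.-integrable setT (EFin \o g) -> mu.-integrable setT (EFin \o (fun t => f t + g t)).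
Proof.
move=> if_ ig; rewrite (_ : _ \o _ = (EFin \o f) \+ (EFin \o g))%E; last first.
  by apply/funext => t /=; rewrite EFinD.
exact: integrableD.
Qed.

Lemma integrable_mull c f : mu.-integrable setT (EFin \o f) ->
  mu.-integrable setT (EFin \o (fun t => c * f t)).
Proof.
move=> if_; rewrite (_ : _ \o _ = (fun t => c%:E * (EFin \o f) t)%E); last first.
  by apply/funext => t /=; rewrite EFinM.
exact: integrableZl.
Qed.

Lemma Rintegral_cvg (f_ : nat -> T -> R) f g :
  (forall n, measurable_fun setT (f_ n)) ->
  mu.-integrable setT (EFin \o g) -> (forall n t, `|f_ n t| <= g t) ->
  (forall t, f_ n t @[n --> \oo] --> f t) ->
  \int[mu]_t f_ n t @[n --> \oo] --> \int[mu]_t f t.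
Proof.
move=> mf ig fg cf.
have mfl : measurable_fun setT f.
  by apply: (measurable_fun_cvg mf) => t _; exact: cf.
have [|||||] := @dominated_convergence _ _ _ mu setT measurableT
    (fun n => EFin \o f_ n) (EFin \o f) (EFin \o g).
- by move=> n; exact/measurable_EFinP.
- exact/measurable_EFinP.
- by apply: aeW => t _; apply: cvg_EFin; [exact: nearW|exact: cf].
- exact: ig.
- by apply: aeW => t n _ /=; rewrite lee_fin.
move=> if_ _ h; apply: fine_cvg.
by rewrite /Rintegral fineK//; exact: integrable_fin_num.
Qed.

End real_integrals.

Section waves.
Context {R : realType} {d : nat}.
Local Notation vec := 'rV[R]_d.
Local Notation frq := (d.-tuple (measurableTypeR R)).
Implicit Types (k : vec -> frq -> R) (m q : vec -> R).

(** The model is [k x xi = cos (xi . x) * g xi], with [g] decaying: averaging the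
    translates by [y] and [- y] multiplies by [cos (xi . y)]. The superposition
    [int k x xi d xi] then is a function of [x] on which multipliers act inside the
    integral, and the quadratic weight makes this legitimate for symbols of
    order at most 2. *)
Record wave k : Prop := Wave {
  wave_measurable : forall x, measurable_fun setT (k x);
  wave_dominated : exists2 G : frq -> R, (@leb R d).-integrable setT (EFin \o G) &
    forall x t, (1 + dotmul (rV_of_tuple t) (rV_of_tuple t)) * `|k x t| <= G t;
  wave_cos : forall x y t, cos (dotmul (rV_of_tuple t) y) * k x t =
    (k (x + y) t + k (x - y) t) / 2 }.

Definition superpose k (x : vec) : R := \int[@leb R d]_t k x t.

Definition filter m k : vec -> frq -> R := fun x t => m (rV_of_tuple t) * k x t.

Lemma dotmul_ge0 (x : vec) : 0 <= dotmul x x.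
Proof. by apply: sumr_ge0 => i _; rewrite -expr2 sqr_ge0. Qed.

Definition quadratic_growth (K : R) m :=
  forall x, `|m x| <= K * (1 + dotmul x x).

Lemma filter_measurable m k x : measurable_fun setT (m \o @rV_of_tuple R d) ->
  wave k -> measurable_fun setT (filter m k x).
Proof. by move=> mm wk; apply: measurable_funM => //; exact: wave_measurable. Qed.

Lemma quadratic_growth_ge0 K m : quadratic_growth K m -> 0 <= K.
Proof.
move=> /(_ 0) mK; have : 0 <= K * (1 + dotmul 0 (0 : vec)) by exact: le_trans mK.
by rewrite pmulr_lge0// ltr_pwDl// dotmul_ge0.
Qed.

Lemma filter_dominated K k : wave k -> 0 <= K ->
  exists2 G : frq -> R, (@leb R d).-integrable setT (EFin \o G) &
  forall m, quadratic_growth K m -> forall x t, `|filter m k x t| <= G t.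
Proof.
move=> wk K0; have [G iG kG] := wave_dominated wk.
exists (fun t => K * G t).
  exact: integrable_mull.
move=> m mK x t; rewrite normrM.
apply: (le_trans (ler_wpM2r (normr_ge0 _) (mK _))).
by rewrite -mulrA ler_wpM2l.
Qed.

Lemma filter_integrable K m k x : measurable_fun setT (m \o @rV_of_tuple R d) ->
  quadratic_growth K m -> wave k ->
  (@leb R d).-integrable setT (EFin \o filter m k x).
Proof.
move=> mm mK wk; have K0 := quadratic_growth_ge0 mK.
have [G iG mG] := filter_dominated wk K0.
by apply: integrable_bounded_by iG (mG _ mK x); exact: filter_measurable.
Qed.

Lemma bounded_quadratic_growth c m : (forall x, `|m x| <= c) -> quadratic_growth c m.
Proof.
move=> mc x; apply: (le_trans (mc x)).
have c0 : 0 <= c by exact: le_trans (mc 0).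
by rewrite ler_peMr// lerDl dotmul_ge0.
Qed.

Lemma filter1 k : filter (fun=> 1) k = k.
Proof. by apply/funext => x; apply/funext => t; rewrite /filter mul1r. Qed.

Lemma wave_integrable k x : wave k -> (@leb R d).-integrable setT (EFin \o k x).
Proof.
move=> wk; rewrite -(filter1 k).
apply: (@filter_integrable 1 (fun=> 1) k x) => //; first exact: measurable_cst.
by apply: bounded_quadratic_growth => y; rewrite normr1.
Qed.

Lemma wave_filter c q k : measurable_fun setT (q \o @rV_of_tuple R d) ->
  (forall x, `|q x| <= c) -> wave k -> wave (filter q k).
Proof.
move=> mq qc wk; have c0 : 0 <= c by exact: le_trans (qc 0).
split=> [x||x y t].
- exact: filter_measurable.
- have [G iG kG] := wave_dominated wk; exists (fun t => c * G t).
    exact: integrable_mull.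
  move=> x t; rewrite normrM mulrCA ler_pM// ?kG//.
  by rewrite mulr_ge0// addr_ge0// dotmul_ge0.
- by rewrite /filter mulrCA (wave_cos wk); ring.
Qed.

Lemma waveN k : wave k -> wave (fun x t => - k x t).
Proof.
move=> wk; have := @wave_filter 1 (fun=> -1) k.
rewrite (_ : filter _ k = (fun x t => - k x t)); last first.
  by apply/funext => x; apply/funext => t; rewrite /filter mulN1r.
by apply => // [|x]; [exact: measurable_cst|rewrite normrN1].
Qed.

Lemma superposeN k x : wave k -> superpose (fun x t => - k x t) x = - superpose k x.
Proof.
move=> wk; rewrite /superpose -[RHS]mulN1r -RintegralZl//; last exact: wave_integrable.
by apply: eq_Rintegral => t _; rewrite mulN1r.
Qed.

(** These multipliers act like the convolution with a positive measure of
    mass [c], which is expressed by the preservation of one-sided bounds. *)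
Record sup_contractive (c : R) q : Prop := SupContractive {
  scontr_measurable : measurable_fun setT (q \o @rV_of_tuple R d);
  scontr_bounded : forall x, `|q x| <= c;
  scontr_le : forall k B, wave k -> (forall x, superpose k x <= B) ->
    forall x, superpose (filter q k) x <= c * B }.

Lemma dotmulDr (x y z : vec) : dotmul x (y + z) = dotmul x y + dotmul x z.
Proof. by rewrite /dotmul -big_split/=; apply: eq_bigr => i _; rewrite mxE mulrDr. Qed.

Lemma measurable_dotmul (y : vec) :
  measurable_fun setT (fun t : frq => dotmul (rV_of_tuple t) y).
Proof.
apply: measurable_sum => i; apply: measurable_funM; last exact: measurable_cst.
under eq_fun do rewrite mxE.
exact: measurable_tnth.
Qed.

Lemma sup_contractive_cst c : 0 <= c -> sup_contractive c (fun=> c).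
Proof.
move=> c0; split=> [|x|k B wk kB x]; first exact: measurable_cst.
  by rewrite ger0_norm.
rewrite /superpose RintegralZl//; last exact: wave_integrable.
by rewrite ler_wpM2l// kB.
Qed.

(** This multiplier averages the translations by [y] and [- y]. *)
Lemma sup_contractive_cos (y : vec) : sup_contractive 1 (fun x => cos (dotmul x y)).
Proof.
split=> [|x|k B wk kB x].
- apply: measurableT_comp; last exact: measurable_dotmul.
  by apply: continuous_measurable_fun; exact: continuous_cos.
- by rewrite ler_norml cos_geN1 cos_le1.
- rewrite /superpose /filter.
  under eq_Rintegral do rewrite (wave_cos wk).
  rewrite RintegralZr//; last first.
    by apply: integrable_addr; exact: wave_integrable.
  rewrite RintegralD//; [|exact: wave_integrable..].
  by have := kB (x + y); have := kB (x - y); rewrite /superpose; lra.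
Qed.

Lemma sup_contractiveD c1 c2 q1 q2 : sup_contractive c1 q1 -> sup_contractive c2 q2 ->
  sup_contractive (c1 + c2) (fun x => q1 x + q2 x).
Proof.
move=> [m1 b1 l1] [m2 b2 l2]; split=> [|x|k B wk kB x].
- exact: measurable_funD.
- by rewrite (le_trans (ler_normD _ _))// lerD.
- rewrite /superpose /filter; under eq_Rintegral do rewrite mulrDl.
  rewrite RintegralD//; last 2 first.
  + by apply: (filter_integrable _ m1 (bounded_quadratic_growth b1)).
  + by apply: (filter_integrable _ m2 (bounded_quadratic_growth b2)).
  by rewrite mulrDl lerD//; [apply: l1|apply: l2].
Qed.

Lemma sup_contractiveM c1 c2 q1 q2 : sup_contractive c1 q1 -> sup_contractive c2 q2 ->
  sup_contractive (c1 * c2) (fun x => q1 x * q2 x).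
Proof.
move=> [m1 b1 l1] [m2 b2 l2]; split=> [|x|k B wk kB x].
- exact: measurable_funM.
- by rewrite normrM ler_pM.
- have -> : filter (fun x => q1 x * q2 x) k = filter q1 (filter q2 k).
    by apply/funext => z; apply/funext => t; rewrite /filter mulrA.
  rewrite -mulrA; apply: l1; first exact: wave_filter b2 wk.
  by move=> z; exact: l2.
Qed.

(** Waves are dominated uniformly, so superpositions converge. *)
Lemma sup_contractive_lim (c_ : nat -> R) (q_ : nat -> vec -> R) c q :
  (forall n, sup_contractive (c_ n) (q_ n)) ->
  c_ n @[n --> \oo] --> c -> (forall x, q_ n x @[n --> \oo] --> q x) ->
  sup_contractive c q.
Proof.
move=> qn cc cq.
have mq : measurable_fun setT (q \o @rV_of_tuple R d).
  apply: (measurable_fun_cvg (fun n => scontr_measurable (qn n))) => t _.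
  exact: cq.
have [K K0 cK] : exists2 K, 0 <= K & forall n, c_ n <= K.
  have : cvgn c_ by apply/cvg_ex; exists c.
  move/cvg_seq_bounded => [M [_ /(_ (M + 1))]].
  rewrite ltrDl ltr01 => /(_ isT) cM; exists (M + 1).
    by apply: le_trans (cM 0%N I).
  by move=> n; apply: le_trans (ler_norm _) (cM n I).
split=> // [x|k B wk kB x].
  apply: ler_cvg_to (cvg_norm (cq x)) cc _.
  by apply: nearW => n; exact: scontr_bounded.
apply: ler_cvg_to (cvgMr_tmp (b := B) cc) _; last first.
  by apply: nearW => n; apply: (scontr_le (qn n) wk kB x).
have [G iG mG] := filter_dominated wk K0.
apply: Rintegral_cvg iG _ _ => [n|n t|t].
- by apply: filter_measurable => //; exact: scontr_measurable (qn n).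
- apply: mG; apply: bounded_quadratic_growth => z.
  by apply: le_trans (cK n); exact: scontr_bounded.
- by apply: cvgMr_tmp; exact: cq.
Qed.

(** When [- m] is the symbol of the generator of an averaging semigroup this holds
    with [C = 0], by the positive maximum principle; [C] measures the defect. *)
Record almost_accretive (C : R) m : Prop := AlmostAccretive {
  aacc_measurable : measurable_fun setT (m \o @rV_of_tuple R d);
  aacc_growth : exists K, quadratic_growth K m;
  aacc_ge : forall k B x0, wave k -> (forall x, `|superpose k x| <= B) ->
    (forall x, superpose k x <= superpose k x0) ->
    - (C * B) <= superpose (filter m k) x0 }.

(** At a maximum point, an average is at most [c] times the value there. *)
Lemma almost_accretive_cstB c q : sup_contractive c q ->
  almost_accretive 0 (fun x => c - q x).
Proof.
move=> [mq bq lq]; have c0 : 0 <= c by exact: le_trans (bq 0).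
split=> [||k B x0 wk kB kx0].
- by apply: measurable_funB => //; exact: measurable_cst.
- exists (c + c); apply: bounded_quadratic_growth => x.
  by rewrite (le_trans (ler_normB _ _))// lerD// ger0_norm.
- rewrite mul0r oppr0 /superpose /filter; under eq_Rintegral do rewrite mulrBl.
  rewrite RintegralB//; last 2 first.
  + apply: (filter_integrable (m := fun=> c) (K := c) _ _ _ wk).
      exact: measurable_cst.
    by apply: bounded_quadratic_growth => x; rewrite ger0_norm.
  + by apply: (filter_integrable _ mq (bounded_quadratic_growth bq)).
  rewrite RintegralZl//; last exact: wave_integrable.
  by rewrite subr_ge0; apply: lq.
Qed.

Lemma sup_contractive_almost_accretive c q : sup_contractive c q -> almost_accretive c q.
Proof.
move=> [mq bq lq]; split=> [//||k B x0 wk kB kx0].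
  by exists c; exact: bounded_quadratic_growth.
have wNk := waveN wk.
have := lq _ B wNk _ x0; rewrite lerNl.
have -> : filter q (fun x t => - k x t) = fun x t => - filter q k x t.
  by apply/funext => z; apply/funext => t; rewrite /filter mulrN.
rewrite superposeN; last exact: wave_filter bq wk.
by apply => x; rewrite superposeN// lerNl; have := kB x; rewrite ler_norml => /andP[].
Qed.

Lemma sup_contractive_almost_accretiveN c q : sup_contractive c q ->
  almost_accretive c (fun x => - q x).
Proof.
move=> [mq bq lq]; split=> [||k B x0 wk kB kx0].
- exact: measurableT_comp.
- by exists c; apply: bounded_quadratic_growth => x; rewrite normrN.
have -> : filter (fun x => - q x) k = fun x t => - filter q k x t.
  by apply/funext => z; apply/funext => t; rewrite /filter mulNr.
rewrite superposeN; last exact: wave_filter bq wk.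
by rewrite lerN2; apply: lq => // x; have := kB x; rewrite ler_norml => /andP[].
Qed.

Lemma almost_accretiveD C1 C2 m1 m2 :
  almost_accretive C1 m1 -> almost_accretive C2 m2 ->
  almost_accretive (C1 + C2) (fun x => m1 x + m2 x).
Proof.
move=> [mm1 [K1 g1] l1] [mm2 [K2 g2] l2]; split=> [||k B x0 wk kB kx0].
- exact: measurable_funD.
- exists (K1 + K2) => x.
  by rewrite (le_trans (ler_normD _ _))// mulrDl lerD.
- rewrite /superpose /filter; under eq_Rintegral do rewrite mulrDl.
  rewrite RintegralD//; last 2 first.
  + exact: (filter_integrable _ mm1 g1).
  + exact: (filter_integrable _ mm2 g2).
  by rewrite mulrDl opprD lerD//; [apply: l1|apply: l2].
Qed.

Lemma almost_accretiveZ a C m : 0 <= a -> almost_accretive C m ->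
  almost_accretive (a * C) (fun x => a * m x).
Proof.
move=> a0 [mm [K gK] l]; split=> [||k B x0 wk kB kx0].
- by apply: measurable_funM => //; exact: measurable_cst.
- by exists (a * K) => x; rewrite normrM ger0_norm// -mulrA ler_wpM2l.
- rewrite /superpose /filter; under eq_Rintegral do rewrite -mulrA.
  rewrite RintegralZl//; last exact: (filter_integrable _ mm gK).
  by rewrite -mulrA -mulrN ler_wpM2l//; exact: l.
Qed.

Lemma almost_accretive_lim (C_ : nat -> R) (m_ : nat -> vec -> R) C m K :
  (forall n, almost_accretive (C_ n) (m_ n)) ->
  (forall n, quadratic_growth K (m_ n)) ->
  C_ n @[n --> \oo] --> C -> (forall x, m_ n x @[n --> \oo] --> m x) ->
  almost_accretive C m.
Proof.
move=> mn gm cC cm.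
have K0 := quadratic_growth_ge0 (gm 0%N).
have mm : measurable_fun setT (m \o @rV_of_tuple R d).
  apply: (measurable_fun_cvg (fun n => aacc_measurable (mn n))) => t _.
  exact: cm.
split=> // [|k B x0 wk kB kx0].
  exists K => x; apply: cvgr_to_le (cvg_norm (cm x)) _.
  by apply: nearW => n; exact: gm.
have cCB : - (C_ n * B) @[n --> \oo] --> - (C * B) by apply: cvgN; exact: cvgMr_tmp.
apply: ler_cvg_to cCB _ _; last first.
  by apply: nearW => n; apply: (aacc_ge (mn n) wk kB kx0).
have [G iG mG] := filter_dominated wk K0.
apply: Rintegral_cvg iG _ _ => [n|n t|t].
- by apply: filter_measurable => //; exact: aacc_measurable (mn n).
- by apply: mG; exact: gm.
- by apply: cvgMr_tmp; exact: cm.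
Qed.

End waves.

(** * Absolutely monotone profiles *)

Section symbol_profiles.
Context {R : realType}.
Implicit Types (M K a b g lam y : R).

Lemma is_derive_affine K M y : is_derive y (1 : R) (fun y => K - M * y) (- M).
Proof.
have h : is_derive y (1 : R) (cst K - M *: id) (0 - M *: 1) by exact: is_deriveB.
by apply: (is_derive_eq h); rewrite sub0r /GRing.scale/= mulr1.
Qed.

(** The derivative [M / (K - M y)] is covered by [am_inv]. The functions treated
    next follow the same pattern: powers are exponentials of multiples of
    logarithms, and logarithms are primitives of inverses. *)
Lemma am_ln_affine M K : 0 <= M < K ->
  absolutely_monotone (fun y => ln K - ln (K - M * y)).
Proof.
move=> /andP[M0 MK].
apply: (am_primitive (G := fun y => M * (K - M * y)^-1)).
- by rewrite mulr0 subr0 subrr.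
- apply: amZ => //; apply: am_inv; last by rewrite mulr1.
  by apply: amZ => //; exact: am_id.
- move=> y /andP[y0 y1].
  have Ky : 0 < K - M * y by nra.
  have h := @is_derive1_comp R (@ln R) (fun y => K - M * y) y _ _
    (is_derive1_ln Ky) (is_derive_affine K M y).
  have h2 := is_deriveB (is_derive_cst (ln K) y 1) h.
  by apply: (is_derive_eq h2); rewrite sub0r mulrN opprK mulrC.
Qed.

Lemma powR_expR a x : 0 < x -> x `^ a = expR (a * ln x).
Proof. by move=> x0; rewrite /powR gt_eqF. Qed.

Lemma am_powR_affine M K b : 0 <= M < K -> 0 <= b ->
  absolutely_monotone (fun y => (K - M * y) `^ (- b)).
Proof.
move=> MK b0; have aL := am_ln_affine MK; case/andP: MK => M0 MK.
apply: (am_ext (F := fun y => K `^ (- b) * expR (b * (ln K - ln (K - M * y))))).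
  move=> y /andP[y0 y1]; have Ky : 0 < K - M * y by nra.
  rewrite !powR_expR//; last lra.
  by rewrite -expRD; congr expR; ring.
by apply: amZ; [exact: powR_ge0|apply: am_expR; exact: amZ].
Qed.

Lemma is_derive_sqrt_affine K M y : 0 < K - M * y ->
  is_derive y (1 : R) (fun y => Num.sqrt (K - M * y))
    (- (M / 2 * (K - M * y) `^ (- 2^-1))).
Proof.
move=> Ky; have h := @is_derive1_comp R Num.sqrt (fun y => K - M * y) y _ _
  (is_derive1_sqrt Ky) (is_derive_affine K M y).
apply: (is_derive_eq h); rewrite powRN powR12_sqrt ?(ltW Ky)//.
by field; rewrite gt_eqF// sqrtr_gt0.
Qed.

Lemma am_sqrt_affine M K : 0 <= M < K ->
  absolutely_monotone (fun y => Num.sqrt K - Num.sqrt (K - M * y)).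
Proof.
move=> /andP[M0 MK].
apply: (am_primitive (G := fun y => M / 2 * (K - M * y) `^ (- 2^-1))).
- by rewrite mulr0 subr0 subrr.
- apply: amZ; first by rewrite divr_ge0.
  by apply: am_powR_affine; [rewrite M0|rewrite invr_ge0].
- move=> y /andP[y0 y1]; have Ky : 0 < K - M * y by nra.
  have h := is_deriveB (is_derive_cst (Num.sqrt K) y 1) (is_derive_sqrt_affine Ky).
  by apply: (is_derive_eq h); rewrite sub0r opprK.
Qed.

Lemma am_inv_sqrt_affine M K lam : 0 <= M < K -> 0 < lam ->
  absolutely_monotone (fun y => (lam + Num.sqrt (K - M * y))^-1).
Proof.
move=> MK l0; have aS := am_sqrt_affine MK; case/andP: MK => M0 MK.
have := am_inv (c := lam + Num.sqrt K) aS.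
rewrite mulr1 ltrBlDr => h.
apply: (am_ext _ (h _)); last by have := sqrtr_ge0 (K - M); lra.
by move=> y _; congr (_^-1); ring.
Qed.

Lemma am_powR_sqrt_affine M K lam a : 0 <= M < K -> 0 < lam -> 0 <= a ->
  absolutely_monotone (fun y => (lam + Num.sqrt (K - M * y)) `^ (- a)).
Proof.
move=> MK l0 a0; have aX := am_inv_sqrt_affine MK l0.
have [M0 MltK] := andP MK.
have sp x : 0 < lam + Num.sqrt x by have := sqrtr_ge0 x; lra.
pose s y := Num.sqrt (K - M * y).
have aL : absolutely_monotone (fun y => ln (lam + Num.sqrt K) - ln (lam + s y)).
  apply: (am_primitive (G := fun y =>
      (M / 2 * (K - M * y) `^ (- 2^-1)) * (lam + s y)^-1)).
  - by rewrite /s mulr0 subr0 subrr.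
  - apply: amM => //; apply: amZ; first by rewrite divr_ge0.
    by apply: am_powR_affine => //; rewrite invr_ge0.
  - move=> y /andP[y0 y1]; have Ky : 0 < K - M * y by nra.
    have h1 := is_deriveD (is_derive_cst lam y 1) (is_derive_sqrt_affine Ky).
    have h := @is_derive1_comp R (@ln R) (fun y => lam + s y) y _ _
      (is_derive1_ln (sp (K - M * y))) h1.
    have h2 := is_deriveB (is_derive_cst (ln (lam + Num.sqrt K)) y 1) h.
    by apply: (is_derive_eq h2); rewrite sub0r add0r mulrN opprK mulrC.
apply: (am_ext (F := fun y => (lam + Num.sqrt K) `^ (- a) *
    expR (a * (ln (lam + Num.sqrt K) - ln (lam + s y))))).
  move=> y _; rewrite !powR_expR//.
  by rewrite -expRD; congr expR; rewrite /s; ring.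
by apply: amZ; [exact: powR_ge0|apply: am_expR; exact: amZ].
Qed.

(** The symbol [|xi|^g (lam + |xi|)^(-a)] as a function of [r = |xi|^2]. *)
Definition profile lam g a (r : R) := r `^ (g / 2) * (lam + Num.sqrt r) `^ (- a).

(** With [s = sqrt (K - M y)], the derivative is a product of negative powers of
    [s] and [lam + s] and of the factor [(g - a) + a lam / (lam + s)]. The
    hypothesis [g <= 2] makes the exponent of [s] nonpositive, and [a <= g] makes
    the constant [g - a] nonnegative. *)
Lemma am_profile M K lam g a : 0 <= M < K -> 0 < lam ->
  0 <= a <= g -> g <= 2 ->
  absolutely_monotone (fun y => profile lam g a K - profile lam g a (K - M * y)).
Proof.
move=> MK l0 /andP[a0 ag] g2; have [M0 MltK] := andP MK.
have sp x : 0 < lam + Num.sqrt x by have := sqrtr_ge0 x; lra.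
pose s y := Num.sqrt (K - M * y).
apply: (am_primitive (G := fun y => M / 2 * ((K - M * y) `^ (- (1 - g / 2)) *
   ((lam + s y) `^ (- a) * ((g - a) + (a * lam) * (lam + s y)^-1))))).
- by rewrite mulr0 subr0 subrr.
- apply: amZ; first by rewrite divr_ge0.
  apply: amM; first by apply: am_powR_affine => //; lra.
  apply: amM; first exact: am_powR_sqrt_affine.
  apply: amD; first by apply: am_cst; lra.
  apply: amZ; first by rewrite mulr_ge0// ltW.
  exact: am_inv_sqrt_affine.
- move=> y /andP[y0 y1]; have Ky : 0 < K - M * y by nra.
  have h1 := @is_derive1_comp R (fun r => r `^ (g / 2)) (fun y => K - M * y) y _ _
    (is_derive1_powR _ Ky) (is_derive_affine K M y).
  have h2 := is_deriveD (is_derive_cst lam y 1) (is_derive_sqrt_affine Ky).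
  have h3 := @is_derive1_comp R (fun r => r `^ (- a)) (fun y => lam + s y) y _ _
    (is_derive1_powR _ (sp (K - M * y))) h2.
  have h4 := is_deriveB (is_derive_cst (profile lam g a K) y 1) (is_deriveM h1 h3).
  apply: (is_derive_eq h4).
  rewrite sub0r add0r /GRing.scale/= /s.
  set r := K - M * y in Ky *; set t := lam + Num.sqrt r.
  have t0 : 0 < t by exact: sp.
  have sr : 0 < Num.sqrt r by rewrite sqrtr_gt0.
  have -> : r `^ (g / 2 - 1) = r `^ (- (1 - g / 2)) by congr powR; ring.
  have -> : r `^ (g / 2) = r * r `^ (- (1 - g / 2)).
    rewrite -{2}(powRr1 (ltW Ky)) -powRD; last by rewrite (gt_eqF Ky) implybT.
    by congr powR; ring.
  have -> : t `^ (- a - 1) = t `^ (- a) / t.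
    rewrite powRB; last by rewrite (gt_eqF t0) implybT.
    by rewrite (powRr1 (ltW t0)).
  have -> : r `^ (- 2^-1) = (Num.sqrt r)^-1 by rewrite powRN powR12_sqrt// ltW.
  have -> : r * r `^ (- (1 - g / 2)) =
      Num.sqrt r * Num.sqrt r * r `^ (- (1 - g / 2)).
    by rewrite -expr2 sqr_sqrtr// ltW.
  have -> : lam = t - Num.sqrt r by rewrite /t; ring.
  by set u := _ `^ _; set v := _ `^ _; field; rewrite !gt_eqF.
Qed.

Lemma near_natSinv_le (e : R) : 0 < e -> \forall n \near \oo, n.+1%:R^-1 <= e.
Proof.
by move=> e0; apply: filterS (near_infty_natSinv_lt (PosNum e0)) => n; exact: ltW.
Qed.

Lemma powR_cvg_pos a (u : nat -> R) (l : R) : 0 < a -> (forall n, 0 <= u n) ->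
  u n @[n --> \oo] --> l -> u n `^ a @[n --> \oo] --> l `^ a.
Proof.
move=> a0 u0 ul.
have l0 : 0 <= l by apply: cvgr_to_ge ul _; exact: nearW.
have [l_gt0|] := ltP 0 l.
  refine (continuous_cvg _ (h := fun x : R => x `^ a) _ ul).
  have [h _] := is_derive1_powR a l_gt0.
  exact/differentiable_continuous/derivable1_diffP.
move=> l_le0; have {l0 l_le0} l0 : l = 0 by lra.
rewrite l0 in ul *; rewrite powR0 ?gt_eqF//.
apply/cvgrPdist_lt => e e0.
have ea0 : 0 < e `^ a^-1 by rewrite powR_gt0.
move/cvgrPdist_lt : ul => /(_ _ ea0); apply: filterS => n.
rewrite !sub0r !normrN ger0_norm// ger0_norm ?powR_ge0// => h.
have -> : e = (e `^ a^-1) `^ a by rewrite -powRrM mulVf ?gt_eqF// powRr1// ltW.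
by rewrite gt0_ltr_powR// nnegrE ?powR_ge0.
Qed.

Lemma powR_cvg a (u : nat -> R) (l : R) : 0 < l -> 
  u n @[n --> \oo] --> l -> u n `^ a @[n --> \oo] --> l `^ a.
Proof.
move=> l0 ul; refine (continuous_cvg _ (h := fun x : R => x `^ a) _ ul).
have [h _] := is_derive1_powR a l0.
exact/differentiable_continuous/derivable1_diffP.
Qed.

Lemma lam_sqrt_cvg lam a (u : nat -> R) (l : R) : 0 < lam ->
  u n @[n --> \oo] --> l ->
  (lam + Num.sqrt (u n)) `^ a @[n --> \oo] --> (lam + Num.sqrt l) `^ a.
Proof.
move=> l0 ul; apply: powR_cvg; first by have := sqrtr_ge0 l; lra.
apply: cvgD; first exact: cvg_cst.
by refine (continuous_cvg _ (h := Num.sqrt) _ ul); exact: sqrt_continuous.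
Qed.

Lemma profile_cvg lam g a (u : nat -> R) (l : R) : 0 < lam -> 0 < g ->
  (forall n, 0 <= u n) -> u n @[n --> \oo] --> l ->
  profile lam g a (u n) @[n --> \oo] --> profile lam g a l.
Proof.
move=> l0 g0 u0 ul; apply: cvgM; last exact: lam_sqrt_cvg.
by apply: powR_cvg_pos => //; rewrite divr_gt0.
Qed.

Lemma abs_sin_le (x : R) : `|sin x| <= `|x|.
Proof.
wlog x0 : x / 0 <= x.
  move=> h; have [/h//|x0] := leP 0 x.
  by rewrite -(normrN x) -(normrN (sin x)) -sinN; apply: h; lra.
have [|c _] := @MVT_segment R sin cos 0 x x0 (fun z _ => is_derive_sin z).
  by apply: continuous_subspaceT => z; exact: continuous_sin.
rewrite sin0 !subr0 => ->; rewrite normrM ler_piMl//.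
by rewrite ler_norml cos_geN1 cos_le1.
Qed.

Lemma abs_cosB1_le (x : R) : `|cos x - 1| <= `|x|.
Proof.
wlog x0 : x / 0 <= x.
  move=> h; have [/h//|x0] := leP 0 x.
  by rewrite -(normrN x) -cosN; apply: h; lra.
have [|c _] := @MVT_segment R cos (fun x => - sin x) 0 x x0 (fun z _ => is_derive_cos z).
  by apply: continuous_subspaceT => z; exact: continuous_cos.
rewrite cos0 !subr0 => ->; rewrite normrM ler_piMl// normrN.
exact: sin_max.
Qed.

(** A quadratic error suffices for the convergence of the lattice Laplacian. *)
Lemma abs_sinB_le (x : R) : `|sin x - x| <= x ^+ 2.
Proof.
wlog x0 : x / 0 <= x.
  move=> h; have [/h//|x0] := leP 0 x.
  have := h (- x); rewrite sqrrN sinN -opprD normrN; apply; lra.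
have dz z : is_derive z (1 : R) (sin - id) (cos z - 1) by exact: is_deriveB.
have [|c] := @MVT_segment R (sin - id) (fun x => cos x - 1) 0 x x0 (fun z _ => dz z).
  by apply: derivable_within_continuous => z _; have [] := dz z.
rewrite in_itv/= !fctE/= sin0 !subr0 => /andP[c0 cx] ->.
rewrite normrM expr2 (ger0_norm x0) ler_wpM2r//.
by apply: (le_trans (abs_cosB1_le _)); rewrite ger0_norm.
Qed.

End symbol_profiles.

(** * Radial multipliers built from cosines *)

Lemma cvg_sum_ord (R : realType) n (f : 'I_n -> nat -> R) (l : 'I_n -> R) :
  (forall i, f i k @[k --> \oo] --> l i) ->
  \sum_(i < n) f i k @[k --> \oo] --> \sum_(i < n) l i.
Proof.
elim: n f l => [|n ih] f l fl.
  by under eq_fun do rewrite big_ord0; rewrite big_ord0; exact: cvg_cst.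
under eq_fun do rewrite big_ord_recl; rewrite big_ord_recl.
by apply: cvgD => //; apply: ih.
Qed.

Section radial_multipliers.
Context {R : realType} {d : nat}.
Local Notation vec := 'rV[R]_d.
Implicit Types (x : vec) (q m : vec -> R) (lam g a : R).

Lemma sup_contractive_ext c q1 q2 : q1 =1 q2 -> sup_contractive c q1 -> sup_contractive c q2.
Proof. by move=> /funext ->. Qed.

Lemma sup_contractive_sum n (c : 'I_n -> R) (q : 'I_n -> vec -> R) :
  (forall i, sup_contractive (c i) (q i)) ->
  sup_contractive (\sum_(i < n) c i) (fun x => \sum_(i < n) q i x).
Proof.
elim: n c q => [|n ih] c q cq.
  rewrite big_ord0; apply: sup_contractive_ext (sup_contractive_cst (lexx 0)) => x.
  by rewrite big_ord0.
rewrite big_ord_recl; apply: sup_contractive_ext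
  (sup_contractiveD (cq ord0) (ih _ _ (fun i => cq (lift ord0 i)))) => x.
by rewrite big_ord_recl.
Qed.

Lemma sup_contractiveZ a c q : 0 <= a -> sup_contractive c q ->
  sup_contractive (a * c) (fun x => a * q x).
Proof. by move=> a0 cq; exact: (sup_contractiveM (sup_contractive_cst a0) cq). Qed.

Lemma sup_contractiveX n q : sup_contractive 1 q -> sup_contractive 1 (fun x => q x ^+ n).
Proof.
move=> cq; elim: n => [|n ih].
  by apply: sup_contractive_ext (sup_contractive_cst ler01) => x; rewrite expr0.
rewrite -(mulr1 1); apply: sup_contractive_ext (sup_contractiveM cq ih) => x.
by rewrite exprS.
Qed.

(** For a polynomial with nonnegative coefficients this is the sum of the bounds
    for the powers of [q], which are iterated averages. *)
Lemma sup_contractive_am (F : R -> R) q : absolutely_monotone F ->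
  sup_contractive 1 q -> (forall x, 0 <= q x <= 1) ->
  sup_contractive (F 1) (fun x => F (q x)).
Proof.
move=> aF cq q01.
have /choice[p pP] : forall n : nat, exists p : {poly R}, (forall i, 0 <= p`_i) /\
    forall y, 0 <= y <= 1 -> `|F y - p.[y]| <= n.+1%:R^-1.
  by move=> n; have [|p p0 pF] := aF n.+1%:R^-1; [rewrite invr_gt0|exists p].
have pcvg y : 0 <= y <= 1 -> (p n).[y] @[n --> \oo] --> F y.
  move=> y01; apply/cvgrPdist_le => e e0.
  near=> n; apply: (le_trans ((pP n).2 _ y01)).
  by near: n; exact: near_natSinv_le.
apply: (sup_contractive_lim (c_ := fun n => (p n).[1]) (q_ := fun n x => (p n).[q x])).
- move=> n; have [p0 _] := pP n; rewrite horner_coef.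
  apply: (sup_contractive_ext (q1 := fun x => \sum_(i < size (p n)) (p n)`_i * q x ^+ i)).
    by move=> x; rewrite horner_coef.
  apply: sup_contractive_sum => i.
  by rewrite expr1n; apply: sup_contractiveZ => //; exact: sup_contractiveX.
- by apply: pcvg; rewrite ler01 lexx.
- by move=> x; exact: pcvg.
Unshelve. all: by end_near. Qed.

(** With mesh [h = 1 / (n + 1)], the average of the [cos^2 (h xi_i)]. The affine
    function [d / h^2 * (1 - lattice_cos)] of it equals the lattice Laplacian
    [sum_i (sin (h xi_i) / h)^2], which tends to [|xi|^2]. *)
Definition lattice_cos (n : nat) x : R :=
  d%:R^-1 * \sum_(i < d) cos (n.+1%:R^-1 * x 0 i) ^+ 2.

Definition lattice_scale (n : nat) : R := d%:R * n.+1%:R ^+ 2.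

Definition lattice_laplacian (n : nat) x : R :=
  \sum_(i < d) (n.+1%:R * sin (n.+1%:R^-1 * x 0 i)) ^+ 2.

Hypothesis d_gt0 : (0 < d)%N.

Let d0 : d%:R != 0 :> R. Proof. by rewrite pnatr_eq0 -lt0n. Qed.

Lemma lattice_cosE n x :
  lattice_scale n * (1 - lattice_cos n x) = lattice_laplacian n x.
Proof.
rewrite /lattice_laplacian /lattice_scale /lattice_cos.
under [RHS]eq_bigr do rewrite exprMn sin2cos2.
rewrite -mulr_sumr sumrB sumr_const card_ord -mulr_natl mulr1.
by set S := \sum_(_ < _) _; field.
Qed.

Lemma lattice_cos01 n x : 0 <= lattice_cos n x <= 1.
Proof.
have di : 0 <= d%:R^-1 :> R by rewrite invr_ge0.
apply/andP; split.
  by rewrite mulr_ge0// sumr_ge0// => i _; rewrite sqr_ge0.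
rewrite -[leRHS](mulVf d0) ler_wpM2l//.
rewrite -[leRHS]mulr1 -[d in leRHS]card_ord mulr_natl -sumr_const.
apply: ler_sum => i _; set c := cos _.
by have := cos2Dsin2 (n.+1%:R^-1 * x 0 i); rewrite -/c; have := sqr_ge0 (sin (n.+1%:R^-1 * x 0 i)); lra.
Qed.

Lemma sup_contractive_lattice_cos n : sup_contractive 1 (lattice_cos n).
Proof.
have -> : 1 = d%:R^-1 * \sum_(i < d) (2^-1 + 2^-1 * 1) :> R.
  by rewrite sumr_const card_ord -mulr_natl; field.
apply: sup_contractiveZ; first by rewrite invr_ge0.
apply: sup_contractive_sum => i.
pose z : vec := (2 * n.+1%:R^-1) *: delta_mx 0 i.
apply: (sup_contractive_ext (q1 := fun x => 2^-1 + 2^-1 * cos (dotmul x z))).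
  move=> x; have -> : dotmul x z = (n.+1%:R^-1 * x 0 i) *+ 2.
    rewrite /dotmul (bigD1 i)//= big1 ?addr0 => [|j ji].
      by rewrite !mxE !eqxx/= mulr1; ring.
    by rewrite !mxE eqxx (negbTE ji) /= !mulr0.
  by rewrite mulr2n cosD -!expr2 sin2cos2; field.
apply: sup_contractiveD; first by apply: sup_contractive_cst; rewrite invr_ge0.
by apply: sup_contractiveZ; [rewrite invr_ge0|exact: sup_contractive_cos].
Qed.

Lemma lattice_laplacian_le n x : 0 <= lattice_laplacian n x <= dotmul x x.
Proof.
apply/andP; split; first by apply: sumr_ge0 => i _; rewrite sqr_ge0.
apply: ler_sum => i _; rewrite -expr2 -[leLHS]real_normK ?num_real//.
rewrite -[leRHS]real_normK ?num_real// lerXn2r ?nnegrE// normrM ger0_norm//.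
have := abs_sin_le (n.+1%:R^-1 * x 0 i); rewrite normrM ger0_norm ?invr_ge0// => h.
by rewrite -ler_pdivlMl// (le_trans h).
Qed.

Lemma cvg_lattice_laplacian x : lattice_laplacian n x @[n --> \oo] --> dotmul x x.
Proof.
have -> : dotmul x x = \sum_(i < d) (x 0 i) ^+ 2 by apply: eq_bigr.
rewrite /lattice_laplacian.
apply: cvg_sum_ord => i; under eq_fun do rewrite expr2.
have h : (n.+1%:R * sin (n.+1%:R^-1 * x 0 i)) @[n --> \oo] --> x 0 i.
  apply/cvgrPdist_le => e e0; near=> n.
  have n0 : 0 < n.+1%:R :> R by [].
  have h := abs_sinB_le (n.+1%:R^-1 * x 0 i); rewrite distrC.
  have -> : n.+1%:R * sin (n.+1%:R^-1 * x 0 i) - x 0 i =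
     n.+1%:R * (sin (n.+1%:R^-1 * x 0 i) - n.+1%:R^-1 * x 0 i).
    by field; rewrite gt_eqF.
  rewrite normrM ger0_norm ?(ltW n0)//.
  apply: (le_trans (ler_wpM2l (ltW n0) h)).
  have -> : n.+1%:R * (n.+1%:R^-1 * x 0 i) ^+ 2 = n.+1%:R^-1 * (x 0 i) ^+ 2.
    by field; rewrite gt_eqF.
  have : n.+1%:R^-1 <= e / (1 + x 0 i ^+ 2).
    near: n; apply: near_natSinv_le.
    by rewrite divr_gt0// ltr_pwDl// sqr_ge0.
  rewrite ler_pdivlMr; last by rewrite ltr_pwDl// sqr_ge0.
  apply: le_trans; rewrite ler_wpM2l// ?invr_ge0 ?(ltW n0)//.
  by rewrite lerDr.
by rewrite expr2; exact: cvgM.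
Unshelve. all: by end_near. Qed.

(** The shift by [1 / (n + 1)] keeps the argument of the profiles away from [0],
    where they fail to be smooth. *)
Let rad n x : R := n.+1%:R^-1 + lattice_laplacian n x.

Let rad_gt0 n x : 0 < rad n x.
Proof. by rewrite ltr_pwDl// ?invr_gt0//; have /andP[] := lattice_laplacian_le n x. Qed.

Let cvg_rad x : rad n x @[n --> \oo] --> dotmul x x.
Proof.
rewrite -[X in _ --> X]add0r; apply: cvgD; last exact: cvg_lattice_laplacian.
exact: cvg_harmonic.
Qed.

Let top n : R := n.+1%:R^-1 + lattice_scale n.

Let radE n x : rad n x = top n - lattice_scale n * lattice_cos n x.
Proof. by rewrite /rad /top -lattice_cosE; ring. Qed.

Let scale_lt n : 0 <= lattice_scale n < top n.
Proof. by rewrite ltrDr invr_gt0 ltr0n andbT mulr_ge0// exprn_ge0. Qed.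

(** The function is absolutely monotone in the lattice cosine, and the lattice
    cosine is [1] at frequency [0]. *)
Lemma sup_contractive_powR lam b : 0 < lam -> 0 <= b ->
  sup_contractive (lam `^ (- b)) (fun x => (lam + euclidean_norm x) `^ (- b)).
Proof.
move=> l0 b0.
apply: (sup_contractive_lim (c_ := fun n => (lam + Num.sqrt n.+1%:R^-1) `^ (- b))
   (q_ := fun n x => (lam + Num.sqrt (rad n x)) `^ (- b))).
- move=> n; have := sup_contractive_am (am_powR_sqrt_affine (scale_lt n) l0 b0)
    (sup_contractive_lattice_cos n) (lattice_cos01 n).
  rewrite mulr1 {1}/top addrK.
  by apply: sup_contractive_ext => x; rewrite radE.
- rewrite -[X in _ --> X `^ _]addr0 -(sqrtr0 R).
  by apply: lam_sqrt_cvg => //; exact: cvg_harmonic.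
- by move=> x; exact: lam_sqrt_cvg.
Qed.

Lemma profile_sqr lam g a x : profile lam g a (dotmul x x) =
  euclidean_norm x `^ g * (lam + euclidean_norm x) `^ (- a).
Proof.
rewrite /profile /euclidean_norm; congr (_ * _).
by rewrite -powR12_sqrt ?dotmul_ge0// -powRrM; congr powR; rewrite mulrC.
Qed.

Lemma profile_ge0 lam g a r : 0 <= profile lam g a r.
Proof. by rewrite mulr_ge0// powR_ge0. Qed.

Lemma powR_half_le g r : 0 <= g <= 2 -> 0 <= r -> r `^ (g / 2) <= 1 + r.
Proof.
move=> g02 r0; have [r1|r1] := leP r 1.
  have [->|rn0] := eqVneq r 0.
    by rewrite /powR eqxx addr0; case: (_ == 0); rewrite ?ler01 ?lexx.
  have : r `^ (g / 2) <= r `^ 0 by apply: ger_powR; lra.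
  by rewrite powRr0; lra.
by have := ler1_powR (ltW r1) (_ : g / 2 <= 1); lra.
Qed.

Lemma profile_le lam g a r : 0 < lam -> 0 <= a -> 0 <= g <= 2 -> 0 <= r ->
  profile lam g a r <= lam `^ (- a) * (1 + r).
Proof.
move=> l0 a0 g02 r0; rewrite /profile mulrC ler_pM ?powR_ge0// ?powR_half_le//.
rewrite !powRN lef_pV2 ?posrE ?powR_gt0//; last by have := sqrtr_ge0 r; lra.
rewrite ge0_ler_powR// ?nnegrE ?(ltW l0)//; have := sqrtr_ge0 r; lra.
Qed.

(** As a function [F] of the lattice cosine, the decrease of the profile from its
    value at the top frequency is absolutely monotone, and the profile itself is
    [F 1 - F] up to its value near frequency [0], which tends to [0]. *)
Lemma almost_accretive_profile lam g a : 0 < lam -> 0 <= a <= g -> 0 < g <= 2 ->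
  almost_accretive 0 (fun x => euclidean_norm x `^ g * (lam + euclidean_norm x) `^ (- a)).
Proof.
move=> l0 /andP[a0 ag] /andP[g0 g2].
apply: (@almost_accretive_lim _ _ (fun=> 0) (fun n x =>
   profile lam g a (rad n x) - profile lam g a n.+1%:R^-1) _ _ (lam `^ (- a) * 2)).
- move=> n.
  have := almost_accretive_cstB (sup_contractive_am (am_profile (scale_lt n) l0
    (_ : 0 <= a <= g) g2) (sup_contractive_lattice_cos n) (lattice_cos01 n)).
  rewrite a0 ag => /(_ isT); rewrite mulr1 {1}/top addrK; congr almost_accretive.
  by apply/funext => x; rewrite radE; ring.
- move=> n x.
  have [p0 q0] := (profile_ge0 lam g a (rad n x), profile_ge0 lam g a n.+1%:R^-1).
  have g02 : 0 <= g <= 2 by rewrite ltW.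
  have h1 := profile_le l0 a0 g02 (ltW (rad_gt0 n x)).
  have n1 : n.+1%:R^-1 <= 1 :> R by rewrite invf_le1// ler1n.
  have n0 : 0 <= n.+1%:R^-1 :> R by rewrite invr_ge0.
  have h2 := profile_le l0 a0 g02 n0.
  have /andP[_ h3] := lattice_laplacian_le n x.
  have lp : 0 <= lam `^ (- a) by exact: powR_ge0.
  have x0 := dotmul_ge0 x.
  have h4 : lam `^ (- a) * (1 + rad n x) <= lam `^ (- a) * 2 * (1 + dotmul x x).
    rewrite -mulrA ler_wpM2l// /rad; move: n1 h3 x0.
    by move: (_^-1) (dotmul x x) (lattice_laplacian n x) => u v w; lra.
  have h5 : lam `^ (- a) * (1 + n.+1%:R^-1) <= lam `^ (- a) * 2 * (1 + dotmul x x).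
    rewrite -mulrA ler_wpM2l//; move: n1 x0.
    by move: (_^-1) (dotmul x x) => u v; lra.
  have {h1 h4}h1 := le_trans h1 h4; have {h2 h5}h2 := le_trans h2 h5.
  rewrite ler_norml; move: p0 q0 h1 h2.
  move: (_ * 2 * _) => D; move: (profile _ _ _ (rad _ _)) => P.
  by move: (profile _ _ _ _) => Q; lra.
- exact: cvg_cst.
- move=> x; rewrite -profile_sqr -[X in _ --> X]subr0.
  have -> : 0 = profile lam g a 0 by rewrite /profile powR0 ?mul0r// gt_eqF// divr_gt0.
  apply: cvgB.
    by apply: (profile_cvg l0 g0); [move=> n; exact/ltW/rad_gt0|exact: cvg_rad].
  by apply: (profile_cvg l0 g0); [move=> n; rewrite invr_ge0|exact: cvg_harmonic].
Qed.

(** For equal exponents the profile is [(s / (lam + s))^g], which increases from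
    [0] to [1], so the total mass of the averages tends to [1]. *)
Lemma sup_contractive_1Bprofile lam g : 0 < lam -> 0 < g <= 2 ->
  sup_contractive 1 (fun x => 1 - euclidean_norm x `^ g * (lam + euclidean_norm x) `^ (- g)).
Proof.
move=> l0 /andP[g0 g2].
have ctop : profile lam g g (top n) @[n --> \oo] --> (1 : R).
  have tp n : 0 < top n by have /andP[] := scale_lt n; exact: le_lt_trans.
  have tE n : profile lam g g (top n) = (1 - lam / (lam + Num.sqrt (top n))) `^ g.
    have s0 : 0 < Num.sqrt (top n) by rewrite sqrtr_gt0.
    have ls : 0 < lam + Num.sqrt (top n) by rewrite addr_gt0.
    have -> : 1 - lam / (lam + Num.sqrt (top n)) =
        Num.sqrt (top n) * (lam + Num.sqrt (top n))^-1 by field; rewrite gt_eqF.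
    rewrite powRM ?invr_ge0 ?(ltW s0) ?(ltW ls)// -(powR_inv1 (ltW ls)) -powRrM mulN1r.
    by rewrite /profile; congr (_ * _); rewrite -powR12_sqrt ?(ltW (tp n))// -powRrM mulrC.
  rewrite (_ : (fun n => profile lam g g (top n)) =
    (fun n => (1 - lam / (lam + Num.sqrt (top n))) `^ g)); last exact/funext.
  suff : (1 - lam / (lam + Num.sqrt (top n))) `^ g @[n --> \oo] --> (1 : R) `^ g.
    by rewrite powR1.
  apply: powR_cvg => //.
  rewrite -[X in _ --> X]subr0; apply: cvgB; first exact: cvg_cst.
  apply/cvgrPdist_le => e e0; near=> n.
  have s0 : 0 < lam + Num.sqrt (top n) by rewrite addr_gt0// sqrtr_gt0.
  rewrite sub0r normrN ger0_norm ?divr_ge0 ?(ltW l0) ?(ltW s0)//.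
  rewrite ler_pdivrMr// -ler_pdivrMl// mulrC.
  have h1 : lam / e <= n.+1%:R.
    have h2 : lam / e < n%:R by near: n; exact: nbhs_infty_gtr.
    by rewrite (le_trans (ltW h2))// ler_nat.
  apply: (le_trans h1); rewrite (@le_trans _ _ (Num.sqrt (top n)))//; last first.
    by rewrite lerDr ltW.
  rewrite -[leLHS]ger0_norm// -sqrtr_sqr ler_sqrt ?(ltW (tp n))//.
  rewrite /top /lattice_scale ler_wpDl ?invr_ge0//.
  by rewrite ler_peMl ?exprn_ge0// ler1n.
apply: (sup_contractive_lim (c_ := fun n => profile lam g g (top n) - profile lam g g n.+1%:R^-1)
   (q_ := fun n x => profile lam g g (top n) - profile lam g g (rad n x))).
- move=> n; have := sup_contractive_am (am_profile (scale_lt n) l0 (_ : 0 <= g <= g) g2)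
    (sup_contractive_lattice_cos n) (lattice_cos01 n).
  rewrite lexx ltW// => /(_ isT); rewrite mulr1 {2}/top addrK.
  by apply: sup_contractive_ext => x; rewrite radE.
- rewrite -[X in _ --> X]subr0; apply: cvgB => //.
  have -> : 0 = profile lam g g 0 by rewrite /profile powR0 ?mul0r// gt_eqF// divr_gt0.
  by apply: (profile_cvg l0 g0); [move=> n; rewrite invr_ge0|exact: cvg_harmonic].
- move=> x; rewrite -profile_sqr; apply: cvgB => //.
  by apply: (profile_cvg l0 g0); [move=> n; exact/ltW/rad_gt0|exact: cvg_rad].
Unshelve. all: by end_near. Qed.

Lemma almost_accretive_le C1 C2 m : C1 <= C2 -> almost_accretive C1 m ->
  almost_accretive C2 m.
Proof.
move=> C12 [mm gm l]; split=> // k B x0 wk kB kx0.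
apply: le_trans (l k B x0 wk kB kx0); rewrite lerN2 ler_wpM2r//.
exact: le_trans (kB x0).
Qed.

(** With [b = (lam + s)^(g - a)] the symbol is [b - b * (1 - (s / (lam + s))^g)],
    and both terms are sup-contractive with constant [lam^(g - a)]. *)
Lemma almost_accretive_profile_bounded lam g a : 0 < lam -> 0 <= g <= 2 -> g <= a ->
  almost_accretive (2 * lam `^ (g - a))
    (fun x => euclidean_norm x `^ g * (lam + euclidean_norm x) `^ (- a)).
Proof.
move=> l0 /andP[g0 g2] ga.
have cb : sup_contractive (lam `^ (- (a - g)))
   (fun x => (lam + euclidean_norm x) `^ (- (a - g))).
  by apply: sup_contractive_powR => //; lra.
have [g_eq0|gn0] := eqVneq g 0.
  have h := sup_contractive_almost_accretive cb.
  apply: (almost_accretive_le (C1 := lam `^ (- (a - g)))).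
    by rewrite opprB ler_peMl ?powR_ge0// ler1n.
  rewrite (_ : (fun x => _) = (fun x => (lam + euclidean_norm x) `^ (- (a - g))))//.
  by apply/funext => x; rewrite g_eq0 powRr0 mul1r subr0.
have g_gt0 : 0 < g by rewrite lt_neqAle eq_sym gn0.
have cq := sup_contractive_1Bprofile l0 (_ : 0 < g <= 2).
rewrite g_gt0 in cq; have {cq} := cq g2 => cq.
have := almost_accretiveD (sup_contractive_almost_accretive cb)
  (sup_contractive_almost_accretiveN (sup_contractiveM cb cq)).
rewrite mulr1 (_ : 2 * _ = lam `^ (- (a - g)) + lam `^ (- (a - g))); last first.
  by rewrite opprB; ring.
rewrite (_ : (fun x => euclidean_norm x `^ g * _) = (fun x =>
  (lam + euclidean_norm x) `^ (- (a - g)) + - ((lam + euclidean_norm x) `^ (- (a - g)) *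
   (1 - euclidean_norm x `^ g * (lam + euclidean_norm x) `^ (- g)))))//.
apply/funext => x; rewrite opprB; set s := euclidean_norm x.
have ls : 0 < lam + s by rewrite ltr_pwDl// sqrtr_ge0.
have -> : (lam + s) `^ (- a) = (lam + s) `^ (g - a) * (lam + s) `^ (- g).
  rewrite -powRD; last by rewrite (gt_eqF ls) implybT.
  by congr powR; ring.
by ring.
Qed.

End radial_multipliers.

(** * The logarithmic symbol *)

Section logarithmic_symbol.
Context {R : realType} {d : nat}.
Local Notation vec := 'rV[R]_d.
Implicit Types (x : vec) (m : vec -> R) (lam gam bet : R).
Hypothesis d_gt0 : (0 < d)%N.

Lemma almost_accretive_sum n (C : 'I_n -> R) (m : 'I_n -> vec -> R) :
  (forall i, almost_accretive (C i) (m i)) ->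
  almost_accretive (\sum_(i < n) C i) (fun x => \sum_(i < n) m i x).
Proof.
elim: n C m => [|n ih] C m cm.
  rewrite big_ord0 (_ : (fun x => _) = (fun x => 0)); last first.
    by apply/funext => x; rewrite big_ord0.
  exact: (sup_contractive_almost_accretive (sup_contractive_cst (lexx 0))).
rewrite big_ord_recl (_ : (fun x => _) =
  (fun x => m ord0 x + \sum_(i < n) m (lift ord0 i) x)); last first.
  by apply/funext => x; rewrite big_ord_recl.
exact: almost_accretiveD (cm ord0) (ih _ _ (fun i => cm (lift ord0 i))).
Qed.

(** With [h = ln y / (n + 1)], the bounds [1 - h <= exp (- h) <= 1 - h + h^2] leave an
    error of order [h]. *)
Lemma cvg_ln (y : R) : 1 < y ->
  n.+1%:R * (1 - y `^ (- n.+1%:R^-1)) @[n --> \oo] --> ln y.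
Proof.
move=> y1; have y0 : 0 < y by lra.
have L0 : 0 < ln y by exact: ln_gt0.
set L := ln y in L0 *.
apply/cvgrPdist_le => e e0; near=> n.
set N := n.+1%:R : R; have N0 : 0 < N by rewrite ltr0n.
have h0 : 0 < L / N by rewrite divr_gt0.
have hN : N * (L / N) = L by field; rewrite gt_eqF.
rewrite powR_expR// -/L (_ : - N^-1 * L = - (L / N)); last ring.
set h := L / N in h0 hN *.
have e1 : 1 - h <= expR (- h) by have := expR_ge1Dx (- h).
have e2 : expR (- h) <= 1 - h + h ^+ 2.
  have e3 := expR_ge1Dx h; rewrite expRN.
  have h1 : 0 < 1 + h by lra.
  apply: (@le_trans _ _ (1 + h)^-1); first by rewrite lef_pV2// posrE expR_gt0.
  rewrite -[leLHS]mul1r ler_pdivrMr//.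
  have -> : (1 - h + h ^+ 2) * (1 + h) = 1 + h ^+ 3 by ring.
  by rewrite lerDl exprn_ge0// ltW.
have hL : N * h ^+ 2 = L * h by rewrite expr2 mulrA hN.
have Lh : L * h <= e.
  have : N^-1 <= e / L ^+ 2.
    by rewrite /N; near: n; apply: near_natSinv_le; rewrite divr_gt0// exprn_gt0.
  rewrite ler_pdivlMr ?exprn_gt0// => h5.
  by apply: le_trans h5; rewrite /h expr2 le_eqVlt; apply/orP; left; apply/eqP; ring.
rewrite ler_norml; apply/andP; split; nra.
Unshelve. all: by end_near. Qed.

(** [(ln t)^(- bet)] is the limit of [N^(- bet) (1 - t^(- 1/N))^(- bet)], and
    [(1 - y)^(- bet)] has nonnegative Taylor coefficients. Scaling by [z], the value
    of [t^(- 1/N)] at [t = lam], makes the polynomial approximation of the latter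
    uniform for [t >= lam]. *)
Lemma log_symbol_approximation lam bet : 1 < lam -> 0 <= bet ->
  exists D : nat -> R -> R,
  [/\ forall n, exists k (w a : 'I_k -> R),
        (forall i, 0 <= w i /\ 0 <= a i) /\
        forall s, 0 <= s -> D n s = \sum_(i < k) w i * (lam + s) `^ (- a i) &
      forall s, 0 <= s -> D n s @[n --> \oo] --> (ln (lam + s)) `^ (- bet)].
Proof.
move=> l1 b0; have l0 : 0 < lam by lra.
pose N n : R := n.+1%:R.
have N0 n : 0 < N n by rewrite ltr0n.
pose z n := lam `^ (- (N n)^-1).
have z01 n : 0 <= z n < 1.
  rewrite powR_ge0/= /z powR_expR// expR_lt1.
  by rewrite mulNr oppr_lt0 mulr_gt0 ?invr_gt0 ?ln_gt0.
have /choice[p pP] : forall n : nat, exists p : {poly R}, (forall i, 0 <= p`_i) /\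
    forall y, 0 <= y <= 1 -> `|(1 - z n * y) `^ (- bet) - p.[y]| <= n.+1%:R^-1.
  move=> n; have [|p p0 pF] := am_powR_affine (z01 n) b0 (e := n.+1%:R^-1).
    by rewrite invr_gt0.
  by exists p.
pose y n s := lam `^ ((N n)^-1) * (lam + s) `^ (- (N n)^-1).
have zy n s : 0 <= s -> z n * y n s = (lam + s) `^ (- (N n)^-1).
  by move=> s0; rewrite /y mulrA /z powRN mulVf ?mul1r// gt_eqF// powR_gt0.
have y01 n s : 0 <= s -> 0 <= y n s <= 1.
  move=> s0; rewrite mulr_ge0 ?powR_ge0//= /y powRN ler_pdivrMr ?powR_gt0//; last lra.
  rewrite mul1r ge0_ler_powR ?nnegrE ?invr_ge0//; first exact: ltW; lra.
exists (fun n s => N n `^ (- bet) * (p n).[y n s]); split.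
- move=> n; exists (size (p n)).
  exists (fun i => N n `^ (- bet) * (p n)`_i * lam `^ (i%:R / N n)).
  exists (fun i => i%:R / N n); split.
    move=> i; have [p0 _] := pP n.
    by rewrite !mulr_ge0 ?powR_ge0 ?p0 ?invr_ge0// ltW.
  move=> s s0; rewrite horner_coef mulr_sumr; apply: eq_bigr => i _.
  rewrite /y exprMn -!powR_mulrn ?powR_ge0// -!powRrM.
  have -> : - (N n)^-1 * i%:R = - (i%:R / N n) by ring.
  by rewrite (mulrC (N n)^-1); ring.
- move=> s s0; have ls : 1 < lam + s by lra.
  have Ls : 0 < ln (lam + s) by exact: ln_gt0.
  have c1 := powR_cvg (a := - bet) Ls (cvg_ln ls).
  rewrite -[X in _ --> X]addr0.
  have E n : N n `^ (- bet) * (p n).[y n s] =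
     (n.+1%:R * (1 - (lam + s) `^ (- n.+1%:R^-1))) `^ (- bet) +
      N n `^ (- bet) * ((p n).[y n s] - (1 - z n * y n s) `^ (- bet)).
    rewrite powRM ?(ltW (N0 n))//; last first.
      rewrite -(zy n s s0); have /andP[_ ] := z01 n; have := y01 n s s0.
      by have /andP[] := z01 n; nra.
    by rewrite -/(N n) -(zy n s s0); ring.
  rewrite (_ : (fun n => _) = (fun n =>
    (n.+1%:R * (1 - (lam + s) `^ (- n.+1%:R^-1))) `^ (- bet) +
      N n `^ (- bet) * ((p n).[y n s] - (1 - z n * y n s) `^ (- bet)))); last exact/funext.
  apply: cvgD => //; apply/cvgrPdist_le => e e0; near=> n.
  rewrite sub0r normrN normrM -[leRHS]mul1r ler_pM//.
    rewrite ger0_norm ?powR_ge0// powRN invf_le1 ?powR_gt0//.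
    by rewrite -[leLHS](powRr0 (N n)) ler_powR// ler1n.
  rewrite distrC; have [_ h] := pP n; apply: (le_trans (h _ (y01 n s s0))).
  by near: n; exact: near_natSinv_le.
Unshelve. all: by end_near. Qed.

(** Each power [(lam + s)^(- a)] costs at most [2 lam^(gam - a)], so the total is
    [2 lam^gam] times the value at [s = 0] of the approximation of
    [(ln (lam + s))^(- bet)]. *)
Theorem almost_accretive_log_symbol lam gam bet :
  1 < lam -> 0 <= gam <= 2 -> 0 <= bet ->
  almost_accretive (2 * lam `^ gam * (ln lam) `^ (- bet)) (@A_symbol R d gam bet lam).
Proof.
move=> l1 g02 b0; have l0 : 0 < lam by lra.
have [D [DE Dcvg]] := log_symbol_approximation l1 b0.
have D0 : D n 0 @[n --> \oo] --> (ln lam) `^ (- bet).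
  by have := Dcvg 0 (lexx 0); rewrite addr0.
have [K DK] : exists K, forall n, D n 0 <= K.
  have : cvgn (D ^~ 0) by apply/cvg_ex; exists ((ln lam) `^ (- bet)).
  move/cvg_seq_bounded => [M [_ /(_ (M + 1))]].
  rewrite ltrDl ltr01 => /(_ isT) cM; exists (M + 1).
  by move=> n; apply: le_trans (ler_norm _) (cM n I).
apply: (@almost_accretive_lim _ _ (fun n => 2 * lam `^ gam * D n 0)
  (fun n x => euclidean_norm x `^ gam * D n (euclidean_norm x)) _ _ K).
- move=> n; have [k [w [a [wa0 E]]]] := DE n.
  rewrite E// addr0 mulr_sumr (_ : (fun x => _) = (fun x : vec =>
    \sum_(i < k) w i * (euclidean_norm x `^ gam * (lam + euclidean_norm x) `^ (- a i)))); last first.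
    apply/funext => x; rewrite E ?sqrtr_ge0// mulr_sumr.
    by apply: eq_bigr => i _; rewrite mulrCA.
  apply: almost_accretive_sum => i; have [w0 a0] := wa0 i.
  rewrite mulrCA; apply: almost_accretiveZ => //.
  have [ag|ga] := ltP (a i) gam.
    apply: (@almost_accretive_le _ _ 0); first by rewrite !mulr_ge0// powR_ge0.
    by apply: almost_accretive_profile => //; lra.
  rewrite -mulrA -powRD; last by rewrite (gt_eqF l0) implybT.
  exact: almost_accretive_profile_bounded.
- move=> n x; have [k [w [a [wa0 E]]]] := DE n.
  have x0 := dotmul_ge0 x.
  have Dx : 0 <= D n (euclidean_norm x).
    rewrite E ?sqrtr_ge0// sumr_ge0// => i _; have [w0 _] := wa0 i.
    by rewrite mulr_ge0// powR_ge0.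
  rewrite ger0_norm ?mulr_ge0 ?powR_ge0//.
  have h : euclidean_norm x `^ gam * D n (euclidean_norm x) <= D n 0 * (1 + dotmul x x).
    rewrite !E ?sqrtr_ge0// addr0 mulr_sumr mulr_suml ler_sum// => i _.
    have [w0 a0] := wa0 i; rewrite mulrCA -mulrA ler_wpM2l// -profile_sqr.
    exact: profile_le.
  by apply: (le_trans h); rewrite ler_wpM2r// addr_ge0.
- exact: cvgMl_tmp.
- move=> x; rewrite /A_symbol -powRN; apply: cvgMl_tmp.
  by apply: Dcvg; exact: sqrtr_ge0.
Qed.

End logarithmic_symbol.

(** * Smooth bumps supported in a cube *)

Section flat_functions.
Context {R : realType}.
Implicit Types (p q : {poly R}) (x y u : R).

(** The functions [p(1/x) exp(- 1/x)], extended by [0], form a class stable under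
    differentiation, which gives their smoothness at [0] without computing
    higher derivatives. *)
Definition flat p x : R := if 0 < x then p.[x^-1] * expR (- x^-1) else 0.

Definition dflat p : {poly R} := 'X^2 * (p - p^`()).

Lemma horner_le_pow p : exists A, forall y, 1 <= y -> `|p.[y]| <= A * y ^+ size p.
Proof.
exists (\sum_(i < size p) `|p`_i|) => y y1.
rewrite horner_coef mulr_suml; apply: (le_trans (ler_norm_sum _ _ _)).
apply: ler_sum => i _; have y0 : 0 <= y by lra.
by rewrite normrM ler_wpM2l// normrX ger0_norm// ler_weXn2l// ltnW.
Qed.

(** The exponential beats every power of [1/x]; a quadratic bound is enough for
    the derivative at [0] to vanish. *)
Lemma flat_le_sqr p : exists C, forall x, 0 < x <= 1 -> `|flat p x| <= C * x ^+ 2.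
Proof.
have [A pA] := horner_le_pow p; set n := size p in pA.
exists (A * (n.+2)`!%:R) => x /andP[x0 x1].
rewrite /flat x0; set y := x^-1.
have y1 : 1 <= y by rewrite invf_ge1.
have y0 : 0 < y by rewrite invr_gt0.
have -> : x = y^-1 by rewrite invrK.
rewrite normrM (ger0_norm (expR_ge0 _)) expRN.
have h := pA _ y1.
have A0 : 0 <= A.
  have : 0 <= A * y ^+ n by exact: le_trans h.
  by rewrite pmulr_lge0// exprn_gt0.
apply: (le_trans (ler_wpM2r _ h)); first by rewrite invr_ge0 expR_ge0.
have e : y ^+ n.+2 / (n.+2)`!%:R <= expR y.
  by have := expR_ge1Dxn n.+1 (ltW y0); lra.
have F0 : 0 < (n.+2)`!%:R :> R by rewrite ltr0n fact_gt0.
have e2 : (expR y)^-1 <= (n.+2)`!%:R / y ^+ n.+2.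
  rewrite -[leRHS]invf_div lef_pV2 ?posrE ?expR_gt0//.
  by rewrite divr_gt0// exprn_gt0.
apply: (le_trans (ler_wpM2l _ e2)); first by rewrite mulr_ge0// exprn_ge0// ltW.
rewrite le_eqVlt; apply/orP; left; apply/eqP.
have yn0 : y ^+ n != 0 by rewrite expf_neq0// gt_eqF.
rewrite !exprS expr0; set Y := y ^+ n in yn0 *.
by field; rewrite yn0 gt_eqF.
Qed.

Lemma is_derive_flat p x : is_derive x (1 : R) (flat p) (flat (dflat p) x).
Proof.
have [x0|x0|x0] := ltgtP x 0.
- have -> : flat (dflat p) x = 0 by rewrite /flat ltNge ltW.
  apply: (near_eq_is_derive (f := cst (0 : R))).
  near=> z; rewrite /flat ltNge (_ : (z <= 0) = true)//.
  by apply/ltW; near: z; exact: lt_nbhsl.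
- rewrite {2}/flat x0.
  apply: (near_eq_is_derive (f := fun x => p.[x^-1] * expR (- x^-1))).
    near=> z; rewrite /flat (_ : (0 < z) = true)//.
    by near: z; exact: lt_nbhsr.
  have xn0 : x != 0 by rewrite gt_eqF.
  have h1 := is_deriveV xn0 (is_derive_id x (1 : R)).
  have h2 := @is_derive1_comp R (horner p) (fun x => x^-1) x _ _ (is_derive_poly p x^-1) h1.
  have h3 := @is_derive1_comp R expR (fun x => - x^-1) x _ _ (is_derive_expR (- x^-1)) (is_deriveN h1).
  apply: (is_derive_eq (is_deriveM h2 h3)).
  rewrite /GRing.scale/= /dflat hornerM hornerXn hornerD hornerN.
  by rewrite mulr1 exprVn; ring.
- subst x; rewrite {2}/flat ltxx.
  have [C hC] := flat_le_sqr p.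
  have C0 : 0 <= C.
    have := hC 1; rewrite ltr01 lexx expr1n mulr1 => /(_ isT); exact: le_trans.
  have lim0 : (h^-1 *: ((flat p \o shift 0) (h *: (1 : R)) - flat p 0)) @[h --> 0^'] --> (0 : R).
    apply/cvgrPdist_le => e e0; near=> h.
    rewrite sub0r normrN /= /GRing.scale/= mulr1 addr0 {2}/flat ltxx subr0.
    have h1 : `|h| <= 1 by near: h; apply: dnbhs0_le.
    have he : `|h| <= e / (C + 1).
      by near: h; apply: dnbhs0_le; rewrite divr_gt0// ltr_wpDl.
    have [h0|h0] := ltP 0 h; last by rewrite /flat ltNge h0/= mulr0 normr0 ltW.
    rewrite (ger0_norm (ltW h0)) in h1 he.
    rewrite normrM (ger0_norm (_ : 0 <= h^-1)) ?invr_ge0 ?(ltW h0)//.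
    rewrite ler_pdivrMl//; apply: (le_trans (hC h _)); first by rewrite h0.
    rewrite expr2 mulrCA ler_wpM2l ?(ltW h0)//.
    move: he; rewrite ler_pdivlMr; last by rewrite ltr_wpDl.
    by nra.
  apply: DeriveDef; first by apply/cvg_ex; exists 0.
  exact/cvg_lim.
Unshelve. all: by end_near. Qed.

Lemma continuous_flat p : continuous (flat p).
Proof.
move=> x; have [h _] := is_derive_flat p x.
exact/differentiable_continuous/derivable1_diffP.
Qed.

Lemma flat_le0 p x : x <= 0 -> flat p x = 0.
Proof. by rewrite /flat leNgt => /negbTE ->. Qed.

Lemma flat1_gt0 x : (0 < flat 1 x) = (0 < x).
Proof.
have [x0|x0] := ltP 0 x; last by rewrite flat_le0 ?ltxx.
by rewrite /flat x0 hornerC mul1r expR_gt0.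
Qed.

Lemma flat1_ge0 x : 0 <= flat 1 x.
Proof. by rewrite /flat; case: ifP => // _; rewrite hornerC mul1r expR_ge0. Qed.

End flat_functions.

Section test_functions.
Context {R : realType} {d : nat}.
Local Notation vec := 'rV[R]_d.
Implicit Types (f g : vec -> R) (p : {poly R}) (x v z : vec) (e u : R).

Lemma is_derive_line (V : normedModType R) (f : V -> R) (x v : V) (df : R) :
  is_derive (0 : R) (1 : R) (fun h : R => f (x + h *: v)) df -> is_derive x v f df.
Proof.
move=> [h1 h2].
have E : (fun h : R => h^-1 *: ((f \o shift x) (h *: v) - f x)) =
    (fun h : R => h^-1 *: (((fun h : R => f (x + h *: v)) \o shift 0) (h *: (1 : R)) -
      (fun h : R => f (x + h *: v)) 0)).
  apply/funext => h /=; have -> : h *: (1 : R) = h by rewrite /GRing.scale/= mulr1.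
  by rewrite addr0 scale0r addr0 [x + _]addrC.
by split; rewrite /derivable /derive E.
Qed.

(** Closed under directional derivatives, so its members are smooth. *)
Inductive flat_algebra : (vec -> R) -> Prop :=
| FlatCst c : flat_algebra (fun=> c)
| FlatAdd f g : flat_algebra f -> flat_algebra g -> flat_algebra (fun x => f x + g x)
| FlatMul f g : flat_algebra f -> flat_algebra g -> flat_algebra (fun x => f x * g x)
| FlatCoord p a b i : flat_algebra (fun x => flat p (a + b * x 0 i)).

Lemma flat_algebra_derive f v : flat_algebra f ->
  exists2 g, flat_algebra g & forall x, is_derive x v f (g x).
Proof.
elim=> {f} [c|f1 f2 _ [g1 ag1 d1] _ [g2 ag2 d2]|f1 f2 a1 [g1 ag1 d1] a2 [g2 ag2 d2]|p a b i].
- exists (fun=> 0); first exact: FlatCst.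
  by move=> x; exact: (is_derive_cst c x v).
- exists (fun x => g1 x + g2 x); first exact: FlatAdd.
  by move=> x; exact: (is_deriveD (d1 x) (d2 x)).
- exists (fun x => f1 x * g2 x + f2 x * g1 x).
    by apply: FlatAdd; exact: FlatMul.
  by move=> x; exact: (is_deriveM (d1 x) (d2 x)).
- exists (fun x => b * v 0 i * flat (dflat p) (a + b * x 0 i)).
    by apply: FlatMul; [exact: FlatCst|exact: FlatCoord].
  move=> x; apply: is_derive_line.
  rewrite (_ : (fun h : R => _) = flat p \o
    (fun h => (a + b * x 0 i) - (- (b * v 0 i)) * h)); last first.
    by apply/funext => h /=; rewrite !mxE; congr flat; ring.
  have := @is_derive1_comp R (flat p) _ 0 _ _ (is_derive_flat p _)
    (is_derive_affine (a + b * x 0 i) (- (b * v 0 i)) 0).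
  move=> h; apply: (is_derive_eq h).
  by rewrite mulr0 subr0 opprK; ring.
Qed.

Lemma flat_algebra_continuous f : flat_algebra f -> continuous f.
Proof.
elim=> {f} [c|f1 f2 _ c1 _ c2|f1 f2 _ c1 _ c2|p a b i] x.
- exact: cst_continuous.
- exact: (continuousD (c1 x) (c2 x)).
- exact: (continuousM (c1 x) (c2 x)).
- apply: (continuous_comp (f := fun x : vec => a + b * x 0 i) (g := flat p)).
    apply: continuousD; first exact: cst_continuous.
    by apply: continuousM; [exact: cst_continuous|exact: coord_continuous].
  exact: continuous_flat.
Qed.

Lemma flat_algebra_smooth f : flat_algebra f -> smooth_on setT f.
Proof.
move=> af vs x _.
have ag : flat_algebra (iter_derive f vs).
  elim: vs => [//|v vs ih] /=.
  have [g ag dg] := flat_algebra_derive v ih.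
  rewrite (_ : (fun x => _) = g)//.
  by apply/funext => y; have [] := dg y.
split; first exact: flat_algebra_continuous.
by move=> v; have [g _ dg] := flat_algebra_derive v ag; have [] := dg x.
Qed.

Definition bump (e u : R) : R := flat 1 (e + u) * flat 1 (e - u).

Definition box_bump (e : R) (x z : vec) : R := \prod_(i < d) bump e (z 0 i - x 0 i).

Lemma box_bump_flat e x : flat_algebra (box_bump e x).
Proof.
rewrite /box_bump.
elim: (index_enum _) => [|i s ih].
  rewrite (_ : (fun z => _) = (fun=> 1)); first exact: FlatCst.
  by apply/funext => z; rewrite big_nil.
rewrite (_ : (fun z => _) = (fun z : vec => (flat 1 ((e - x 0 i) + 1 * z 0 i) *
   flat 1 ((e + x 0 i) + (-1) * z 0 i)) * \prod_(j <- s) bump e (z 0 j - x 0 j))).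
  by apply: FlatMul => //; apply: FlatMul; exact: FlatCoord.
apply/funext => z; rewrite big_cons; congr (_ * _).
by rewrite /bump; congr (flat _ _ * flat _ _); ring.
Qed.

Lemma bump_ge0 e u : 0 <= bump e u.
Proof. by rewrite mulr_ge0// flat1_ge0. Qed.

Lemma bump_gt0 e u : (0 < bump e u) = (- e < u < e).
Proof.
rewrite /bump; have [h1|h1] := ltP (- e) u; last first.
  by rewrite flat_le0 ?mul0r ?ltxx//; lra.
rewrite pmulr_rgt0 ?flat1_gt0 ?subr_gt0//; lra.
Qed.

Lemma bump_out e u : e <= `|u| -> bump e u = 0.
Proof.
rewrite ler_normr => /orP[h|h]; rewrite /bump.
  by rewrite (@flat_le0 _ 1 (e - u)) ?mulr0//; lra.
by rewrite (@flat_le0 _ 1 (e + u)) ?mul0r//; lra.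
Qed.

Lemma bumpN e u : bump e (- u) = bump e u.
Proof. by rewrite /bump opprK mulrC. Qed.

Lemma box_bump_ge0 e x z : 0 <= box_bump e x z.
Proof. by apply: prodr_ge0 => i _; exact: bump_ge0. Qed.

Lemma box_bump_out e x z i : e <= `|z 0 i - x 0 i| -> box_bump e x z = 0.
Proof. by move=> h; rewrite /box_bump (bigD1 i)//= bump_out// mul0r. Qed.

Lemma coord_le_euclidean (x : vec) i : `|x 0 i| <= euclidean_norm x.
Proof.
rewrite -sqrtr_sqr ler_sqrt ?dotmul_ge0// /dotmul (bigD1 i)//= -expr2 lerDl.
by apply: sumr_ge0 => j _; rewrite -expr2 sqr_ge0.
Qed.

Lemma euclidean_le (x : vec) (r : R) : (forall i, `|x 0 i| <= r) -> 0 <= r ->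
  euclidean_norm x <= Num.sqrt d%:R * r.
Proof.
move=> xr r0; rewrite -[in leRHS](ger0_norm r0) -sqrtr_sqr -sqrtrM//.
rewrite ler_wsqrtr// /dotmul -[d in leRHS]card_ord mulr_natl -sumr_const ler_sum// => i _.
rewrite -expr2 -[leLHS]real_normK ?num_real//.
by rewrite lerXn2r ?nnegrE.
Qed.

Lemma test_box_bump e x : 0 < e -> test_function (box_bump e x).
Proof.
move=> e0; split; first exact/flat_algebra_smooth/box_bump_flat.
pose r := e + euclidean_norm x; have r0 : 0 <= r by rewrite addr_ge0 ?sqrtr_ge0// ltW.
exists (Num.sqrt d%:R * r) => z rz.
have [i hi] : exists i, e <= `|z 0 i - x 0 i|.
  apply: contrapT => /forallNP h; move: rz; rewrite ltNge => /negP; apply.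
  apply: euclidean_le => // i; have := h i => /negP; rewrite -ltNge => hi.
  rewrite -(subrK (x 0 i) (z 0 i)) (le_trans (ler_normD _ _))// lerD// ?(ltW hi)//.
  exact: coord_le_euclidean.
exact: box_bump_out hi.
Qed.

End test_functions.

(** * Product integrals and integration on the line *)

Section product_integrals.
Context d1 d2 (T1 : measurableType d1) (T2 : measurableType d2) (R : realType).
Variables (m1 : {sigma_finite_measure set T1 -> \bar R})
          (m2 : {sigma_finite_measure set T2 -> \bar R}).
Implicit Types (f : T1 * T2 -> R) (g : T1 -> R) (h : T2 -> R).

Lemma integrable_tensor g h : m1.-integrable setT (EFin \o g) ->
  m2.-integrable setT (EFin \o h) ->
  (m1 \x m2)%E.-integrable setT (EFin \o (fun z => g z.1 * h z.2)).
Proof.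
move=> ig ih; have mg := measurable_int _ ig; have mh := measurable_int _ ih.
have mag : measurable_fun setT (abse \o (EFin \o g)) by exact: measurableT_comp.
have mah : measurable_fun setT (abse \o (EFin \o h)) by exact: measurableT_comp.
apply/integrable12ltyP.
  apply/measurable_EFinP; apply: measurable_funM.
    by apply: measurableT_comp => //; exact/measurable_EFinP.
  by apply: measurableT_comp => //; exact/measurable_EFinP.
have -> : (\int[m1]_x \int[m2]_y `|(EFin \o (fun z => g z.1 * h z.2)%R) (x, y)| =
    \int[m1]_x (`|(g x)%:E| * \int[m2]_y `|(h y)%:E|))%E.
  apply: eq_integral => x _ /=.
  rewrite -ge0_integralZl//.
  by apply: eq_integral => y _ /=; rewrite normrM EFinM.
have /integrableP[_ hoo] := ih; have /integrableP[_ goo] := ig.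
rewrite ge0_integralZr//; last exact: integral_ge0.
by apply: lte_mul_pinfty => //; [exact: integral_ge0|rewrite ge0_fin_numE//; exact: integral_ge0].
Qed.

Variables (f : T1 * T2 -> R) (g : T1 -> R) (h : T2 -> R).
Hypotheses (mf : measurable_fun setT f) (ig : m1.-integrable setT (EFin \o g))
  (ih : m2.-integrable setT (EFin \o h)) (fgh : forall x y, `|f (x, y)| <= g x * h y).

Lemma tensor_bounded_integrable : (m1 \x m2)%E.-integrable setT (EFin \o f).
Proof.
apply: (integrable_bounded_by (g := fun z => g z.1 * h z.2)) => //.
  exact: integrable_tensor.
by move=> [x y]; exact: fgh.
Qed.

Lemma tensor_bounded_integrable2 x : m2.-integrable setT (EFin \o (fun y => f (x, y))).
Proof.
apply: (integrable_bounded_by (g := fun y => g x * h y)) => //.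
- by apply: (measurableT_comp mf); exact: pair1_measurable.
- exact: integrable_mull.
Qed.

Lemma tensor_bounded_integrable1 y : m1.-integrable setT (EFin \o (fun x => f (x, y))).
Proof.
apply: (integrable_bounded_by (g := fun x => h y * g x)) => //.
- by apply: (measurableT_comp mf); exact: pair2_measurable.
- exact: integrable_mull.
- by move=> x; rewrite mulrC.
Qed.

Lemma Rintegral_product :
  \int[(m1 \x m2)%E]_z f z = \int[m1]_x \int[m2]_y f (x, y).
Proof.
rewrite /Rintegral -integral12_prod_meas1; last exact: tensor_bounded_integrable.
congr fine; apply: eq_integral => x _.
by rewrite fineK//; exact: integrable_fin_num (tensor_bounded_integrable2 x).
Qed.

Lemma Rintegral_swap :
  \int[m1]_x \int[m2]_y f (x, y) = \int[m2]_y \int[m1]_x f (x, y).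
Proof.
rewrite -Rintegral_product /Rintegral -integral21_prod_meas1; last exact: tensor_bounded_integrable.
congr fine; apply: eq_integral => y _.
by rewrite fineK//; exact: integrable_fin_num (tensor_bounded_integrable1 y).
Qed.

Lemma partial_integrable :
  m1.-integrable setT (EFin \o (fun x => \int[m2]_y f (x, y))).
Proof.
rewrite (_ : _ \o _ = fubini_F m2 (EFin \o f)).
  exact: (integrable_fubini_F tensor_bounded_integrable).
apply/funext => x /=; rewrite /Rintegral fineK//.
exact: integrable_fin_num (tensor_bounded_integrable2 x).
Qed.

End product_integrals.

Section lebesgue_invariance.
Context {R : realType}.
Local Notation leb1 := (@lebesgue_measure R).
Implicit Types (f : R -> R) (b : R).

Definition lebesgue_image (phi : measurableTypeR R -> measurableTypeR R)
    (mphi : measurable_fun setT phi) : {measure set (measurableTypeR R) -> \bar R} :=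
  @measure_function_pushforward__canonical__measure_function_Measure _ _ _ _ R leb1 _ mphi.

(** Lebesgue measure is determined by the half-open intervals, so invariance has
    to be checked on these only. *)
Lemma invariant_integral (phi : measurableTypeR R -> measurableTypeR R)
    (mphi : measurable_fun setT phi) f :
  (forall X, ocitv X -> leb1 X = lebesgue_image mphi X) ->
  leb1.-integrable setT (EFin \o f) ->
  leb1.-integrable setT (EFin \o (f \o phi)) /\
  \int[leb1]_x f (phi x) = \int[leb1]_x f x.
Proof.
move=> inv if_; have /integrableP[mf foo] := if_.
have E A : measurable A -> lebesgue_image mphi A = leb1 A.
  by move=> mA; apply/esym/(@lebesgue_measure_unique R (lebesgue_image mphi)).
have mfa : measurable_fun setT (abse \o (EFin \o f)) by exact: measurableT_comp.
have ifp : leb1.-integrable setT ((EFin \o f) \o phi).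
  apply/integrableP; split; first exact: (measurableT_comp mf mphi).
  rewrite (_ : (\int[leb1]_x _ =
      \int[lebesgue_image mphi]_x (abse \o (EFin \o f)) x)%E); last first.
    rewrite (ge0_integral_pushforward mphi) ?preimage_setT//.
    by move=> y _ /=; rewrite lee_fin.
  rewrite (eq_measure_integral leb1)// => A mA _; exact: E.
split=> //; congr fine.
rewrite [RHS](eq_measure_integral (lebesgue_image mphi)); last first.
  by move=> A mA _; exact/esym/E.
by rewrite (integral_pushforward mphi) ?preimage_setT.
Qed.

Lemma shift_integral f b : leb1.-integrable setT (EFin \o f) ->
  leb1.-integrable setT (EFin \o (fun x => f (x + b))) /\
  \int[leb1]_x f (x + b) = \int[leb1]_x f x.
Proof.
have mb : measurable_fun setT (fun x : R => x + b).
  by apply: measurable_funD => //; exact: measurable_cst.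
apply: (invariant_integral (mphi := mb)) => _ [[p q] _ <-].
rewrite /lebesgue_image/= /pushforward.
rewrite (_ : _ @^-1` _ = [set` `]p - b, q - b]%R]); last first.
  by apply/seteqP; split => x /=; rewrite !in_itv/= ltrBlDr lerBrDr.
rewrite !lebesgue_measure_itv/= !lte_fin ltrD2r.
by case: ifP => // _; rewrite -!EFinD; congr EFin; ring.
Qed.

Lemma opp_integral f : leb1.-integrable setT (EFin \o f) ->
  leb1.-integrable setT (EFin \o (fun x => f (- x))) /\
  \int[leb1]_x f (- x) = \int[leb1]_x f x.
Proof.
have mb : measurable_fun setT (fun x : R => - x) by exact: continuous_measurable_fun opp_continuous.
apply: (invariant_integral (mphi := mb)) => _ [[p q] _ <-].
rewrite /lebesgue_image/= /pushforward.
rewrite (_ : _ @^-1` _ = [set` `[- q, - p[%R]); last first.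
  by apply/seteqP; split => x /=; rewrite !in_itv/= => /andP[? ?]; apply/andP; split; lra.
rewrite !lebesgue_measure_itv/= !lte_fin ltrN2.
by case: ifP => // _; rewrite -!EFinD; congr EFin; ring.
Qed.

Lemma Rintegral_odd f : leb1.-integrable setT (EFin \o f) ->
  (forall x, f (- x) = - f x) -> \int[leb1]_x f x = 0.
Proof.
move=> if_ fN; have [_] := opp_integral if_.
under eq_Rintegral do rewrite fN -mulN1r.
by rewrite RintegralZl// mulN1r; lra.
Qed.

Lemma compact_support_Rintegral f e : (forall u, e < `|u| -> f u = 0) ->
  \int[leb1]_u f u = \int[leb1]_(u in `[- e, e]) f u.
Proof.
move=> f0; rewrite [RHS]Rintegral_mkcond; apply: eq_Rintegral => u _.
rewrite patchE; case: ifPn => // ue; apply: f0.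
rewrite ltNge; apply: contra ue => ue.
by rewrite inE/= in_itv/= -ler_norml.
Qed.

Lemma continuous_compact_support_integrable f e : continuous f ->
  (forall u, e < `|u| -> f u = 0) -> leb1.-integrable setT (EFin \o f).
Proof.
move=> cf f0.
have : leb1.-integrable `[- e, e] (EFin \o f).
  apply: continuous_compact_integrable; first exact: segment_compact.
  exact: continuous_subspaceT.
move/integrable_mkcond => /(_ (measurable_itv _)).
rewrite (_ : _ \_ _ = EFin \o f)//.
apply/funext => u; rewrite patchE; case: ifPn => //= ue; rewrite f0//.
rewrite ltNge; apply: contra ue => ue.
by rewrite inE/= in_itv/= -ler_norml.
Qed.

Lemma Rintegral_derive_compact_support (F f : R -> R) e : 0 < e -> continuous f ->
  (forall u, is_derive u (1 : R) F (f u)) ->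
  (forall u, e <= `|u| -> F u = 0) -> (forall u, e < `|u| -> f u = 0) ->
  \int[leb1]_u f u = 0.
Proof.
move=> e0 cf dF F0 f0; rewrite (compact_support_Rintegral f0) /Rintegral.
have cF u : {for u, continuous F}.
  by have [h _] := dF u; exact/differentiable_continuous/derivable1_diffP.
rewrite (@continuous_FTC2 R f F (- e) e).
- by rewrite !F0 ?normrN ?ger0_norm ?(ltW e0)// subee.
- lra.
- exact: continuous_subspaceT.
- split; first by move=> u _; have [] := dF u.
  + by apply: cvg_at_right_filter; exact: cF.
  + by apply: cvg_at_left_filter; exact: cF.
- by move=> u _; rewrite derive1E; have [] := dF u.
Qed.

End lebesgue_invariance.

(** * The Cauchy and Abel kernels *)

Section lebesgue_kernels.
Context {R : realType}.
Local Notation leb1 := (@lebesgue_measure R).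
Implicit Types (t u v w z del : R).

Lemma even_ge0_integral (f F : R -> R) (l : R) : (forall x, 0 <= x -> 0 <= f x) ->
  continuous f -> F x @[x --> +oo] --> l ->
  (forall x, is_derive x (1 : R) F (f x)) ->
  leb1.-integrable setT (EFin \o (fun x : R => f `|x|)) /\
  \int[leb1]_x f `|x| = 2 * (l - F 0).
Proof.
move=> f0 cf Fl dF.
have cfa : continuous (fun x : R => f `|x|).
  move=> x; apply: (@continuous_comp R R R (fun x : R => `|x|) f); last exact: cf.
  exact: norm_continuous.
have E : (\int[leb1]_x (f `|x|)%:E = (2 * (l - F 0))%:E)%E.
  rewrite ge0_symfun_integralT//; last 2 first.
  - by move=> x; exact: f0.
  - by move=> x /=; rewrite normrN.
  rewrite -set_itvcy.
  have -> : (\int[leb1]_(x in `[0%R, +oo[) (f `|x|)%:E =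
      \int[leb1]_(x in `[0%R, +oo[) (f x)%:E)%E.
    by apply: eq_integral => x; rewrite inE/= in_itv/= andbT => x0; rewrite ger0_norm.
  have h1 : forall x : R, 0 < x -> derivable F x 1 by move=> x _; have [] := dF x.
  have h2 : F x @[x --> 0^'+] --> F 0.
    apply: cvg_at_right_filter; have [h _] := dF 0.
    exact/differentiable_continuous/derivable1_diffP.
  have h3 : {in `]0, +oo[%R, derive1 F =1 f}.
    by move=> x _; rewrite derive1E; have [] := dF x.
  rewrite (ge0_continuous_FTC2y f0 (continuous_subspaceT cf) Fl h1 h2 h3).
  by rewrite -EFinB -EFinM.
split; last by rewrite /Rintegral E.
apply/integrableP; split.
  by apply/measurable_EFinP; exact: continuous_measurable_fun.
rewrite (_ : (\int[leb1]_x _ = \int[leb1]_x (f `|x|)%:E)%E).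
  by rewrite E ltry.
by apply: eq_integral => x _ /=; rewrite ger0_norm// f0.
Qed.

Definition cauchy v : R := (1 + v ^+ 2)^-1.

Lemma cauchy_pos v : 0 < 1 + v ^+ 2.
Proof. by rewrite ltr_pwDl// sqr_ge0. Qed.

Lemma continuous_cauchy : continuous cauchy.
Proof.
move=> v; rewrite /continuous_at /cauchy; apply: cvgV.
  by rewrite gt_eqF// cauchy_pos.
by apply: cvgD; [exact: cvg_cst|exact: exprn_continuous].
Qed.

Lemma cauchy_integral : leb1.-integrable setT (EFin \o cauchy) /\
  \int[leb1]_v cauchy v = pi.
Proof.
have cE v : cauchy `|v| = cauchy v by rewrite /cauchy real_normK ?num_real.
have [] := @even_ge0_integral cauchy atan (pi / 2) _ continuous_cauchy (@cvgy_atan R).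
- by move=> x _; rewrite invr_ge0 ltW// cauchy_pos.
rewrite (_ : (fun x : R => cauchy `|x|) = cauchy); last exact/funext.
move=> h1 h2; split => //.
have E2 : 2 * (pi / 2 - atan 0) = pi :> R by rewrite atan0; field.
by rewrite -[RHS]E2.
Qed.

Lemma expR_decay_cvg del (g : R -> R) C : 0 < del -> (forall x, `|g x| <= C) ->
  expR (- (del * x)) * g x @[x --> +oo] --> (0 : R).
Proof.
move=> d0 gC; have C0 : 0 <= C by exact: le_trans (gC 0).
have h : expR (- (del * x)) * (C + 1) @[x --> +oo] --> (0 : R).
  rewrite -[X in _ --> X](mul0r (C + 1)); apply: cvgMr_tmp.
  have : (fun x : R => del * x) @ +oo --> +oo by apply: gt0_cvgMry => //; exact: cvg_id.
  by move=> h; exact: (cvg_comp _ _ h (@cvgr_expR R)).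
apply/cvgrPdist_le => e e0.
move/cvgrPdist_le : h => /(_ _ e0); apply: filterS => x.
rewrite !sub0r !normrN !normrM (ger0_norm (expR_ge0 _)); apply: le_trans.
rewrite ler_wpM2l ?expR_ge0// (le_trans (gC x))// ger0_norm; lra.
Qed.

Lemma is_derive_expR_decay del x :
  is_derive x (1 : R) (fun x => expR (- (del * x))) (- del * expR (- (del * x))).
Proof.
have h := is_derive_affine 0 del x.
have h2 := @is_derive1_comp R expR (fun y => 0 - del * y) x _ _ (is_derive_expR _) h.
rewrite (_ : (fun x => _) = expR \o (fun y => 0 - del * y)); last first.
  by apply/funext => y /=; rewrite sub0r.
by apply: (is_derive_eq h2); rewrite sub0r mulrC.
Qed.

Lemma is_derive_sin_mul z x : is_derive x (1 : R) (fun x => sin (x * z)) (z * cos (x * z)).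
Proof.
have h := is_derive_affine 0 (- z) x.
have h2 := @is_derive1_comp R sin (fun y => 0 - - z * y) x _ _ (is_derive_sin _) h.
rewrite (_ : (fun x => _) = sin \o (fun y => 0 - - z * y)); last first.
  by apply/funext => y /=; congr sin; ring.
by apply: (is_derive_eq h2); rewrite opprK mulrC; congr (_ * cos _); ring.
Qed.

Lemma is_derive_cos_mul z x : is_derive x (1 : R) (fun x => cos (x * z)) (- (z * sin (x * z))).
Proof.
have h := is_derive_affine 0 (- z) x.
have h2 := @is_derive1_comp R cos (fun y => 0 - - z * y) x _ _ (is_derive_cos _) h.
rewrite (_ : (fun x => _) = cos \o (fun y => 0 - - z * y)); last first.
  by apply/funext => y /=; congr cos; ring.
by apply: (is_derive_eq h2); rewrite opprK mulNr mulrC; congr (- (_ * sin _)); ring.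
Qed.

Lemma continuous_mulr_cst z : continuous (fun x : R => x * z).
Proof. by move=> x; apply: continuousM; [exact: cvg_id|exact: cst_continuous]. Qed.

Lemma continuous_cos_mul z : continuous (fun x : R => cos (x * z)).
Proof.
move=> x; apply: (@continuous_comp R R R (fun x : R => x * z) cos).
  exact: continuous_mulr_cst.
exact: continuous_cos.
Qed.

Lemma continuous_sin_mul z : continuous (fun x : R => sin (x * z)).
Proof.
move=> x; apply: (@continuous_comp R R R (fun x : R => x * z) sin).
  exact: continuous_mulr_cst.
exact: continuous_sin.
Qed.

Lemma continuous_expR_decay del : continuous (fun x : R => expR (- (del * x))).
Proof.
move=> x; have [h _] := is_derive_expR_decay del x.
exact/differentiable_continuous/derivable1_diffP.
Qed.

(** Adding [1] to the cosine makes the integrand nonnegative, so that its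
    explicit primitive [F] gives both integrability and the value. *)
Lemma abel_integral_aux del z : 0 < del ->
  leb1.-integrable setT (EFin \o (fun t => expR (- (del * `|t|)) * (1 + cos (`|t| * z)))) /\
  \int[leb1]_t (expR (- (del * `|t|)) * (1 + cos (`|t| * z))) =
  2 / del + 2 * del / (del ^+ 2 + z ^+ 2).
Proof.
move=> d0; pose D := del ^+ 2 + z ^+ 2.
have D0 : 0 < D by rewrite ltr_pwDl ?exprn_gt0// sqr_ge0.
pose g x := - del^-1 + (z * sin (x * z) - del * cos (x * z)) / D.
pose F x := expR (- (del * x)) * g x.
have gC x : `|g x| <= del^-1 + (`|z| + del) / D.
  apply: (le_trans (ler_normD _ _)); rewrite normrN (ger0_norm (_ : 0 <= del^-1)) ?invr_ge0 ?(ltW d0)//.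
  rewrite lerD2l normrM (ger0_norm (_ : 0 <= D^-1)) ?invr_ge0 ?(ltW D0)//.
  rewrite ler_wpM2r ?invr_ge0 ?(ltW D0)// (le_trans (ler_normB _ _))//.
  rewrite !normrM (gtr0_norm d0) lerD//.
    by rewrite ler_piMr// sin_max.
  by rewrite ler_piMr ?(ltW d0)// cos_max.
have F0 : F 0 = - del^-1 - del / D.
  by rewrite /F /g mulr0 oppr0 expR0 !mul0r sin0 cos0; ring.
have dF x : is_derive x (1 : R) F (expR (- (del * x)) * (1 + cos (x * z))).
  have h1 := is_derive_expR_decay del x.
  have h2 : is_derive x (1 : R) g ((z * (z * cos (x * z)) + del * (z * sin (x * z))) / D).
    have hs := is_deriveM (is_derive_cst z x (1 : R)) (is_derive_sin_mul z x).
    have hc := is_deriveM (is_derive_cst del x (1 : R)) (is_derive_cos_mul z x).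
    have hsc := is_deriveM (is_deriveB hs hc) (is_derive_cst D^-1 x (1 : R)).
    have h := is_deriveD (is_derive_cst (- del^-1) x (1 : R)) hsc.
    by apply: (is_derive_eq h); rewrite /GRing.scale/= /cst; ring.
  apply: (is_derive_eq (is_deriveM h1 h2)).
  rewrite /GRing.scale/= /g.
  set E := expR _; set c := cos _; set s := sin _.
  by rewrite /D; field; rewrite !gt_eqF.
have := @even_ge0_integral (fun x => expR (- (del * x)) * (1 + cos (x * z))) F 0 _ _ _ dF.
rewrite F0 => h; have [] := h.
- by move=> x _; rewrite mulr_ge0 ?expR_ge0//; have := cos_geN1 (x * z); lra.
- move=> x; rewrite /continuous_at; apply: cvgM; first exact: continuous_expR_decay.
  by apply: cvgD; [exact: cvg_cst|exact: continuous_cos_mul].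
- exact: expR_decay_cvg gC.
move=> i1 ->; split => //.
by rewrite /D; field; rewrite !gt_eqF.
Qed.

(** The Fourier transform of [exp (- del |t|)] is a Poisson kernel, obtained by
    subtracting the case [z = 0] of the previous computation. *)
Lemma abel_integral del z : 0 < del ->
  leb1.-integrable setT (EFin \o (fun t => expR (- (del * `|t|)))) /\
  \int[leb1]_t (expR (- (del * `|t|)) * cos (t * z)) = 2 * del / (del ^+ 2 + z ^+ 2).
Proof.
move=> d0.
have cabs t x : cos (`|t| * x) = cos (t * x).
  by have [t0|t0] := leP 0 t; [rewrite ger0_norm|rewrite ltr0_norm// mulNr cosN].
have [i0 e0] := abel_integral_aux 0 d0.
have [i1 e1] := abel_integral_aux z d0.
have i2 : leb1.-integrable setT (EFin \o (fun t => expR (- (del * `|t|)))).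
  have := integrable_mull 2^-1 i0; congr (_.-integrable _ _).
  by apply/funext => t /=; rewrite mulr0 cos0; congr EFin; field.
have e2 : \int[leb1]_t expR (- (del * `|t|)) = 2 / del.
  move: e0; have -> : \int[leb1]_t (expR (- (del * `|t|)) * (1 + cos (`|t| * 0))) =
      2 * \int[leb1]_t expR (- (del * `|t|)).
    rewrite -RintegralZl//; apply: eq_Rintegral => t _.
    by rewrite mulr0 cos0; ring.
  rewrite expr0n/= addr0 (_ : 2 * del / del ^+ 2 = 2 / del); last by field; rewrite gt_eqF.
  lra.
split=> //.
rewrite (_ : \int[leb1]_t _ = \int[leb1]_t
  (expR (- (del * `|t|)) * (1 + cos (`|t| * z)) - expR (- (del * `|t|)))); last first.
  by apply: eq_Rintegral => t _; rewrite cabs; ring.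
by rewrite RintegralB// e1 e2; ring.
Qed.

Lemma Rintegral_scale del (G : R -> R) : 0 < del -> continuous G -> (forall x, 0 <= G x) ->
  \int[leb1]_x G x = \int[leb1]_x (G (del * x) * del).
Proof.
move=> d0 cG G0.
have dF x : is_derive x (1 : R) (fun x => del * x) del.
  have h := is_derive_affine 0 (- del) x.
  rewrite (_ : (fun x => del * x) = (fun y => 0 - - del * y)); last first.
    by apply/funext => y; ring.
  by apply: (is_derive_eq h); rewrite opprK.
have F' : derive1 (fun x : R => del * x) = cst del.
  by apply/funext => x; rewrite derive1E; have [] := dF x.
congr fine.
have h1 : {homo (fun x : R => del * x) : x y / x < y} by move=> x y xy; rewrite ltr_pM2l.
have h2 : continuous (derive1 (fun x : R => del * x)).
  by rewrite F' => x; exact: cst_continuous.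
have h3 : cvg (derive1 (fun x : R => del * x) x @[x --> -oo]).
  by rewrite F'; exact: is_cvg_cst.
have h4 : cvg (derive1 (fun x : R => del * x) x @[x --> +oo]).
  by rewrite F'; exact: is_cvg_cst.
have h5 x : derivable (fun x : R => del * x) x 1 by have [] := dF x.
have h6 : (fun x : R => del * x) x @[x --> -oo] --> -oo.
  by apply: gt0_cvgMrNy => //; exact: cvg_id.
have h7 : (fun x : R => del * x) x @[x --> +oo] --> +oo.
  by apply: gt0_cvgMry => //; exact: cvg_id.
by rewrite (increasing_ge0_integration_by_substitutionT h1 h2 h3 h4 h5 h6 h7 cG G0) F'.
Qed.

End lebesgue_kernels.

(** * Fourier inversion for a bump *)

Section bump_fourier.
Context {R : realType}.
Local Notation leb1 := (@lebesgue_measure R).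
Variables (e : R).
Hypothesis e0 : 0 < e.
Implicit Types (p q : {poly R}) (t u w y : R).

(** The bump is the pair of the constant polynomials [1], and its derivatives are
    combinations of such pairs. *)
Definition flat_pair p q u : R := flat p (e + u) * flat q (e - u).

Lemma continuous_flat_pair p q : continuous (flat_pair p q).
Proof.
move=> u; rewrite /continuous_at; apply: cvgM.
  apply: (@continuous_comp R R R (fun u : R => e + u) (flat p)); last exact: continuous_flat.
  by apply: cvgD; [exact: cvg_cst|exact: cvg_id].
apply: (@continuous_comp R R R (fun u : R => e - u) (flat q)); last exact: continuous_flat.
by apply: cvgB; [exact: cvg_cst|exact: cvg_id].
Qed.

Lemma flat_pair_out p q u : e <= `|u| -> flat_pair p q u = 0.
Proof.
rewrite ler_normr => /orP[h|h]; rewrite /flat_pair.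
  by rewrite (@flat_le0 _ q (e - u)) ?mulr0//; lra.
by rewrite (@flat_le0 _ p (e + u)) ?mul0r//; lra.
Qed.

Lemma is_derive_flat_pair p q u :
  is_derive u (1 : R) (flat_pair p q) (flat_pair (dflat p) q u - flat_pair p (dflat q) u).
Proof.
have h1 := @is_derive1_comp R (flat p) _ u _ _ (is_derive_flat p _) (is_derive_affine e (- 1) u).
have h2 := @is_derive1_comp R (flat q) _ u _ _ (is_derive_flat q _) (is_derive_affine e 1 u).
have E : flat_pair p q = (flat p \o (fun y => e - -1 * y)) * (flat q \o (fun y => e - 1 * y)).
  by apply/funext => y /=; rewrite /flat_pair !fctE; congr (flat _ _ * flat _ _); ring.
rewrite E; apply: (is_derive_eq (is_deriveM h1 h2)).
rewrite /GRing.scale/= /flat_pair opprK !mulN1r opprK mul1r; ring.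
Qed.

Lemma flat_pair_integrable p q (g : R -> R) : continuous g ->
  leb1.-integrable setT (EFin \o (fun u => flat_pair p q u * g u)).
Proof.
move=> cg; apply: (@continuous_compact_support_integrable _ _ e).
  by move=> u; apply: cvgM; [exact: continuous_flat_pair|exact: cg].
by move=> u /ltW ue; rewrite flat_pair_out// mul0r.
Qed.

Lemma flat_pair_parts p q (g dg : R -> R) : continuous g -> continuous dg ->
  (forall u, is_derive u (1 : R) g (dg u)) ->
  \int[leb1]_u (flat_pair p q u * dg u) =
  \int[leb1]_u (flat_pair p (dflat q) u * g u) - \int[leb1]_u (flat_pair (dflat p) q u * g u).
Proof.
move=> cg cdg dg_.
have := @Rintegral_derive_compact_support R (flat_pair p q * g)
  (fun u => flat_pair p q u * dg u - (flat_pair p (dflat q) u * g u -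
     flat_pair (dflat p) q u * g u)) e e0.
rewrite RintegralB//; last 2 first.
  exact: flat_pair_integrable.
  have := integrable_addr (flat_pair_integrable p (dflat q) cg)
     (integrable_mull (-1) (flat_pair_integrable (dflat p) q cg)).
  by congr (_.-integrable _ _); apply/funext => u /=; rewrite mulN1r.
rewrite RintegralB//; [|exact: flat_pair_integrable..].
move=> h; apply/eqP; rewrite -subr_eq0; apply/eqP/h.
- move=> u; apply: cvgB.
    by apply: cvgM; [exact: continuous_flat_pair|exact: cdg].
  by apply: cvgB; apply: cvgM; [exact: continuous_flat_pair|exact: cg|exact: continuous_flat_pair|exact: cg].
- move=> u; apply: (is_derive_eq (is_deriveM (is_derive_flat_pair p q u) (dg_ u))).
  by rewrite /GRing.scale/=; ring.
- by move=> u ue; rewrite fctE flat_pair_out// mul0r.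
- by move=> u /ltW ue; rewrite !flat_pair_out// !mul0r !subr0.
Qed.

(** Each integration by parts gains a factor [t] and stays among flat pairs. *)
Lemma flat_pair_fourier_decay (k : nat) p q : exists2 C, 0 <= C &
  forall t, `|t| ^+ k * `|\int[leb1]_u (flat_pair p q u * cos (u * t))| <= C /\
            `|t| ^+ k * `|\int[leb1]_u (flat_pair p q u * sin (u * t))| <= C.
Proof.
elim: k p q => [|k ih] p q.
  have iE := flat_pair_integrable p q (@cst_continuous R R 1).
  exists (\int[leb1]_u `|flat_pair p q u * 1|).
    by apply: Rintegral_ge0 => u _.
  move=> t; rewrite expr0 !mul1r.
  have iN : leb1.-integrable setT (EFin \o (fun u => `|flat_pair p q u * 1|)).
    exact: integrable_norm iE.
  split; (apply: le_trans (le_normr_Rintegral _ _) _ => //;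
    [apply: flat_pair_integrable; first [exact: continuous_cos_mul | exact: continuous_sin_mul]|]);
    apply: le_Rintegral => //.
  + by apply: integrable_norm; apply: flat_pair_integrable; exact: continuous_cos_mul.
  + by move=> u _; rewrite mulr1 normrM ler_piMr// cos_max.
  + by apply: integrable_norm; apply: flat_pair_integrable; exact: continuous_sin_mul.
  + by move=> u _; rewrite mulr1 normrM ler_piMr// sin_max.
have [C1 C10 h1] := ih p (dflat q); have [C2 C20 h2] := ih (dflat p) q.
exists (C1 + C2); first exact: addr_ge0.
move=> t; have [h1c h1s] := h1 t; have [h2c h2s] := h2 t.
have cc := @continuous_cos_mul R t; have cs := @continuous_sin_mul R t.
have Pc : t * \int[leb1]_u (flat_pair p q u * cos (u * t)) =
    \int[leb1]_u (flat_pair p (dflat q) u * sin (u * t)) -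
    \int[leb1]_u (flat_pair (dflat p) q u * sin (u * t)).
  have cd : continuous (fun u => t * cos (u * t)).
    by move=> u; apply: cvgM; [exact: cvg_cst|exact: cc].
  rewrite -(flat_pair_parts p q cs cd (is_derive_sin_mul t)).
  rewrite -RintegralZl//; last exact: flat_pair_integrable.
  by apply: eq_Rintegral => u _; ring.
have Ps : t * \int[leb1]_u (flat_pair p q u * sin (u * t)) =
    - (\int[leb1]_u (flat_pair p (dflat q) u * cos (u * t)) -
    \int[leb1]_u (flat_pair (dflat p) q u * cos (u * t))).
  have cd : continuous (fun u => - (t * sin (u * t))).
    by move=> u; apply: cvgN; apply: cvgM; [exact: cvg_cst|exact: cs].
  rewrite -(flat_pair_parts p q cc cd (is_derive_cos_mul t)).
  rewrite -[RHS]mulN1r -!RintegralZl//; last 2 first.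
  - exact: flat_pair_integrable.
  - exact: flat_pair_integrable.
  by apply: eq_Rintegral => u _; ring.
have t0 : 0 <= `|t| ^+ k by rewrite exprn_ge0.
split; rewrite exprSr -mulrA -normrM ?Pc ?Ps ?normrN.
- by apply: (le_trans (ler_wpM2l t0 (ler_normB _ _))); rewrite mulrDr lerD.
- by apply: (le_trans (ler_wpM2l t0 (ler_normB _ _))); rewrite mulrDr lerD.
Qed.

(** The bump is even, so its Fourier transform reduces to the cosine part. *)
Definition bump_hat t : R := \int[leb1]_u (bump e u * cos (u * t)).

Lemma bump_integrable (g : R -> R) : continuous g ->
  leb1.-integrable setT (EFin \o (fun u => bump e u * g u)).
Proof. exact: flat_pair_integrable. Qed.

Lemma bump_integrable1 : leb1.-integrable setT (EFin \o bump e).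
Proof.
have := bump_integrable (@cst_continuous R R 1); congr (_.-integrable _ _).
by apply/funext => u /=; rewrite mulr1.
Qed.

Lemma continuous_bump : continuous (bump e).
Proof. exact: continuous_flat_pair. Qed.

Lemma bump_le1 u : bump e u <= 1.
Proof.
have h y : 0 <= flat 1 y <= 1.
  rewrite flat1_ge0/=; have [y0|y0] := ltP 0 y; last by rewrite flat_le0.
  by rewrite /flat y0 hornerC mul1r expR_le1 oppr_le0 invr_ge0 ltW.
have /andP[a1 a2] := h (e + u); have /andP[b1 b2] := h (e - u).
by rewrite /bump -[leRHS]mul1r ler_pM.
Qed.

Lemma bump_mass_gt0 : 0 < \int[leb1]_u bump e u.
Proof.
rewrite lt_neqAle Rintegral_ge0 ?andbT; last by move=> u _; exact: bump_ge0.
apply/negP => /eqP h0.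
have c0 : 0 < bump e 0 by rewrite bump_gt0 oppr_lt0 e0.
have : \forall u \near 0, bump e 0 / 2 < bump e u.
  have h2 : bump e 0 / 2 < bump e 0 by rewrite ltr_pdivrMr// ltr_pMr// ltr1n.
  have cb : bump e u @[u --> (0 : R)] --> bump e 0 by exact: continuous_bump.
  by move/cvgr_gt : cb; apply.
move=> [r /= r0 hr].
have sub : forall u, u \in `[- (r / 2), r / 2] -> bump e 0 / 2 < bump e u.
  move=> u; rewrite in_itv/= -ler_norml => ur; apply: hr => /=.
  by rewrite sub0r normrN (le_lt_trans ur)//; lra.
pose m := bump e 0 / 2.
have : \int[leb1]_(u in `[- (r / 2), r / 2]) m <= \int[leb1]_u bump e u.
  rewrite Rintegral_mkcond; apply: le_Rintegral => //.
  - have := @continuous_compact_integrable R (cst m) `[- (r / 2), r / 2].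
    move=> h; have : leb1.-integrable `[- (r / 2), r / 2] (EFin \o cst m).
      apply: h; first exact: segment_compact.
      by apply: continuous_subspaceT; exact: cst_continuous.
    by move/integrable_mkcond => /(_ (measurable_itv _)); rewrite restrict_EFin.
  - exact: bump_integrable1.
  - move=> u _; rewrite patchE; case: ifPn => [|_]; last exact: bump_ge0.
    by rewrite inE/= => /sub/ltW.
rewrite -h0 Rintegral_cst//= lebesgue_measure_itv/= lte_fin.
rewrite (_ : (- (r / 2) < r / 2)%R = true); last lra.
by rewrite -EFinB/= /m => h; nra.
Qed.

Lemma bump_sin0 t : \int[leb1]_u (bump e u * sin (u * t)) = 0.
Proof.
apply: Rintegral_odd; first by apply: bump_integrable; exact: continuous_sin_mul.
by move=> u; rewrite bumpN mulNr sinN mulrN.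
Qed.

Lemma bump_trig t a b :
  \int[leb1]_u (bump e u * (a * cos (u * t) + b * sin (u * t))) = bump_hat t * a.
Proof.
have ic := bump_integrable (@continuous_cos_mul R t).
have is_ := bump_integrable (@continuous_sin_mul R t).
rewrite (_ : \int[leb1]_u _ = \int[leb1]_u (a * (bump e u * cos (u * t)) +
   b * (bump e u * sin (u * t)))); last by apply: eq_Rintegral => u _; ring.
rewrite RintegralD//; [|exact: integrable_mull..].
by rewrite !RintegralZl// bump_sin0 mulr0 addr0 mulrC.
Qed.

Lemma bump_hat_cos t x :
  \int[leb1]_u (bump e (u - x) * cos (u * t)) = bump_hat t * cos (x * t).
Proof.
rewrite -(bump_trig t _ (- sin (x * t))).
have cf : continuous (fun u => cos (x * t) * cos (u * t) + - sin (x * t) * sin (u * t)).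
  by move=> u; apply: cvgD; apply: cvgM;
    [exact: cvg_cst|exact: continuous_cos_mul|exact: cvg_cst|exact: continuous_sin_mul].
have [_ <-] := shift_integral (- x) (bump_integrable cf).
apply: eq_Rintegral => u _; congr (_ * _).
rewrite (_ : u * t = (u - x) * t + x * t) ?cosD; ring.
Qed.

Lemma bump_hat_sin t x :
  \int[leb1]_u (bump e (u - x) * sin (u * t)) = bump_hat t * sin (x * t).
Proof.
rewrite -(bump_trig t _ (cos (x * t))).
have cf : continuous (fun u => sin (x * t) * cos (u * t) + cos (x * t) * sin (u * t)).
  by move=> u; apply: cvgD; apply: cvgM;
    [exact: cvg_cst|exact: continuous_cos_mul|exact: cvg_cst|exact: continuous_sin_mul].
have [_ <-] := shift_integral (- x) (bump_integrable cf).
apply: eq_Rintegral => u _; congr (_ * _).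
rewrite (_ : u * t = (u - x) * t + x * t) ?sinD; ring.
Qed.

(** The Cauchy density comes from a decay of order 4: order 2 for the weight,
    order 2 for integrability. *)
Lemma bump_hat_decay : exists2 C, 0 <= C & forall t, (1 + t ^+ 2) * `|bump_hat t| <= C * cauchy t.
Proof.
have [C0 C00 h0] := flat_pair_fourier_decay 0 1 1.
have [C4 C40 h4] := flat_pair_fourier_decay 4 1 1.
exists (2 * (C0 + C4)); first by rewrite mulr_ge0// addr_ge0.
move=> t; rewrite /cauchy ler_pdivlMr ?cauchy_pos//.
have [a0 _] := h0 t; have [a4 _] := h4 t.
rewrite expr0 mul1r -/(bump_hat t) in a0; rewrite -/(bump_hat t) in a4.
have t4 : `|t| ^+ 4 = t ^+ 4 by rewrite -normrX ger0_norm// (exprM t 2 2) sqr_ge0.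
rewrite t4 in a4; set b := `|_| in a0 a4 *.
have b0 : 0 <= b by rewrite /b.
have : 0 <= (1 - t ^+ 2) ^+ 2 * b by rewrite mulr_ge0// sqr_ge0.
have E4 : t ^+ 4 = t ^+ 2 * t ^+ 2 by ring.
rewrite E4 in a4.
by move: (t ^+ 2) a4 => s a4; nra.
Qed.

Let measurable_cos_prod (w : R) : measurable_fun setT
  (fun z : measurableTypeR R * measurableTypeR R => cos ((z.2 - w) * z.1)).
Proof.
have mc : measurable_fun setT (@cos R).
  by apply: continuous_measurable_fun; exact: continuous_cos.
apply: (measurableT_comp mc); apply: measurable_funM; last exact: measurable_fst.
by apply: measurable_funB; [exact: measurable_snd|exact: measurable_cst].
Qed.

(** Multiplication by the Cauchy density makes the double integral converge, and
    Fubini then gives measurability in the parameter. *)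
Lemma measurable_bump_hat : measurable_fun setT bump_hat.
Proof.
have mb : measurable_fun setT (bump e) by exact: continuous_measurable_fun continuous_bump.
have mca : measurable_fun setT (@cauchy R) by exact: continuous_measurable_fun continuous_cauchy.
pose f (z : measurableTypeR R * measurableTypeR R) := cauchy z.1 * (bump e z.2 * cos ((z.2 - 0) * z.1)).
have mf : measurable_fun setT f.
  apply: measurable_funM; first by apply: (measurableT_comp mca); exact: measurable_fst.
  apply: measurable_funM; first by apply: (measurableT_comp mb); exact: measurable_snd.
  exact: measurable_cos_prod.
have fb t u : `|f (t, u)| <= cauchy t * bump e u.
  rewrite /f/= 2!normrM (ger0_norm (bump_ge0 e u)) ger0_norm; last first.
    by rewrite invr_ge0 ltW// cauchy_pos.
  rewrite ler_wpM2l ?invr_ge0 ?(ltW (cauchy_pos _))// ler_piMr ?bump_ge0// cos_max//.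
have := partial_integrable mf (@cauchy_integral R).1 bump_integrable1 fb.
move=> /integrableP[+ _] => /measurable_EFinP m1.
have m2 : measurable_fun setT (fun t : R => 1 + t ^+ 2).
  by apply: measurable_funD => //; exact: measurable_funX.
have := measurable_funM m2 m1; congr measurable_fun.
apply/funext => t /=; rewrite /f/= RintegralZl//; last first.
  apply: bump_integrable => u; apply: (@continuous_comp R R R (fun u : R => (u - 0) * t) cos); last exact: continuous_cos.
  by apply: cvgM; [apply: cvgB; [exact: cvg_id|exact: cvg_cst]|exact: cvg_cst].
rewrite mulrA mulfV ?gt_eqF ?cauchy_pos// mul1r.
by apply: eq_Rintegral => u _; rewrite subr0.
Qed.

Lemma bump_hat_weight_integrable :
  leb1.-integrable setT (EFin \o (fun t => (1 + t ^+ 2) * `|bump_hat t|)).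
Proof.
have [C C0 hC] := bump_hat_decay.
apply: (@integrable_bounded_by _ _ _ leb1 _ (fun t : R => C * cauchy t)).
- apply: measurable_funM; first by apply: measurable_funD => //; exact: measurable_funX.
  by apply: measurableT_comp => //; exact: measurable_bump_hat.
- exact: integrable_mull (@cauchy_integral R).1.
- by move=> t; rewrite ger0_norm// mulr_ge0// ltW// cauchy_pos.
Qed.

Lemma bump_hat_integrable (g : R -> R) : measurable_fun setT g -> (forall t, `|g t| <= 1) ->
  leb1.-integrable setT (EFin \o (fun t => bump_hat t * g t)).
Proof.
move=> mg g1; apply: (@integrable_bounded_by _ _ _ leb1 _ _ _ bump_hat_weight_integrable).
  by apply: measurable_funM => //; exact: measurable_bump_hat.
move=> t; rewrite normrM mulrC ler_pM// (le_trans (g1 t))// lerDl sqr_ge0//.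
Qed.

Lemma bump_hatN t : bump_hat (- t) = bump_hat t.
Proof. by apply: eq_Rintegral => u _; rewrite mulrN cosN. Qed.

Lemma bump_hat_inversion_sin w : \int[leb1]_t (bump_hat t * sin (t * w)) = 0.
Proof.
apply: Rintegral_odd.
  apply: bump_hat_integrable; last by move=> t; exact: sin_max.
  by apply: continuous_measurable_fun; exact: continuous_sin_mul.
by move=> t; rewrite bump_hatN mulNr sinN mulrN.
Qed.

Let poisson (del z : R) : R := 2 * del / (del ^+ 2 + z ^+ 2).

Let continuous_poisson del : 0 < del -> continuous (poisson del).
Proof.
move=> d0 z; rewrite /continuous_at /poisson; apply: cvgM; first exact: cvg_cst.
apply: cvgV; first by rewrite gt_eqF// ltr_pwDl ?exprn_gt0// sqr_ge0.
by apply: cvgD; [exact: cvg_cst|exact: exprn_continuous].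
Qed.

(** The damping [exp (- del |t|)] allows exchanging the integrals, and turns the
    inverse transform into a Poisson average of the bump. *)
Let abel_mean del w : 0 < del ->
  \int[leb1]_t (expR (- (del * `|t|)) * (bump_hat t * cos (t * w))) =
  \int[leb1]_v (bump e (del * v + w) * (2 * cauchy v)).
Proof.
move=> d0; have iE := (abel_integral 0 d0).1.
have mb : measurable_fun setT (bump e) by exact: continuous_measurable_fun continuous_bump.
pose f (z : measurableTypeR R * measurableTypeR R) :=
  expR (- (del * `|z.1|)) * (bump e z.2 * cos ((z.2 - w) * z.1)).
have mf : measurable_fun setT f.
  have /integrableP[/measurable_EFinP mE _] := iE.
  apply: measurable_funM; first by apply: (measurableT_comp mE); exact: measurable_fst.
  apply: measurable_funM; first by apply: (measurableT_comp mb); exact: measurable_snd.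
  exact: measurable_cos_prod.
have fb t u : `|f (t, u)| <= expR (- (del * `|t|)) * bump e u.
  rewrite /f/= 2!normrM (ger0_norm (bump_ge0 e u)) ger0_norm ?expR_ge0//.
  by rewrite ler_wpM2l ?expR_ge0// ler_piMr ?bump_ge0// cos_max.
have cc (t : R) : continuous (fun u : R => cos ((u - w) * t)).
  move=> u; apply: (@continuous_comp R R R (fun u : R => (u - w) * t) cos); last exact: continuous_cos.
  by apply: cvgM; [apply: cvgB; [exact: cvg_id|exact: cvg_cst]|exact: cvg_cst].
transitivity (\int[leb1]_t \int[leb1]_u f (t, u)).
  apply: eq_Rintegral => t _; rewrite /f/= RintegralZl//; last exact: bump_integrable.
  congr (_ * _).
  rewrite -(bump_trig t _ (sin (t * w))); apply: eq_Rintegral => u _; congr (_ * _).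
  by rewrite mulrBl cosB (mulrC w); ring.
rewrite (Rintegral_swap mf iE bump_integrable1 fb).
pose G z := bump e (z + w) * poisson del z.
have cG : continuous G.
  move=> z; apply: cvgM; last exact: continuous_poisson.
  apply: (@continuous_comp R R R (fun z : R => z + w) (bump e)); last exact: continuous_bump.
  by apply: cvgD; [exact: cvg_id|exact: cvg_cst].
have iG : leb1.-integrable setT (EFin \o G).
  apply: (@continuous_compact_support_integrable _ _ (e + `|w|)) => // z hz.
  rewrite /G bump_out ?mul0r//.
  have : `|z| <= `|z + w| + `|w| by rewrite -{1}(addrK w z) ler_normB.
  by move: hz; lra.
have G0 z : 0 <= G z.
  rewrite mulr_ge0 ?bump_ge0// /poisson divr_ge0 ?mulr_ge0 ?(ltW d0)//.
  by rewrite addr_ge0 ?sqr_ge0.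
transitivity (\int[leb1]_u G (u - w)).
  apply: eq_Rintegral => u _; rewrite /G subrK /poisson -(abel_integral (u - w) d0).2.
  rewrite -RintegralZl//; last first.
    apply: (@integrable_bounded_by _ _ _ leb1 _ _ _ iE) => [|t].
      apply: measurable_funM; first exact: integrable_measurable iE.
      by apply: continuous_measurable_fun; exact: continuous_cos_mul.
    by rewrite normrM ger0_norm ?expR_ge0// ler_piMr ?expR_ge0// cos_max.
  by apply: eq_Rintegral => t _; rewrite /f/= (mulrC (u - w)); ring.
have [_ ->] := shift_integral (- w) iG.
rewrite (Rintegral_scale d0 cG G0); apply: eq_Rintegral => v _.
rewrite /G /poisson /cauchy -mulrA; congr (_ * _).
have h := cauchy_pos v.
by field; rewrite !gt_eqF//= (_ : del ^+ 2 + (del * v) ^+ 2 = del ^+ 2 * (1 + v ^+ 2)) ?mulr_gt0 ?exprn_gt0//; ring.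
Qed.

(** When the damping tends to [0], the Poisson averages, of total mass [2 pi],
    concentrate at [w]. *)
Theorem bump_hat_inversion_cos w :
  \int[leb1]_t (bump_hat t * cos (t * w)) = 2 * pi * bump e w.
Proof.
pose dl n : R := n.+1%:R^-1.
have dl0 n : 0 < dl n by rewrite invr_gt0.
have dlc : dl n @[n --> \oo] --> (0 : R) by exact: cvg_harmonic.
have mc : measurable_fun setT (fun t : R => cos (t * w)).
  by apply: continuous_measurable_fun; exact: continuous_cos_mul.
have ib := bump_hat_integrable mc (fun t => cos_max (t * w)).
have c1 : \int[leb1]_t (expR (- (dl n * `|t|)) * (bump_hat t * cos (t * w))) @[n --> \oo] -->
    \int[leb1]_t (bump_hat t * cos (t * w)).
  apply: (@Rintegral_cvg _ _ _ leb1 _ _ (fun t : R => `|bump_hat t * cos (t * w)|)).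
  - move=> n; apply: measurable_funM.
      exact: integrable_measurable ((abel_integral 0 (dl0 n)).1).
    exact: integrable_measurable ib.
  - exact: integrable_norm ib.
  - move=> n t; rewrite normrM ger0_norm ?expR_ge0// ler_piMl// expR_le1 oppr_le0.
    by rewrite mulr_ge0// ltW.
  - move=> t; rewrite -[X in _ --> X]mul1r; apply: cvgMr_tmp.
    rewrite (_ : 1 = expR (- (0 * `|t|))); last by rewrite mul0r oppr0 expR0.
    have h : - (dl n * `|t|) @[n --> \oo] --> - (0 * `|t|) by apply: cvgN; exact: cvgMr_tmp.
    by refine (continuous_cvg _ (h := expR) _ h); exact: continuous_expR.
have c2 : \int[leb1]_v (bump e (dl n * v + w) * (2 * cauchy v)) @[n --> \oo] -->
    \int[leb1]_v (bump e w * (2 * cauchy v)).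
  have [ic _] := @cauchy_integral R.
  apply: (@Rintegral_cvg _ _ _ leb1 _ _ (fun v : R => 2 * cauchy v)).
  - move=> n; apply: continuous_measurable_fun => v; apply: cvgM.
      apply: (@continuous_comp R R R (fun v : R => dl n * v + w) (bump e)); last exact: continuous_bump.
      by apply: cvgD; [apply: cvgM; [exact: cvg_cst|exact: cvg_id]|exact: cvg_cst].
    by apply: cvgM; [exact: cvg_cst|exact: continuous_cauchy].
  - exact: integrable_mull.
  - have c0 (v : R) : 0 <= 2 * cauchy v by rewrite mulr_ge0// invr_ge0 ltW// cauchy_pos.
    by move=> n v; rewrite normrM ger0_norm ?bump_ge0// (ger0_norm (c0 v)) ler_piMl// bump_le1.
  - move=> v; apply: cvgMr_tmp.
    have h : dl n * v + w @[n --> \oo] --> 0 * v + w.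
      by apply: cvgD; [exact: cvgMr_tmp|exact: cvg_cst].
    rewrite mul0r add0r in h.
    by refine (continuous_cvg _ (h := bump e) _ h); exact: continuous_bump.
rewrite (_ : (fun n => \int[leb1]_t _) =
  (fun n => \int[leb1]_v (bump e (dl n * v + w) * (2 * cauchy v)))) in c1; last first.
  by apply/funext => n; exact: abel_mean.
have := cvg_unique _ c1 c2; move=> -> //.
have [ic ec] := @cauchy_integral R.
rewrite RintegralZl//; last exact: integrable_mull.
by rewrite RintegralZl// ec; ring.
Qed.

End bump_fourier.

(** * Integrals of tensor products *)

Section tensor_integrals.
Context {R : realType}.
Local Notation leb1 := (@lebesgue_measure R).
Local Notation tup n := (n.-tuple (measurableTypeR R)).

Lemma tnth_tcons0 n (z : measurableTypeR R * tup n) : tnth (tcons z) ord0 = z.1.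
Proof. by rewrite /tcons tnth0. Qed.

Lemma tnth_tconsS n (z : measurableTypeR R * tup n) i :
  tnth (tcons z) (lift ord0 i) = tnth z.2 i.
Proof. by rewrite /tcons tnthS. Qed.

Lemma measurable_leb0 (f : tup 0 -> R) : measurable_fun setT f.
Proof.
move=> _ B mB; rewrite setTI.
have [fB|fB] := pselect (B (f [tuple])).
  rewrite (_ : _ @^-1` _ = setT); first exact: measurableT.
  by apply/seteqP; split => // t _; rewrite /preimage/= (tuple0 t).
rewrite (_ : _ @^-1` _ = set0); first exact: measurable0.
by apply/seteqP; split => // t; rewrite /preimage/= (tuple0 t).
Qed.

Lemma Rintegral_leb0 (f : tup 0 -> R) : \int[@leb R 0]_t f t = f [tuple].
Proof.
rewrite /Rintegral (eq_measure_integral (dirac [tuple] : {measure set (tup 0) -> \bar R}))//.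
rewrite integral_dirac//=; first by rewrite indicT mul1r.
by apply/measurable_EFinP; exact: measurable_leb0.
Qed.

Lemma leb0_integrable (f : tup 0 -> R) : (@leb R 0).-integrable setT (EFin \o f).
Proof.
apply/integrableP; split; first by apply/measurable_EFinP; exact: measurable_leb0.
rewrite (eq_measure_integral (dirac [tuple] : {measure set (tup 0) -> \bar R}))//.
rewrite integral_dirac//=; first by rewrite diracT mul1e ltry.
by apply/measurable_EFinP; exact: measurable_leb0 (fun t => `|f t|).
Qed.

Section lebS.
Variables (n : nat) (f : tup n.+1 -> R).
Hypothesis mf : measurable_fun setT f.
Hypothesis if_ : (leb1 \x @leb R n)%E.-integrable setT (EFin \o (f \o @tcons R n)).

Let m : {measure set (tup n.+1) -> \bar R} :=
  @measure_function_pushforward__canonical__measure_function_Measure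
    _ _ _ _ R (leb1 \x @leb R n)%E _ (@measurable_tcons R n).

Lemma lebS_integrable : (@leb R n.+1).-integrable setT (EFin \o f).
Proof.
apply/integrableP; split; first exact/measurable_EFinP.
rewrite (eq_measure_integral m)//.
have mfa : measurable_fun setT (abse \o (EFin \o f)).
  by apply: measurableT_comp => //; exact/measurable_EFinP.
rewrite (_ : (\int[m]_x _ = \int[m]_x (abse \o (EFin \o f)) x)%E)//.
rewrite (ge0_integral_pushforward (@measurable_tcons R n)) ?preimage_setT//.
  by have /integrableP[_] := if_.
by move=> y _ /=; rewrite lee_fin.
Qed.

Lemma Rintegral_lebS : \int[@leb R n.+1]_t f t =
  \int[(leb1 \x @leb R n)%E]_z f (tcons z).
Proof.
congr fine; rewrite (eq_measure_integral m)//.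
have mfe : measurable_fun setT (EFin \o f) by exact/measurable_EFinP.
by rewrite (integral_pushforward (@measurable_tcons R n)) ?preimage_setT.
Qed.

End lebS.

Lemma measurable_tensor n (F : 'I_n -> R -> R) : (forall i, measurable_fun setT (F i)) ->
  measurable_fun setT (fun t : tup n => \prod_(i < n) F i (tnth t i)).
Proof.
move=> mF; elim: (index_enum _) => [|i s ih].
  by under eq_fun do rewrite big_nil; exact: measurable_cst.
under eq_fun do rewrite big_cons.
apply: measurable_funM => //.
by apply: (measurableT_comp (mF i)); exact: measurable_tnth.
Qed.

Lemma measurable_angle n (w : 'I_n -> R) :
  measurable_fun setT (fun t : tup n => \sum_(i < n) tnth t i * w i).
Proof.
apply: measurable_sum => i; apply: measurable_funM; last exact: measurable_cst.
exact: measurable_tnth.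
Qed.

Lemma tensor_integrable n (F : 'I_n -> R -> R) :
  (forall i, leb1.-integrable setT (EFin \o F i)) ->
  (@leb R n).-integrable setT (EFin \o (fun t => \prod_(i < n) F i (tnth t i))).
Proof.
elim: n F => [|n ih] F iF; first exact: leb0_integrable.
apply: lebS_integrable.
  by apply: measurable_tensor => i; exact: integrable_measurable (iF i).
have := integrable_tensor (iF ord0) (ih _ (fun i => iF (lift ord0 i))).
congr (_.-integrable _ _); apply/funext => z /=.
rewrite big_ord_recl tnth_tcons0; congr (_ * _)%:E.
by apply: eq_bigr => i _; rewrite tnth_tconsS.
Qed.

(** The addition formulas separate one variable at a time and mix the two
    identities, which therefore have to be proved together. *)
Lemma tensor_cos_sin n (F : 'I_n -> R -> R) (w r a : 'I_n -> R) :
  (forall i, leb1.-integrable setT (EFin \o F i)) ->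
  (forall i, \int[leb1]_u (F i u * cos (u * w i)) = r i * cos (a i)) ->
  (forall i, \int[leb1]_u (F i u * sin (u * w i)) = r i * sin (a i)) ->
  \int[@leb R n]_t ((\prod_(i < n) F i (tnth t i)) * cos (\sum_(i < n) tnth t i * w i)) =
    (\prod_(i < n) r i) * cos (\sum_(i < n) a i) /\
  \int[@leb R n]_t ((\prod_(i < n) F i (tnth t i)) * sin (\sum_(i < n) tnth t i * w i)) =
    (\prod_(i < n) r i) * sin (\sum_(i < n) a i).
Proof.
elim: n F w r a => [|n ih] F w r a iF Fc Fs.
  by rewrite !Rintegral_leb0 !big_ord0.
pose P (t : tup n) := \prod_(i < n) F (lift ord0 i) (tnth t i).
pose A (t : tup n) := \sum_(i < n) tnth t i * w (lift ord0 i).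
have iP : (@leb R n).-integrable setT (EFin \o P).
  exact: (tensor_integrable (fun i => iF (lift ord0 i))).
have mP : measurable_fun setT P by exact: integrable_measurable iP.
have mA : measurable_fun setT A by exact: (measurable_angle (fun i => w (lift ord0 i))).
have [ihc ihs] := ih (fun i => F (lift ord0 i)) (fun i => w (lift ord0 i))
  (fun i => r (lift ord0 i)) (fun i => a (lift ord0 i)) (fun i => iF (lift ord0 i))
  (fun i => Fc (lift ord0 i)) (fun i => Fs (lift ord0 i)).
have mF0 : measurable_fun setT (F ord0) by exact: integrable_measurable (iF ord0).
have mcos : measurable_fun setT (@cos R) by apply: continuous_measurable_fun; exact: continuous_cos.
have msin : measurable_fun setT (@sin R) by apply: continuous_measurable_fun; exact: continuous_sin.
have PE (z : measurableTypeR R * tup n) :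
    \prod_(i < n.+1) F i (tnth (tcons z) i) = F ord0 z.1 * P z.2.
  rewrite big_ord_recl tnth_tcons0; congr (_ * _).
  by apply: eq_bigr => i _; rewrite tnth_tconsS.
have AE (z : measurableTypeR R * tup n) :
    \sum_(i < n.+1) tnth (tcons z) i * w i = z.1 * w ord0 + A z.2.
  rewrite big_ord_recl tnth_tcons0; congr (_ + _).
  by apply: eq_bigr => i _; rewrite tnth_tconsS.
have iNF : leb1.-integrable setT (EFin \o (fun x => `|F ord0 x|)) by exact: integrable_norm (iF ord0).
have iNP : (@leb R n).-integrable setT (EFin \o (fun t => `|P t|)) by exact: integrable_norm iP.
have iF0 (g : R -> R) : measurable_fun setT g -> (forall u, `|g u| <= 1) ->
    leb1.-integrable setT (EFin \o (fun u => F ord0 u * g u)).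
  move=> mg g1; apply: (@integrable_bounded_by _ _ _ leb1 _ _ _ iNF).
    by apply: measurable_funM.
  by move=> u; rewrite normrM ler_piMr.
have iPg (g : R -> R) : measurable_fun setT g -> (forall u, `|g u| <= 1) ->
    (@leb R n).-integrable setT (EFin \o (fun t => P t * g (A t))).
  move=> mg g1; apply: (@integrable_bounded_by _ _ _ (@leb R n) _ _ _ iNP).
    by apply: measurable_funM => //; exact: measurableT_comp.
  by move=> u; rewrite normrM ler_piMr.
have mw : measurable_fun setT (fun u : R => u * w ord0).
  by apply: measurable_funM => //; exact: measurable_cst.
have icos := iF0 _ (measurableT_comp mcos mw) (fun u => cos_max _).
have isin := iF0 _ (measurableT_comp msin mw) (fun u => sin_max _).
have step (g : R -> R) : measurable_fun setT g -> (forall u, `|g u| <= 1) ->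
  \int[@leb R n.+1]_t ((\prod_(i < n.+1) F i (tnth t i)) * g (\sum_(i < n.+1) tnth t i * w i)) =
  \int[leb1]_x \int[@leb R n]_t ((F ord0 x * P t) * g (x * w ord0 + A t)).
  move=> mg g1.
  pose f (t : tup n.+1) := (\prod_(i < n.+1) F i (tnth t i)) * g (\sum_(i < n.+1) tnth t i * w i).
  have mf : measurable_fun setT f.
    apply: measurable_funM.
      by apply: measurable_tensor => i; exact: integrable_measurable (iF i).
    by apply: (measurableT_comp mg); exact: measurable_angle.
  have fb x t : `|(f \o @tcons R n) (x, t)| <= `|F ord0 x| * `|P t|.
    by rewrite /f/= PE AE/= 2!normrM ler_piMr// mulr_ge0.
  have mft : measurable_fun setT (f \o @tcons R n).
    by apply: (measurableT_comp mf); exact: measurable_tcons.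
  rewrite (Rintegral_lebS mf); last exact: tensor_bounded_integrable mft iNF iNP fb.
  rewrite (Rintegral_product mft iNF iNP fb).
  by apply: eq_Rintegral => x _; apply: eq_Rintegral => t _; rewrite /f/= PE AE.
have iPc := iPg _ mcos (fun u => cos_max _); have iPs := iPg _ msin (fun u => sin_max _).
pose r0 := \prod_(i < n) r (lift ord0 i); pose a0 := \sum_(i < n) a (lift ord0 i).
have inner x c s :
    \int[@leb R n]_t (F ord0 x * P t * (c * cos (A t) + s * sin (A t))) =
    F ord0 x * (c * (r0 * cos a0) + s * (r0 * sin a0)).
  rewrite -ihc -ihs -!RintegralZl// -RintegralD//; [|exact: integrable_mull..].
  rewrite -RintegralZl//; last by apply: integrable_addr; exact: integrable_mull.
  by apply: eq_Rintegral => t _; rewrite -/(P t) -/(A t); ring.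
have outer c s :
    \int[leb1]_x (F ord0 x * (cos (x * w ord0) * c + sin (x * w ord0) * s)) =
    r ord0 * cos (a ord0) * c + r ord0 * sin (a ord0) * s.
  rewrite -Fc -Fs -!RintegralZr// -RintegralD//; first by apply: eq_Rintegral => x _; ring.
  - by have := integrable_mull c icos; congr (_.-integrable _ _); apply/funext => u /=; rewrite mulrC.
  - by have := integrable_mull s isin; congr (_.-integrable _ _); apply/funext => u /=; rewrite mulrC.
split.
- rewrite step//; last by move=> u; exact: cos_max.
  transitivity (\int[leb1]_x (F ord0 x * (cos (x * w ord0) * (r0 * cos a0) +
      sin (x * w ord0) * - (r0 * sin a0)))).
    apply: eq_Rintegral => x _; rewrite mulrN -mulNr -inner.
    by apply: eq_Rintegral => t _; rewrite cosD; ring.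
  by rewrite outer !big_ord_recl cosD /r0 /a0; ring.
- rewrite step//; last by move=> u; exact: sin_max.
  transitivity (\int[leb1]_x (F ord0 x * (cos (x * w ord0) * (r0 * sin a0) +
      sin (x * w ord0) * (r0 * cos a0)))).
    apply: eq_Rintegral => x _; rewrite addrC -inner.
    by apply: eq_Rintegral => t _; rewrite sinD; ring.
  by rewrite outer !big_ord_recl sinD /r0 /a0; ring.
Qed.

End tensor_integrals.

(** * Pairing with a multiplier applied to a bump *)

Section box_fourier.
Context {R : realType} {d : nat}.
Local Notation leb1 := (@lebesgue_measure R).
Local Notation vec := 'rV[R]_d.
Local Notation tup := (d.-tuple (measurableTypeR R)).
Local Notation pos := (@rV_of_tuple R d).
Variable (e : R).
Hypothesis e0 : 0 < e.
Implicit Types (x y z xi : vec) (t : tup) (m : vec -> R).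

Definition box_hat xi : R := \prod_(i < d) bump_hat e (xi 0 i).

Lemma dotmulC x y : dotmul x y = dotmul y x.
Proof. by apply: eq_bigr => i _; rewrite mulrC. Qed.

Lemma dotmul0r x : dotmul x 0 = 0.
Proof. by rewrite /dotmul big1// => i _; rewrite mxE mulr0. Qed.

Lemma dotmulBr x y z : dotmul x (y - z) = dotmul x y - dotmul x z.
Proof. by rewrite /dotmul -sumrB; apply: eq_bigr => i _; rewrite !mxE mulrBr. Qed.

Lemma dotmul_pos t y : dotmul (pos t) y = \sum_(i < d) tnth t i * y 0 i.
Proof. by apply: eq_bigr => i _; rewrite mxE. Qed.

Lemma box_hat_pos t : box_hat (pos t) = \prod_(i < d) bump_hat e (tnth t i).
Proof. by apply: eq_bigr => i _; rewrite mxE. Qed.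

Lemma box_bump_pos x t : box_bump e x (pos t) = \prod_(i < d) bump e (tnth t i - x 0 i).
Proof. by apply: eq_bigr => i _; rewrite mxE. Qed.

Lemma box_bump_shift x z : box_bump e x z = box_bump e 0 (z - x).
Proof. by apply: eq_bigr => i _; rewrite !mxE subr0. Qed.

Lemma box_bump_integrable x : (@leb R d).-integrable setT (EFin \o (box_bump e x \o pos)).
Proof.
have := @tensor_integrable R d (fun i u => bump e (u - x 0 i))
  (fun i => (shift_integral (- x 0 i) (bump_integrable1 e)).1).
by congr (_.-integrable _ _); apply/funext => t /=; rewrite box_bump_pos.
Qed.

Lemma box_bump_fourier x xi :
  \int[@leb R d]_t (box_bump e x (pos t) * cos (dotmul xi (pos t))) =
    box_hat xi * cos (dotmul xi x) /\
  \int[@leb R d]_t (box_bump e x (pos t) * sin (dotmul xi (pos t))) =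
    box_hat xi * sin (dotmul xi x).
Proof.
have [] := @tensor_cos_sin R d (fun i u => bump e (u - x 0 i)) (fun i => xi 0 i)
  (fun i => bump_hat e (xi 0 i)) (fun i => x 0 i * xi 0 i)
  (fun i => (shift_integral (- x 0 i) (bump_integrable1 e)).1)
  (fun i => bump_hat_cos e _ _) (fun i => bump_hat_sin e _ _).
have -> : \sum_(i < d) x 0 i * xi 0 i = dotmul xi x by rewrite dotmulC.
rewrite -/(box_hat xi) => <- <-; split; apply: eq_Rintegral => t _.
  by rewrite box_bump_pos dotmulC dotmul_pos.
by rewrite box_bump_pos dotmulC dotmul_pos.
Qed.

Definition box_mass : R := box_hat 0.

Lemma box_mass_gt0 : 0 < box_mass.
Proof.
apply: prodr_gt0 => i _; rewrite mxE /bump_hat.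
under eq_Rintegral do rewrite mulr0 cos0 mulr1.
exact: bump_mass_gt0.
Qed.

Lemma box_bump_mass x : \int[@leb R d]_t box_bump e x (pos t) = box_mass.
Proof.
have [h _] := box_bump_fourier x 0.
rewrite dotmulC dotmul0r cos0 mulr1 in h; rewrite /box_mass -h.
by apply: eq_Rintegral => t _; rewrite dotmulC dotmul0r cos0 mulr1.
Qed.

Lemma box_hat_inversion y :
  \int[@leb R d]_t (box_hat (pos t) * cos (dotmul (pos t) y)) =
  (2 * pi) ^+ d * box_bump e 0 y.
Proof.
have i1 : leb1.-integrable setT (EFin \o bump_hat e).
  have h1 : forall u : R, `|(fun _ : R => 1 : R) u| <= 1 by move=> u; rewrite normr1.
  have mc : measurable_fun setT (fun _ : R => 1 : R) by exact: measurable_cst.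
  have := bump_hat_integrable e0 mc h1; congr (_.-integrable _ _).
  by apply/funext => u /=; rewrite mulr1.
have [] := @tensor_cos_sin R d (fun i => bump_hat e) (fun i => y 0 i)
  (fun i => 2 * pi * bump e (y 0 i)) (fun=> 0) (fun=> i1).
- by move=> i; rewrite cos0 mulr1; exact: bump_hat_inversion_cos.
- by move=> i; rewrite sin0 mulr0; exact: bump_hat_inversion_sin.
rewrite sumr_const mul0rn cos0 mulr1 => h _.
rewrite (_ : \int[@leb R d]_t _ = \prod_(i < d) (2 * pi * bump e (y 0 i))); last first.
  by rewrite -h; apply: eq_Rintegral => t _; rewrite box_hat_pos dotmul_pos.
rewrite big_split/= prodr_const card_ord; congr (_ * _).
by apply: eq_bigr => i _; rewrite mxE subr0.
Qed.

(** It dominates [1 + |t|^2] times the transform of the bump, as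
    [1 + sum_i t_i^2 <= prod_i (1 + t_i^2)]. *)
Definition box_weight t : R := \prod_(i < d) ((1 + tnth t i ^+ 2) * `|bump_hat e (tnth t i)|).

Lemma box_weight_integrable : (@leb R d).-integrable setT (EFin \o box_weight).
Proof.
exact: (@tensor_integrable R d (fun _ u => (1 + u ^+ 2) * `|bump_hat e u|)
  (fun=> bump_hat_weight_integrable e0)).
Qed.

Lemma box_weight_le t : (1 + dotmul (pos t) (pos t)) * `|box_hat (pos t)| <= box_weight t.
Proof.
rewrite box_hat_pos normr_prod /box_weight big_split/= ler_wpM2r ?prodr_ge0//.
rewrite dotmul_pos (eq_bigr (fun i => tnth t i ^+ 2)); last by move=> i _; rewrite mxE expr2.
elim: (index_enum _) => [|i s ih]; first by rewrite !big_nil addr0.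
rewrite !big_cons.
have s0 : 0 <= \sum_(j <- s) tnth t j ^+ 2 by apply: sumr_ge0 => j _; exact: sqr_ge0.
apply: (@le_trans _ _ ((1 + tnth t i ^+ 2) * (1 + \sum_(j <- s) tnth t j ^+ 2))).
  have := mulr_ge0 (sqr_ge0 (tnth t i)) s0; lra.
by rewrite ler_wpM2l// addr_ge0// sqr_ge0.
Qed.

Lemma measurable_box_hat : measurable_fun setT (box_hat \o pos).
Proof.
have := @measurable_tensor R d (fun=> bump_hat e) (fun=> measurable_bump_hat e).
by congr measurable_fun; apply/funext => t /=; rewrite box_hat_pos.
Qed.

(** The real part of the inverse Fourier integral of [m] times the transform of
    the bump centred at the origin. *)
Definition multiplier_kernel m y : R :=
  ((2 * pi) ^+ d)^-1 *
  \int[@leb R d]_t (m (pos t) * (box_hat (pos t) * cos (dotmul (pos t) y))).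

Local Open Scope complex_scope.

Lemma fourier_box_bump x xi : fourier (box_bump e x) xi =
  (box_hat xi * cos (dotmul xi x)) +i* (- (box_hat xi * sin (dotmul xi x))).
Proof.
have [hc hs] := box_bump_fourier x xi.
rewrite /fourier /Rd_cintegral /Rd_integral; congr (_ +i* _).
  by rewrite -hc; apply: eq_Rintegral => t _ /=; rewrite cosN; ring.
rewrite -hs -mulN1r -RintegralZl//.
  by apply: eq_Rintegral => t _ /=; rewrite sinN; ring.
apply: (@integrable_bounded_by _ _ _ (@leb R d) _ _ _ (box_bump_integrable x)).
  apply: measurable_funM.
    exact: integrable_measurable (box_bump_integrable x).
  have msin : measurable_fun setT (@sin R) by apply: continuous_measurable_fun; exact: continuous_sin.
  apply: (measurableT_comp msin).
  under eq_fun do rewrite dotmulC.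
  exact: measurable_dotmul.
by move=> t; rewrite normrM ger0_norm ?box_bump_ge0// ler_piMr ?box_bump_ge0// sin_max.
Qed.

Lemma Re_fourier_multiplier_box_bump m x z :
  complex.Re (fourier_multiplier m (box_bump e x) z) = multiplier_kernel m (z - x).
Proof.
rewrite /fourier_multiplier (_ : (fun xi => _) = (fun xi => (m xi)%:C *
  ((box_hat xi * cos (dotmul xi x)) +i* (- (box_hat xi * sin (dotmul xi x)))))); last first.
  by apply/funext => xi; rewrite fourier_box_bump.
rewrite /inverse_fourier /Rd_cintegral /Rd_integral /=.
rewrite mul0r subr0 /multiplier_kernel; congr (_ * _).
by apply: eq_Rintegral => t _; rewrite /= dotmulBr cosB; ring.
Qed.

Lemma Re_real_mul (r : R) (c : R[i]) : complex.Re (r%:C * c) = r * complex.Re c.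
Proof. by case: c => a b /=; rewrite mul0r subr0. Qed.

Lemma A_pairing_box_bump gam bet lam (f g : vec -> R) x :
  is_A_of gam bet lam f g ->
  \int[@leb R d]_t (g (pos t) * box_bump e x (pos t)) =
  \int[@leb R d]_t (f (pos t) * multiplier_kernel (A_symbol gam bet lam) (pos t - x)).
Proof.
move=> [_ /(_ _ (test_box_bump x e0))] /(congr1 (@complex.Re R)) h.
transitivity (Rd_integral (fun z => complex.Re ((f z)%:C *
  fourier_multiplier (A_symbol gam bet lam) (box_bump e x) z))); first exact: h.
apply: eq_Rintegral => t _.
by rewrite Re_real_mul Re_fourier_multiplier_box_bump.
Qed.

End box_fourier.

Section duality.
Context {R : realType} {d : nat}.
Local Notation vec := 'rV[R]_d.
Local Notation tup := (d.-tuple (measurableTypeR R)).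
Local Notation pos := (@rV_of_tuple R d).
Variable (e : R).
Hypothesis e0 : 0 < e.
Implicit Types (x y : vec) (t : tup) (m : vec -> R).

Variable h : tup -> R.
Hypothesis ih : (@leb R d).-integrable setT (EFin \o h).

(** The frequency components of [x |-> int h z * box_bump e x z dz], up to the
    factor [(2 pi)^d]. The decay in frequency is provided by the bump, so [h] may be
    any integrable function. *)
Definition correlation_wave x (xi : tup) : R :=
  box_hat e (pos xi) * \int[@leb R d]_z (h z * cos (dotmul (pos xi) (pos z - x))).

Let mh : measurable_fun setT h.
Proof. exact: integrable_measurable ih. Qed.

Let inh : (@leb R d).-integrable setT (EFin \o (fun z => `|h z|)).
Proof. exact: integrable_norm ih. Qed.

Let mcos : measurable_fun setT (@cos R).
Proof. by apply: continuous_measurable_fun; exact: continuous_cos. Qed.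

Let measurable_phase x :
  measurable_fun setT (fun w : tup * tup => cos (dotmul (pos w.1) (pos w.2 - x))).
Proof.
apply: (measurableT_comp mcos).
apply: measurable_sum => i; apply: measurable_funM.
  under eq_fun do rewrite mxE.
  by apply: (measurableT_comp (measurable_tnth i)); exact: measurable_fst.
under eq_fun do rewrite !mxE.
apply: measurable_funB; last exact: measurable_cst.
by apply: (measurableT_comp (measurable_tnth i)); exact: measurable_snd.
Qed.

Let phase_integrable xi x :
  (@leb R d).-integrable setT (EFin \o (fun z => h z * cos (dotmul (pos xi) (pos z - x)))).
Proof.
apply: (@integrable_bounded_by _ _ _ (@leb R d) _ _ _ inh).
  apply: measurable_funM => //.
  exact: (measurable_fun_pair2 xi (measurable_phase x)).
by move=> z; rewrite normrM ler_piMr// cos_max.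
Qed.

Let joint m x (w : tup * tup) : R :=
  m (pos w.1) * box_hat e (pos w.1) * (h w.2 * cos (dotmul (pos w.1) (pos w.2 - x))).

Let joint_measurable m x : measurable_fun setT (m \o pos) -> measurable_fun setT (joint m x).
Proof.
move=> mm; apply: measurable_funM.
  apply: measurable_funM.
    by apply: (measurableT_comp mm); exact: measurable_fst.
  by apply: (measurableT_comp (measurable_box_hat e)); exact: measurable_fst.
apply: measurable_funM => //.
by apply: (measurableT_comp mh); exact: measurable_snd.
Qed.

Let joint_bound K m x xi z : quadratic_growth K m ->
  `|joint m x (xi, z)| <= K * box_weight e xi * `|h z|.
Proof.
move=> gm; rewrite /joint/= normrM (normrM (h z)) ler_pM//.
  rewrite normrM; apply: (le_trans (ler_wpM2r (normr_ge0 _) (gm _))).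
  by rewrite -mulrA ler_wpM2l ?(quadratic_growth_ge0 gm)// box_weight_le.
by rewrite ler_piMr// cos_max.
Qed.

Let weight_integrable K : (@leb R d).-integrable setT (EFin \o (fun xi => K * box_weight e xi)).
Proof. by apply: integrable_mull; exact: box_weight_integrable. Qed.

Let kernel_summand_le K m x z xi : quadratic_growth K m ->
  `|m (pos xi) * (box_hat e (pos xi) * cos (dotmul (pos xi) (pos z - x)))| <=
    K * box_weight e xi.
Proof.
move=> gm; rewrite mulrA normrM -[leRHS]mulr1 ler_pM//; last exact: cos_max.
rewrite normrM; apply: (le_trans (ler_wpM2r (normr_ge0 _) (gm _))).
by rewrite -mulrA ler_wpM2l ?(quadratic_growth_ge0 gm)// box_weight_le.
Qed.

Let kernel_summand_integrable K m x z : measurable_fun setT (m \o pos) ->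
  quadratic_growth K m ->
  (@leb R d).-integrable setT (EFin \o (fun xi => m (pos xi) *
     (box_hat e (pos xi) * cos (dotmul (pos xi) (pos z - x))))).
Proof.
move=> mm gm; apply: (@integrable_bounded_by _ _ _ (@leb R d) _ _ _ (weight_integrable K)).
  apply: measurable_funM => //; apply: measurable_funM; first exact: measurable_box_hat.
  exact: (measurable_fun_pair1 z (measurable_phase x)).
by move=> xi; exact: kernel_summand_le.
Qed.

Lemma kernel_bounded K m x z : measurable_fun setT (m \o pos) ->
  quadratic_growth K m ->
  `|multiplier_kernel e m (pos z - x)| <=
    ((2 * pi) ^+ d)^-1 * \int[@leb R d]_xi (K * box_weight e xi).
Proof.
move=> mm gm; have i1 := kernel_summand_integrable x z mm gm.
have pi0 : 0 <= ((2 * pi) ^+ d)^-1 :> R by rewrite invr_ge0 exprn_ge0// mulr_ge0// pi_ge0.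
rewrite normrM ger0_norm// ler_wpM2l//.
apply: (le_trans (le_normr_Rintegral measurableT i1)).
apply: le_Rintegral => //; first exact: integrable_norm i1.
by move=> xi _; exact: kernel_summand_le.
Qed.

Let two_pi_d : (2 * pi) ^+ d != 0 :> R.
Proof. by rewrite expf_neq0// mulf_neq0// gt_eqF// pi_gt0. Qed.

Let joint_kernel K m x z : measurable_fun setT (m \o pos) -> quadratic_growth K m ->
  \int[@leb R d]_xi joint m x (xi, z) =
    (2 * pi) ^+ d * (h z * multiplier_kernel e m (pos z - x)).
Proof.
move=> mm gm; have im := kernel_summand_integrable x z mm gm.
rewrite /multiplier_kernel mulrCA mulrA mulrA -(mulrA (h z)) mulfV// mulr1 -RintegralZl//.
by apply: eq_Rintegral => xi _; rewrite /joint/=; ring.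
Qed.

(** The kernel is a frequency integral, so this is Fubini for the double
    integral in frequency and position. *)
Lemma pairing_integrable K m x : measurable_fun setT (m \o pos) ->
  quadratic_growth K m ->
  (@leb R d).-integrable setT (EFin \o (fun z => h z * multiplier_kernel e m (pos z - x))).
Proof.
move=> mm gm; have mj := joint_measurable x mm.
have bj xi z := @joint_bound K m x xi z gm.
have mj' : measurable_fun setT (fun w : tup * tup => joint m x (w.2, w.1)).
  by apply: (measurableT_comp mj); exact: measurable_swap.
have iG := partial_integrable mj' inh (weight_integrable K).
have : (@leb R d).-integrable setT (EFin \o (fun z =>
    ((2 * pi) ^+ d)^-1 * \int[@leb R d]_xi joint m x (xi, z))).
  by apply: integrable_mull; apply: iG => z xi; rewrite mulrC.
congr (_.-integrable _ _); apply/funext => z /=.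
by rewrite (joint_kernel x z mm gm) mulKf.
Qed.

Lemma superpose_filter_correlation K m x : measurable_fun setT (m \o pos) ->
  quadratic_growth K m ->
  superpose (filter m correlation_wave) x =
  (2 * pi) ^+ d * \int[@leb R d]_z (h z * multiplier_kernel e m (pos z - x)).
Proof.
move=> mm gm; rewrite /superpose /filter /correlation_wave.
have mj := joint_measurable x mm.
have bj xi z := @joint_bound K m x xi z gm.
rewrite (_ : \int[@leb R d]_t _ = \int[@leb R d]_xi \int[@leb R d]_z joint m x (xi, z)); last first.
  apply: eq_Rintegral => xi _; rewrite /joint/= RintegralZl.
  - by rewrite mulrA.
  - by [].
  - exact: phase_integrable.
rewrite (Rintegral_swap mj (weight_integrable K) inh bj).
have ip := pairing_integrable x mm gm.
rewrite -RintegralZl//.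
by apply: eq_Rintegral => z _; rewrite (joint_kernel x z mm gm).
Qed.

Lemma wave_correlation : wave correlation_wave.
Proof.
have g1 : quadratic_growth 1 (fun _ : vec => 1).
  by apply: bounded_quadratic_growth => z; rewrite normr1.
have m1 : measurable_fun setT ((fun _ : vec => 1 : R) \o pos) by exact: measurable_cst.
split.
- move=> x; have mj := joint_measurable x m1.
  have bj xi z := @joint_bound 1 (fun=> 1) x xi z g1.
  have /integrableP[/measurable_EFinP + _] := partial_integrable mj (weight_integrable 1) inh bj.
  congr measurable_fun; apply/funext => xi.
  rewrite /joint/= RintegralZl; [|by []|exact: phase_integrable].
  by rewrite mul1r.
- exists (fun xi => (\int[@leb R d]_z `|h z|) * box_weight e xi).
    exact: weight_integrable.
  move=> x xi; rewrite normrM mulrA mulrC ler_pM ?mulr_ge0//.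
  + by rewrite addr_ge0// dotmul_ge0.
  + apply: (le_trans (le_normr_Rintegral measurableT (phase_integrable xi x))).
    apply: le_Rintegral => //; first exact: integrable_norm (phase_integrable xi x).
    by move=> z _; rewrite normrM ler_piMr// cos_max.
  + exact: box_weight_le.
- move=> x y xi; rewrite /correlation_wave mulrCA -mulrDr -mulrA; congr (_ * _).
  have i1 := phase_integrable xi (x + y); have i2 := phase_integrable xi (x - y).
  rewrite -RintegralZl; [|by []|exact: phase_integrable].
  rewrite -(RintegralD measurableT i1 i2).
  rewrite -RintegralZr; [|by []|exact: integrable_addr].
  apply: eq_Rintegral => z _.
  rewrite !dotmulBr dotmulDr.
  set a := dotmul _ (pos z); set b := dotmul _ x; set c := dotmul _ y.
  rewrite (_ : a - (b + c) = (a - b) - c); last ring.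
  rewrite (_ : a - (b - c) = (a - b) + c); last ring.
  by rewrite (cosB (a - b)) (cosD (a - b)); field.
Qed.

Lemma superpose_correlation x : superpose correlation_wave x =
  (2 * pi) ^+ d * \int[@leb R d]_z (h z * box_bump e x (pos z)).
Proof.
have g1 : quadratic_growth 1 (fun _ : vec => 1).
  by apply: bounded_quadratic_growth => z; rewrite normr1.
have m1 : measurable_fun setT ((fun _ : vec => 1 : R) \o pos) by exact: measurable_cst.
rewrite -(filter1 correlation_wave) (superpose_filter_correlation x m1 g1); congr (_ * _).
apply: eq_Rintegral => z _; congr (_ * _).
rewrite /multiplier_kernel box_bump_shift.
under eq_Rintegral do rewrite mul1r.
by rewrite (box_hat_inversion e0) mulKf.
Qed.

(** The bump averages of [h] are the superposition of [correlation_wave], and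
    filtering this wave amounts to replacing the bump by its kernel. *)
Theorem pairing_at_max C m B x0 : almost_accretive C m ->
  (forall x, `|\int[@leb R d]_z (h z * box_bump e x (pos z))| <= B) ->
  (forall x, \int[@leb R d]_z (h z * box_bump e x (pos z)) <=
             \int[@leb R d]_z (h z * box_bump e x0 (pos z))) ->
  - (C * B) <= \int[@leb R d]_z (h z * multiplier_kernel e m (pos z - x0)).
Proof.
move=> [mm [K gm] l] hB hmax.
have pd : 0 < (2 * pi) ^+ d :> R by rewrite exprn_gt0// mulr_gt0// pi_gt0.
have := l _ ((2 * pi) ^+ d * B) x0 wave_correlation.
rewrite (superpose_filter_correlation x0 mm gm) => /(_ _ _).
rewrite mulrCA -mulrN ler_pM2l//; apply.
- by move=> x; rewrite superpose_correlation normrM (gtr0_norm pd) ler_pM2l.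
- by move=> x; rewrite !superpose_correlation ler_pM2l.
Qed.

End duality.

(** * Cubes, continuity and measurability *)

Section coordinate_boxes.
Context {R : realType} {d : nat}.
Local Notation vec := 'rV[R]_d.
Local Notation tup := (d.-tuple (measurableTypeR R)).
Local Notation pos := (@rV_of_tuple R d).
Implicit Types (x y z v w : vec) (t : tup) (f : vec -> R) (r : R).

Lemma nbhs_coord v (A : set vec) :
  nbhs v A <-> exists2 r, 0 < r & forall w, (forall i, `|w 0 i - v 0 i| < r) -> A w.
Proof.
split=> [/nbhs_ballP[r /= r0 rA]|[r r0 rA]].
  exists r => // w wr; apply: rA; split => // i j.
  by rewrite ord1 -ball_normE /= distrC.
apply/nbhs_ballP; exists r => //= w [_ wr]; apply: rA => i.
by have := wr 0 i; rewrite -ball_normE /= distrC.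
Qed.

Lemma continuous_coord f v : {for v, continuous f} -> forall e : R, 0 < e ->
  exists2 r, 0 < r & forall w, (forall i, `|w 0 i - v 0 i| < r) -> `|f w - f v| < e.
Proof.
move=> cf e e0.
have /nbhs_coord[r r0 rf] := cf _ (nbhsx_ballx (f v) e e0).
by exists r => // w /rf; rewrite /= -ball_normE /= distrC.
Qed.

Lemma continuous_of_coord f v : (forall e : R, 0 < e -> exists2 r, 0 < r &
    forall w, (forall i, `|w 0 i - v 0 i| < r) -> `|f w - f v| < e) ->
  {for v, continuous f}.
Proof.
move=> h A /nbhs_ballP[e /= e0 eA]; apply/nbhs_coord.
have [r r0 rf] := h e e0; exists r => // w /rf wr.
by apply: eA; rewrite -ball_normE /= distrC.
Qed.

Let grid (n : nat) (k : 'I_d -> int) : vec := \row_i ((k i)%:~R / n.+1%:R).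

(** A continuous function is the limit of its values at the nearest lower points
    of finer and finer grids, and these take countably many values. *)
Lemma measurable_continuous f : continuous f -> measurable_fun setT (f \o pos).
Proof.
move=> cf.
pose fl n t : d.-tuple int := [tuple Num.floor (n.+1%:R * tnth t i : R) | i < d].
pose fn n t := f (grid n (tnth (fl n t))).
have mfn n : measurable_fun setT (fn n).
  move=> _ B mB; rewrite setTI.
  have -> : fn n @^-1` B = \bigcup_(k : d.-tuple int)
      (if `[< B (f (grid n (tnth k))) >] then [set t | fl n t = k] else set0).
    apply/seteqP; split => t.
      by move=> Bt; exists (fl n t) => //; rewrite ifT//; exact/asboolP.
    by move=> [k _]; case: asboolP => // Bk /= E; rewrite /preimage/= /fn E.
  apply: countable_bigcupT_measurable; first exact: countableP.
  move=> k; case: ifP => _; last exact: measurable0.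
  have -> : [set t | fl n t = k] = \bigcap_(i in [set: 'I_d])
     ((fun t => tnth t i) @^-1` [set u : R | (tnth k i)%:~R <= n.+1%:R * u < (tnth k i + 1)%:~R]).
    apply/seteqP; split => t /=.
      by move=> <- i _ /=; rewrite /preimage/= tnth_mktuple floor_itv.
    move=> h; apply/eq_from_tnth => i; rewrite tnth_mktuple.
    by apply: floor_def; exact: h.
  apply: fin_bigcap_measurable => // i _.
  rewrite -[X in measurable X]setTI; apply: (measurable_tnth i) => //.
  have -> : [set u : R | (tnth k i)%:~R <= n.+1%:R * u < (tnth k i + 1)%:~R] =
      [set` `[(tnth k i)%:~R / n.+1%:R, (tnth k i + 1)%:~R / n.+1%:R[%R].
    apply/seteqP; split => u /=; rewrite in_itv/=.
      by rewrite ler_pdivrMr// ltr_pdivlMr// mulrC.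
    by rewrite ler_pdivrMr// ltr_pdivlMr// mulrC.
  exact: measurable_itv.
apply: (measurable_fun_cvg mfn) => t _.
apply/cvgrPdist_lt => e e0.
have [r r0 rf] := continuous_coord (cf (pos t)) e0.
near=> n; rewrite distrC; apply: rf => i; rewrite !mxE tnth_mktuple.
have /andP[h1 h2] := floor_itv (n.+1%:R * tnth t i : R).
have n0 : 0 < n.+1%:R :> R by [].
have nr : n.+1%:R^-1 <= r / 2 by near: n; apply: near_natSinv_le; rewrite divr_gt0.
rewrite distrC ger0_norm; last by rewrite subr_ge0 ler_pdivrMr// (mulrC (tnth t i)); exact: h1.
apply: (@le_lt_trans _ _ n.+1%:R^-1); last by move: nr; set a := _^-1 => nr; lra.
rewrite lerBlDr -(ler_pM2l n0).
move: h2; rewrite intrD; set a := _%:~R => h2.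
rewrite mulrDr divff ?gt_eqF// mulrCA divff ?gt_eqF// mulr1 addrC.
exact: ltW.
Unshelve. all: by end_near. Qed.

Definition coord_box x r : set tup := [set t | forall i, `[x 0 i - r, x 0 i + r]%classic (tnth t i)].

Lemma coord_boxP x r t : coord_box x r t <-> forall i, `|pos t 0 i - x 0 i| <= r.
Proof.
split=> h i; have := h i; rewrite /= in_itv/= mxE ler_norml.
  by move=> /andP[? ?]; apply/andP; split; lra.
by move=> /andP[? ?]; apply/andP; split; lra.
Qed.

Lemma measurable_coord_box x r : measurable (coord_box x r).
Proof.
rewrite (_ : coord_box x r = \bigcap_(i in [set: 'I_d])
  ((fun t => tnth t i) @^-1` `[x 0 i - r, x 0 i + r])); last first.
  by apply/seteqP; split => t /= h i //=; [move=> _|]; exact: h.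
apply: fin_bigcap_measurable => // i _.
by rewrite -[X in measurable X]setTI; exact: measurable_tnth.
Qed.

Lemma leb_coord_box x r : 0 <= r -> @leb R d (coord_box x r) = ((2 * r) ^+ d)%:E.
Proof.
move=> r0.
rewrite (@leb_prod R d (fun i => `[x 0 i - r, x 0 i + r]%classic))//.
rewrite (eq_bigr (fun=> (2 * r)%:E)); last first.
  move=> i _; rewrite lebesgue_measure_itv/= lte_fin; case: ifPn => h.
    by rewrite -EFinB; congr EFin; ring.
  by congr EFin; move: h; rewrite -leNgt; lra.
by rewrite -(big_morph EFin EFinM (erefl _)) prodr_const card_ord.
Qed.

Lemma indic_coord_box_integrable x r : 0 <= r ->
  (@leb R d).-integrable setT (EFin \o \1_(coord_box x r)).
Proof.
move=> r0; apply/integrableP; split.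
  by apply/measurable_EFinP; exact: measurable_indic (measurable_coord_box x r).
rewrite (_ : (\int[_]_x _ = \int[@leb R d]_t (\1_(coord_box x r) t)%:E)%E); last first.
  by apply: eq_integral => t _ /=; rewrite ger0_norm.
rewrite integral_indic//; last exact: measurable_coord_box.
by rewrite setIT [X in (X < _)%E](leb_coord_box x r0) ltry.
Qed.

Lemma Rintegral_indic_coord_box x r : 0 <= r ->
  \int[@leb R d]_t (\1_(coord_box x r) t) = (2 * r) ^+ d.
Proof.
move=> r0; rewrite /Rintegral integral_indic//; last exact: measurable_coord_box.
by rewrite setIT [X in fine X](leb_coord_box x r0).
Qed.

Lemma box_bump_supp e x t : 0 < box_bump e x (pos t) -> forall i, `|pos t 0 i - x 0 i| < e.
Proof.
by move=> h i; rewrite ltNge; apply/negP => /box_bump_out E; move: h; rewrite E ltxx.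
Qed.

Lemma box_bump_off e x t : ~ coord_box x e t -> box_bump e x (pos t) = 0.
Proof.
move=> h; apply/eqP; rewrite eq_le box_bump_ge0 andbT leNgt; apply/negP => /box_bump_supp s.
by apply: h; apply/coord_boxP => i; exact/ltW.
Qed.

Lemma bump_lipschitz e : 0 < e -> exists2 L, 0 <= L &
  forall u w : R, `|bump e u - bump e w| <= L * `|u - w|.
Proof.
move=> e0; pose D u := flat_pair e (dflat 1) 1 u - flat_pair e 1 (dflat 1) u.
have cD : continuous (fun u => `|D u|).
  move=> u; apply: (@continuous_comp R R R D (fun x : R => `|x|)); last exact: norm_continuous.
  by apply: cvgB; exact: continuous_flat_pair.
have ee : - e <= e by lra.
have [c _ cmax] := EVT_max ee (continuous_subspaceT cD).
exists `|D c| => // u w.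
have Db (v : R) : `|D v| <= `|D c|.
  have [ve|ve] := leP `|v| e.
    by apply: cmax; rewrite ?in_itv/= -?ler_norml//; lra.
  by rewrite /D !(flat_pair_out _ _ (ltW ve)) subrr normr0.
have dB (v : R) : is_derive v (1 : R) (bump e) (D v) by exact: is_derive_flat_pair.
wlog uw : u w / w <= u.
  move=> hw; have [|/ltW] := leP w u; first exact: hw.
  by rewrite distrC (distrC u); exact: hw.
have [|v _ ->] := @MVT_segment R (bump e) D w u uw (fun (s : R) _ => dB s).
  by apply: continuous_subspaceT; exact: continuous_bump.
by rewrite normrM ler_wpM2r.
Qed.

Lemma box_bump_lipschitz e : 0 < e -> exists2 L, 0 <= L &
  forall x y z r, (forall i, `|x 0 i - y 0 i| <= r) ->
    `|box_bump e x z - box_bump e y z| <= L * r.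
Proof.
move=> e0; have [L L0 hL] := bump_lipschitz e0.
exists (d%:R * L) => [|x y z r xy]; first by rewrite mulr_ge0.
have b1 u : 0 <= bump e u <= 1 by rewrite bump_ge0 bump_le1.
have prod1 s (w : vec) : 0 <= \prod_(i <- s) bump e (z 0 i - w 0 i) <= 1.
  rewrite prodr_ge0//=; last by move=> i _; exact: bump_ge0.
  by apply: prodr_ile1 => i _.
have h s : `|\prod_(i <- s) bump e (z 0 i - x 0 i) - \prod_(i <- s) bump e (z 0 i - y 0 i)| <=
    \sum_(i <- s) (L * r).
  elim: s => [|i s ih]; first by rewrite !big_nil subrr normr0.
  rewrite !big_cons; have := prod1 s x; have := b1 (z 0 i - y 0 i).
  set a := bump e (z 0 i - x 0 i); set b := bump e (z 0 i - y 0 i).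
  set p := \prod_(j <- s) _; set q := \prod_(j <- s) _ => b01 p01.
  have ab : `|a - b| <= L * r.
    apply: (le_trans (hL _ _)); rewrite ler_wpM2l//.
    rewrite (_ : _ - _ - _ = - (x 0 i - y 0 i)); last ring.
    by rewrite normrN.
  rewrite (_ : a * p - b * q = (a - b) * p + b * (p - q)); last ring.
  apply: (le_trans (ler_normD _ _)); rewrite (normrM (a - b)) (normrM b); apply: lerD.
    apply: le_trans ab; rewrite ler_piMr// ger0_norm//; by case/andP: p01.
  by apply: le_trans ih; rewrite ler_piMl// ger0_norm//; case/andP: b01.
apply: (le_trans (h _)).
by rewrite sumr_const card_ord -mulrA mulr_natl.
Qed.

End coordinate_boxes.

(** * Integrability of the kernel *)

Section exhaustion.
Context d (T : measurableType d) (R : realType) (mu : {measure set T -> \bar R}).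

Lemma integrable_exhaustion (f : T -> R) (D : nat -> set T) (K : R) :
  measurable_fun setT f -> (forall t, 0 <= f t) ->
  (forall n, measurable (D n)) -> nondecreasing_seq D -> \bigcup_n D n = setT ->
  (forall n, mu.-integrable setT (EFin \o (fun t => \1_(D n) t * f t))) ->
  (forall n, \int[mu]_t (\1_(D n) t * f t) <= K) ->
  mu.-integrable setT (EFin \o f) /\ \int[mu]_t f t <= K.
Proof.
move=> mf f0 mD ndD DT iD leK.
have mEf : measurable_fun setT (EFin \o f) by exact/measurable_EFinP.
have h : (\int[mu]_t (f t)%:E <= K%:E)%E.
  have := @ge0_nondecreasing_set_cvg_integral _ _ _ D (EFin \o f) mu ndD mD
    (fun i => measurable_funTS mEf) (fun i t _ => f0 t).
  rewrite DT => /cvg_lim <-//; apply: lime_le.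
    apply: ereal_nondecreasing_is_cvgn.
    apply: ge0_nondecreasing_set_nondecreasing_integral => //.
      by move=> i; exact: measurable_funTS mEf.
    by move=> i t _; exact: f0.
  apply: nearW => n; rewrite integral_mkcond.
  rewrite (_ : _ \_ _ = EFin \o (fun t => \1_(D n) t * f t)); last first.
    apply/funext => t; rewrite patchE /= indicE; case: ifP => _.
      by rewrite mul1r.
    by rewrite mul0r.
  have := leK n; rewrite /Rintegral -lee_fin fineK//.
  exact: integrable_fin_num (iD n).
have iT : mu.-integrable setT (EFin \o f).
  apply/integrableP; split=> //.
  apply: le_lt_trans (ltry K); apply: le_trans h.
  rewrite le_eqVlt; apply/orP; left; apply/eqP; apply: eq_integral => t _ /=.
  by rewrite ger0_norm.
split=> //; rewrite /Rintegral -lee_fin fineK//.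
exact: integrable_fin_num iT.
Qed.

End exhaustion.

Section kernel_integrability.
Context {R : realType} {d : nat}.
Local Notation vec := 'rV[R]_d.
Local Notation tup := (d.-tuple (measurableTypeR R)).
Local Notation pos := (@rV_of_tuple R d).
Variable (e : R).
Hypothesis e0 : 0 < e.
Variables (C : R) (m : vec -> R).
Hypothesis am : almost_accretive C m.
Implicit Types (x y : vec) (t z : tup).

Let D x n := coord_box x (e + n%:R).

Let er n : 0 <= e + n%:R.
Proof. by rewrite addr_ge0// ltW. Qed.

Let mD x n : measurable (D x n).
Proof. exact: measurable_coord_box. Qed.

Let ndD x : nondecreasing_seq (D x).
Proof.
move=> n k nk; apply/subsetPset => t /coord_boxP h; apply/coord_boxP => i.
by apply: le_trans (h i) _; rewrite lerD2l ler_nat.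
Qed.

Let DT x : \bigcup_n D x n = setT.
Proof.
apply/seteqP; split=> // t _.
pose n := (\max_(i < d) Num.truncn (`|pos t 0 i - x 0 i|)%R).+1.
exists n => //; apply/coord_boxP => i.
apply: (@le_trans _ _ n%:R); last by rewrite lerDr ltW.
apply/ltW/(lt_le_trans (truncnS_gt _)).
by rewrite ler_nat ltnS; exact: (leq_bigmax i).
Qed.

Let D0 x n t : coord_box x e t -> D x n t.
Proof.
by move=> /coord_boxP h; apply/coord_boxP => i; rewrite (le_trans (h i))// lerDl.
Qed.

Let iD x n := @indic_coord_box_integrable R d x _ (er n).

Lemma measurable_multiplier_kernel x :
  measurable_fun setT (fun z => multiplier_kernel e m (pos z - x)).
Proof.
have [mm [K gm] _] := am.
apply: (@measurable_fun_cvg _ _ R setT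
   (fun n z => \1_(D x n) z * multiplier_kernel e m (pos z - x))).
  move=> n; have := pairing_integrable e0 (iD x n) x mm gm.
  by move=> /integrableP[/measurable_EFinP].
move=> z _; have [n _ nz] : (\bigcup_n D x n) z by rewrite DT.
apply: cvg_near_cst; near=> k; rewrite indicE mem_set ?mul1r//.
have nk : (n <= k)%N by near: k; exact: nbhs_infty_ge.
by have /subsetPset := ndD x nk; apply.
Unshelve. all: by end_near. Qed.

(** The bound at a maximum is tested on [h] equal to [1] on the support of the bump
    at [x] and to minus the sign of the kernel on the rest of a large cube. The bump
    average of [h] is largest at [x], where it is the full mass; so [int h * kernel]
    is bounded below, which bounds the integral of the absolute value of the kernel
    over the large cube independently of its size. *)
Lemma multiplier_kernel_integrable : exists K, forall x,
  (@leb R d).-integrable setT (EFin \o (fun z => multiplier_kernel e m (pos z - x))) /\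
  \int[@leb R d]_z `|multiplier_kernel e m (pos z - x)| <= K.
Proof.
have [mm [K gm] _] := am.
pose S := ((2 * pi) ^+ d)^-1 * \int[@leb R d]_xi (K * box_weight e xi).
exists (C * @box_mass R d e + 2 * (S * (2 * e) ^+ d)) => x.
pose A z := multiplier_kernel e m (pos z - x).
have mA : measurable_fun setT A by exact: measurable_multiplier_kernel.
have mB : measurable (coord_box x e) by exact: measurable_coord_box.
have iB := @indic_coord_box_integrable R d x _ (ltW e0).
have AS z : `|A z| <= S.
  by have := kernel_bounded e0 x z mm gm.
(* a sign of A, with values in {-1, 1} also where A vanishes *)
pose s z : R := 2 * \1_(A @^-1` [set u | 0 <= u]) z - 1.
have sA z : s z * A z = `|A z|.
  rewrite /s indicE; have [Az|Az] := leP 0 (A z).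
    by rewrite mem_set// ger0_norm// -[true%:R]/(1 : R); ring.
  rewrite memNset; last by rewrite /preimage /= leNgt Az.
  by rewrite ltr0_norm// -[false%:R]/(0 : R); ring.
have s1 z : `|s z| <= 1.
  by rewrite /s indicE; case: (_ \in _); rewrite -?[true%:R]/(1 : R) -?[false%:R]/(0 : R) ler_norml; apply/andP; split; lra.
have ms : measurable_fun setT s.
  apply: measurable_funB => //; apply: measurable_funM => //; apply: measurable_indic.
  rewrite -[X in measurable X]setTI; apply: mA => //.
  rewrite (_ : [set u : R | 0 <= u] = `[0, +oo[%classic); first exact: measurable_itv.
  by apply/seteqP; split => u /=; rewrite in_itv/= andbT.
pose h n z := \1_(coord_box x e) z - (\1_(D x n) z - \1_(coord_box x e) z) * s z.
have hD n z : `|h n z| <= \1_(D x n) z.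
  rewrite /h !indicE; have [zB|zB] := boolP (z \in coord_box x e).
    rewrite mem_set; last by apply: D0; rewrite inE in zB.
    by rewrite subrr mul0r subr0 normr1.
  by rewrite subr0 sub0r normrN normrM ger0_norm ?ler0n// ler_piMr.
have ih n : (@leb R d).-integrable setT (EFin \o h n).
  apply: (@integrable_bounded_by _ _ _ (@leb R d) _ _ _ (iD x n)); last exact: hD.
  have m1 : measurable_fun setT (\1_(coord_box x e) : tup -> R) by exact: measurable_indic.
  apply: measurable_funB => //; apply: measurable_funM => //.
  by apply: measurable_funB => //; exact: measurable_indic.
have iDA n : (@leb R d).-integrable setT (EFin \o (fun z => \1_(D x n) z * `|A z|)).
  have := integrable_norm (pairing_integrable e0 (iD x n) x mm gm).
  congr (_.-integrable _ _); apply/funext => z /=.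
  by rewrite normrM ger0_norm// indicE ler0n.
have leK n : \int[@leb R d]_z (\1_(D x n) z * `|A z|) <= C * @box_mass R d e + 2 * (S * (2 * e) ^+ d).
  have ip := pairing_integrable e0 (ih n) x mm gm.
  have hx : \int[@leb R d]_z (h n z * box_bump e x (pos z)) = @box_mass R d e.
    rewrite -(box_bump_mass e x); apply: eq_Rintegral => z _.
    have [zB|zB] := pselect (coord_box x e z); last by rewrite box_bump_off// mulr0.
    by rewrite /h !indicE !mem_set ?subrr ?mul0r ?subr0 ?mul1r//; exact: D0.
  have hy y : `|\int[@leb R d]_z (h n z * box_bump e y (pos z))| <= @box_mass R d e.
    have iy := box_bump_integrable e y.
    have hle z : `|h n z * box_bump e y (pos z)| <= box_bump e y (pos z).
      rewrite normrM (ger0_norm (box_bump_ge0 _ _ _)) ler_piMl ?box_bump_ge0//.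
      by apply: (le_trans (hD n z)); rewrite indicE lern1 leq_b1.
    have ihy : (@leb R d).-integrable setT (EFin \o (fun z => h n z * box_bump e y (pos z))).
      apply: (@integrable_bounded_by _ _ _ (@leb R d) _ _ _ iy) => //.
      apply: measurable_funM; first exact: integrable_measurable (ih n).
      exact: integrable_measurable iy.
    rewrite -(box_bump_mass e y); apply: (le_trans (le_normr_Rintegral measurableT ihy)).
    by apply: le_Rintegral => //; exact: integrable_norm ihy.
  have := pairing_at_max e0 (ih n) am hy.
  move=> /(_ x) /(_ _) low.
  have {}low : - (C * @box_mass R d e) <= \int[@leb R d]_z (h n z * A z).
    by apply: low => y; rewrite hx; apply: le_trans (hy y); rewrite ler_norm.
  have iS : (@leb R d).-integrable setT (EFin \o (fun z => 2 * (S * \1_(coord_box x e) z))).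
    by do 2 apply: integrable_mull.
  have -> : 2 * (S * (2 * e) ^+ d) = \int[@leb R d]_z (2 * (S * \1_(coord_box x e) z)).
    rewrite RintegralZl//; last exact: integrable_mull.
    rewrite RintegralZl//; by rewrite Rintegral_indic_coord_box// ltW.
  have -> : \int[@leb R d]_z (\1_(D x n) z * `|A z|) =
      \int[@leb R d]_z (\1_(D x n) z * `|A z| + h n z * A z) - \int[@leb R d]_z (h n z * A z).
    by rewrite (RintegralD measurableT (iDA n) ip) addrK.
  rewrite [leRHS]addrC; apply: lerD; last by rewrite lerNl.
  apply: le_Rintegral => //; first exact: integrable_addr (iDA n) ip.
  move=> z _; rewrite /h !indicE.
  have := ler_norm (A z); have := AS z.
  have [zB|zB] := boolP (z \in coord_box x e).
    rewrite mem_set; last by apply: D0; rewrite inE in zB.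
    rewrite -![true%:R]/(1 : R); lra.
  rewrite -![false%:R]/(0 : R) sub0r subr0 mulNr -mulrA sA; lra.
have [] := @integrable_exhaustion _ _ R (@leb R d) (fun z => `|A z|) (D x)
  (C * @box_mass R d e + 2 * (S * (2 * e) ^+ d)).
- exact: measurableT_comp.
- by [].
- exact: mD.
- exact: ndD.
- exact: DT.
- exact: iDA.
- exact: leK.
move=> iA leA; split=> //.
by apply: (@integrable_bounded_by _ _ _ (@leb R d) _ _ _ iA).
Qed.

End kernel_integrability.

(** * Averages against bumps *)

Section compact_boxes.
Context {R : realType} {d : nat}.
Local Notation vec := 'rV[R]_d.
Implicit Types (x y : vec) (f : vec -> R) (r : R).

Definition vector_box x r : set vec := [set v | forall i, `[x 0 i - r, x 0 i + r]%classic (v 0 i)].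

Lemma vector_boxP x r v : vector_box x r v <-> forall i, `|v 0 i - x 0 i| <= r.
Proof.
split=> h i; have := h i; rewrite /= in_itv/= ler_norml.
  by move=> /andP[? ?]; apply/andP; split; lra.
by move=> /andP[? ?]; apply/andP; split; lra.
Qed.

Lemma compact_vector_box x r : compact (vector_box x r).
Proof.
by apply: (@rV_compact R d (fun i => `[x 0 i - r, x 0 i + r]%classic)) => i; exact: segment_compact.
Qed.

Lemma max_on_vector_box f x r : 0 <= r -> continuous f ->
  exists2 c, vector_box x r c & forall v, vector_box x r v -> f v <= f c.
Proof.
move=> r0 cf; have [|c cK cmax] := EVT_max_rV _ (@compact_vector_box x r) (continuous_subspaceT cf).
  by exists x; apply/vector_boxP => i; rewrite subrr normr0.
exists c => [|v vK]; first by rewrite inE in cK.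
by apply: cmax; rewrite inE.
Qed.

Lemma decay_outside_box f (e : R) : decays_at_infinity f -> 0 < e ->
  exists2 r, 0 <= r & forall x i, r <= `|x 0 i| -> `|f x| < e.
Proof.
move=> df e0; have [r rf] := df e e0.
exists (Num.max 0 r) => [|x i]; first by rewrite le_max lexx.
rewrite ge_max => /andP[_ rx]; apply: rf.
exact: le_trans rx (coord_le_euclidean x i).
Qed.

End compact_boxes.

Section bump_averages.
Context {R : realType} {d : nat}.
Local Notation vec := 'rV[R]_d.
Local Notation tup := (d.-tuple (measurableTypeR R)).
Local Notation pos := (@rV_of_tuple R d).
Variable (e : R).
Hypothesis e0 : 0 < e.
Implicit Types (x y : vec) (z : tup) (u : tup -> R) (a : R).

Lemma bounded_bump_integrable u a x : measurable_fun setT u ->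
  (forall z, coord_box x e z -> `|u z| <= a) ->
  (@leb R d).-integrable setT (EFin \o (fun z => u z * box_bump e x (pos z))).
Proof.
move=> mu ua; have ib := box_bump_integrable e x.
apply: (@integrable_bounded_by _ _ _ (@leb R d) _ (fun z => a * box_bump e x (pos z))).
- by apply: measurable_funM => //; exact: integrable_measurable ib.
- exact: integrable_mull.
- move=> z; have [zb|zb] := pselect (coord_box x e z).
    rewrite normrM (ger0_norm (box_bump_ge0 _ _ _)) ler_wpM2r ?box_bump_ge0//.
    exact: ua.
  by rewrite box_bump_off// !mulr0 normr0.
Qed.

Lemma bump_average_le u a x :
  (@leb R d).-integrable setT (EFin \o (fun z => u z * box_bump e x (pos z))) ->
  (forall z, coord_box x e z -> u z <= a) ->
  \int[@leb R d]_z (u z * box_bump e x (pos z)) <= a * @box_mass R d e.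
Proof.
move=> iu ua; have ib := box_bump_integrable e x.
rewrite -(box_bump_mass e x) -RintegralZl//.
apply: le_Rintegral => //; first exact: integrable_mull.
move=> z _; have [zb|zb] := pselect (coord_box x e z).
  by rewrite ler_wpM2r ?box_bump_ge0//; exact: ua.
by rewrite box_bump_off// !mulr0.
Qed.

Lemma bump_average_ge u a x :
  (@leb R d).-integrable setT (EFin \o (fun z => u z * box_bump e x (pos z))) ->
  (forall z, coord_box x e z -> a <= u z) ->
  a * @box_mass R d e <= \int[@leb R d]_z (u z * box_bump e x (pos z)).
Proof.
move=> iu ua; have ib := box_bump_integrable e x.
rewrite -(box_bump_mass e x) -RintegralZl//.
apply: le_Rintegral => //; first exact: integrable_mull.
move=> z _; have [zb|zb] := pselect (coord_box x e z).
  by rewrite ler_wpM2r ?box_bump_ge0//; exact: ua.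
by rewrite box_bump_off// !mulr0.
Qed.

(** The bump is Lipschitz in its centre, uniformly in the other variable. *)
Lemma continuous_bump_average u : (@leb R d).-integrable setT (EFin \o u) ->
  continuous (fun x => \int[@leb R d]_z (u z * box_bump e x (pos z))).
Proof.
move=> iu x; have [L L0 hL] := @box_bump_lipschitz R d e e0.
have mu : measurable_fun setT u by exact: integrable_measurable iu.
have inu := integrable_norm iu.
have b1 y z : box_bump e y (pos z) <= 1.
  by apply: prodr_ile1 => i _; rewrite bump_ge0 bump_le1.
have iub y : (@leb R d).-integrable setT (EFin \o (fun z => u z * box_bump e y (pos z))).
  apply: (@integrable_bounded_by _ _ _ (@leb R d) _ _ _ inu).
    by apply: measurable_funM => //; exact: integrable_measurable (box_bump_integrable e y).
  by move=> z; rewrite normrM ler_piMr// ger0_norm ?box_bump_ge0.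
pose I := \int[@leb R d]_z `|u z|.
have I0 : 0 <= I by apply: Rintegral_ge0.
apply: continuous_of_coord => s s0; exists (s / (I * L + 1)).
  by rewrite divr_gt0// ltr_wpDl// mulr_ge0.
move=> w wx; rewrite -(RintegralB measurableT (iub w) (iub x)).
have iB : (@leb R d).-integrable setT (EFin \o (fun z =>
    u z * box_bump e w (pos z) - u z * box_bump e x (pos z))).
  rewrite (_ : _ \o _ = (EFin \o (fun z => (u z * box_bump e w (pos z))%R)) \-
    (EFin \o (fun z => (u z * box_bump e x (pos z))%R)))%E; first exact: integrableB.
  by apply/funext => z /=; rewrite EFinB.
apply: (le_lt_trans (le_normr_Rintegral measurableT iB)).
pose c := L * (s / (I * L + 1)).
apply: (@le_lt_trans _ _ (I * c)).
  rewrite -RintegralZr//; apply: le_Rintegral => //.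
  - exact: integrable_norm iB.
  - rewrite (_ : _ \o _ = EFin \o (fun z => c * `|u z|)); first exact: integrable_mull.
    by apply/funext => z /=; rewrite mulrC.
  - move=> z _; rewrite -mulrBr normrM ler_wpM2l//.
    by apply: hL => i; exact/ltW.
rewrite /c mulrA mulrA ltr_pdivrMr; last by rewrite ltr_wpDl// mulr_ge0.
by rewrite mulrC ltr_pM2l// ltrDl.
Qed.

End bump_averages.

(** * The operator at a maximum point *)

Section max_principle.
Context {R : realType} {d : nat}.
Local Notation vec := 'rV[R]_d.
Local Notation tup := (d.-tuple (measurableTypeR R)).
Local Notation pos := (@rV_of_tuple R d).
Variables (gam bet lam C : R).
Hypothesis am : almost_accretive C (@A_symbol R d gam bet lam).
Variables (f g : vec -> R) (M : R) (xm : vec).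
Hypothesis cf : continuous f.
Hypothesis df : decays_at_infinity f.
Hypothesis fM : forall x, `|f x| <= M.
Hypothesis fxm : f xm = M.
Hypothesis M0 : 0 < M.
Hypothesis Afg : is_A_of gam bet lam f g.

(** The restriction [h] of [f] to a large cube has bump averages that attain their
    maximum at some [x0]. This maximum is nearly [M] times the mass of the bump, so
    [f] is nearly [M] somewhere on the cube around [x0]. By duality the average of
    [g] there is the pairing of [f] with the kernel, which differs from that of [h]
    by a small amount, so [g] is not far below [- C M] somewhere on the same cube. *)
Lemma approximate_max eta : 0 < eta -> 2 * eta <= M -> exists w : vec * vec,
  [/\ forall i, `|w.2 0 i - w.1 0 i| <= 2 * eta, M - 2 * eta <= f w.1 &
      - (C * M) - 2 * eta <= g w.2].
Proof.
move=> eta0 etaM; have [cg _] := Afg.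
have [r1 r10 near_xm] := continuous_coord (@cf xm) eta0.
pose e := Num.min (r1 / 2) eta.
have e0 : 0 < e by rewrite lt_min eta0 divr_gt0.
have eeta : e <= eta by rewrite ge_min lexx orbT.
have er1 : e < r1 by rewrite gt_min; apply/orP; left; lra.
pose mass := @box_mass R d e; have mass0 : 0 < mass by exact: box_mass_gt0.
have [K kerK] := multiplier_kernel_integrable e0 am.
have K0 : 0 <= K.
  have [_] := kerK 0; apply: le_trans.
  by apply: Rintegral_ge0.
(* the part of f outside the cube, of size delta, pairs with the kernel to at
   most delta * K <= eta * mass *)
pose delta := eta * mass / (K + 1).
have delta0 : 0 < delta by rewrite divr_gt0 ?mulr_gt0// ltr_wpDl.
have [r2 r20 far] := decay_outside_box df delta0.
pose r := r2 + euclidean_norm xm + e.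
have r0 : 0 <= r by rewrite !addr_ge0 ?sqrtr_ge0// ltW.
have r2r : r2 <= r by rewrite /r -addrA lerDl addr_ge0 ?sqrtr_ge0// ltW.
have xmr i : `|xm 0 i| <= r - e.
  by rewrite /r addrK (le_trans (coord_le_euclidean _ _))// lerDr.
pose h z := \1_(coord_box 0 r) z * f (pos z).
have mf : measurable_fun setT (f \o pos) by exact: measurable_continuous.
have hf z : `|h z| <= `|f (pos z)|.
  by rewrite normrM indicE ler_piMl//; case: (_ \in _); rewrite ?normr1 ?normr0.
have ih : (@leb R d).-integrable setT (EFin \o h).
  apply: (@integrable_bounded_by _ _ _ (@leb R d) _ (fun z => M * \1_(coord_box 0 r) z)).
  - apply: measurable_funM => //; apply: measurable_indic; exact: measurable_coord_box.
  - exact/integrable_mull/indic_coord_box_integrable.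
  - move=> z; rewrite /h normrM indicE; case: (_ \in _); last by rewrite normr0 mul0r mulr0.
    by rewrite normr1 mul1r mulr1.
have mh : measurable_fun setT h by exact: integrable_measurable ih.
pose H x := \int[@leb R d]_z (h z * box_bump e x (pos z)).
have ihb x := @bounded_bump_integrable R d e h M x mh (fun z _ => le_trans (hf z) (fM (pos z))).
have HM x : `|H x| <= M * mass.
  have hM z := le_trans (hf z) (fM (pos z)).
  rewrite ler_norml -mulNr; apply/andP; split.
    by apply: bump_average_ge => // z _; have := hM z; rewrite ler_norml => /andP[].
  by apply: bump_average_le => // z _; have := hM z; rewrite ler_norml => /andP[].
have Hxm : (M - eta) * mass <= H xm.
  apply: bump_average_ge => // z /coord_boxP zb.
  have zr : coord_box 0 r z.
    apply/coord_boxP => i; rewrite [(0 : vec) 0 i]mxE subr0 -(subrK (xm 0 i) (pos z 0 i)).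
    by rewrite (le_trans (ler_normD _ _))// -(subrK e r) addrC lerD.
  rewrite /h indicE mem_set// mul1r.
  have := near_xm (pos z) (fun i => le_lt_trans (zb i) er1).
  by rewrite fxm ltr_norml => /andP[+ _]; lra.
have Hout (x : vec) i : r + e < `|x 0 i| -> H x = 0.
  move=> xr; rewrite /H (_ : (fun z => _) = (fun=> 0)) ?Rintegral_cst//= ?mul0r//.
  apply/funext => z; have [zb|zb] := pselect (coord_box x e z); last by rewrite box_bump_off// mulr0.
  rewrite /h indicE memNset ?mul0r//; move/coord_boxP => zr.
  move/coord_boxP/(_ i): zb; have := zr i; rewrite [(0 : vec) 0 i]mxE subr0 => h1 h2.
  have := ler_normB (pos z 0 i) (pos z 0 i - x 0 i); rewrite opprB addrC subrK; lra.
have [x0 _ x0max] := @max_on_vector_box R d H 0 (r + e) (addr_ge0 r0 (ltW e0))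
  (continuous_bump_average e0 ih).
have Hmax (x : vec) : H x <= H x0.
  have [xb|/existsNP[i xi]] := pselect (forall i, `|x 0 i| <= r + e).
    by apply: x0max; apply/vector_boxP => i; rewrite [(0 : vec) 0 i]mxE subr0.
  rewrite (Hout x i); last by rewrite ltNge; exact/negP.
  apply: (@le_trans _ _ (H xm)).
    by apply: le_trans Hxm; rewrite mulr_ge0 ?(ltW mass0)//; lra.
  apply: x0max; apply/vector_boxP => i'; rewrite [(0 : vec) 0 i']mxE subr0.
  by apply: (le_trans (xmr i')); lra.
have low := pairing_at_max e0 ih am HM Hmax.
set ker := multiplier_kernel e (A_symbol gam bet lam) in kerK low.
have [ik kK] := kerK x0.
have mk : measurable_fun setT (fun z => ker (pos z - x0)).
  exact: integrable_measurable ik.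
have ifk : (@leb R d).-integrable setT (EFin \o (fun z => f (pos z) * ker (pos z - x0))).
  apply: (@integrable_bounded_by _ _ _ (@leb R d) _ (fun z => M * `|ker (pos z - x0)|)).
  - exact: measurable_funM.
  - by apply: integrable_mull; exact: integrable_norm ik.
  - by move=> z; rewrite normrM ler_wpM2r.
have ihk : (@leb R d).-integrable setT (EFin \o (fun z => h z * ker (pos z - x0))).
  apply: (@integrable_bounded_by _ _ _ (@leb R d) _ (fun z => M * `|ker (pos z - x0)|)).
  - exact: measurable_funM.
  - by apply: integrable_mull; exact: integrable_norm ik.
  - by move=> z; rewrite normrM ler_wpM2r// (le_trans (hf z)).
have tail : \int[@leb R d]_z (h z * ker (pos z - x0)) -
    \int[@leb R d]_z (f (pos z) * ker (pos z - x0)) <= eta * mass.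
  rewrite -RintegralB//.
  apply: (@le_trans _ _ (delta * K)); last first.
    rewrite /delta mulrAC ler_pdivrMr; last by rewrite ltr_wpDl.
    by rewrite ler_pM2l ?mulr_gt0//; lra.
  apply: (@le_trans _ _ (delta * \int[@leb R d]_z `|ker (pos z - x0)|)); last first.
    by rewrite ler_pM2l.
  have ink := integrable_norm ik.
  rewrite -RintegralZl//; apply: le_Rintegral => //.
  - rewrite (_ : _ \o _ = (EFin \o (fun z => (h z * ker (pos z - x0))%R)) \-
      (EFin \o (fun z => (f (pos z) * ker (pos z - x0))%R)))%E; first exact: integrableB.
    by apply/funext => z /=; rewrite EFinB.
  - exact: integrable_mull.
  - move=> z _; rewrite -mulrBl (le_trans (ler_norm _))// normrM ler_wpM2r//.
    rewrite /h indicE; have [zb|zb] := boolP (z \in coord_box 0 r).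
      by rewrite mul1r subrr normr0 ltW.
    rewrite mul0r sub0r normrN.
    have /existsNP[i /negP] : ~ forall i, `|pos z 0 i - (0 : vec) 0 i| <= r.
      by move=> zr; move: zb; rewrite notin_setE; apply; exact/coord_boxP.
    rewrite -ltNge.
    by rewrite [(0 : vec) 0 i]mxE subr0 => zi; apply/ltW/(far _ i); apply: le_trans (ltW zi).
have gk := A_pairing_box_bump e0 x0 Afg.
have mg : measurable_fun setT (g \o pos) by exact: measurable_continuous.
have [c _ gc] : exists2 c, vector_box x0 e c & forall v, vector_box x0 e v -> `|g v| <= `|g c|.
  apply: (@max_on_vector_box R d (fun v => `|g v|)); first exact: ltW.
  move=> v; apply: (continuous_comp (f := g) (g := fun u : R => `|u|)); first exact: cg.
  exact: norm_continuous.
have igb := @bounded_bump_integrable R d e (g \o pos) `|g c| x0 mg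
  (fun z zb => gc (pos z) ((vector_boxP _ _ _).2 ((coord_boxP _ _ _).1 zb))).
have [z [zb fz]] : exists z, coord_box x0 e z /\ M - 2 * eta <= f (pos z).
  apply: contrapT => /forallNP no.
  have : H x0 <= (M - 2 * eta) * mass.
    apply: bump_average_le => // z zb; rewrite /h indicE; case: (_ \in _); last by rewrite mul0r; lra.
    by rewrite mul1r leNgt; apply/negP => h1; apply: (no z); split=> //; exact: ltW.
  apply/negP; rewrite -ltNge; apply: lt_le_trans (Hmax xm); apply: lt_le_trans Hxm.
  by rewrite ltr_pM2r//; lra.
have [z' [zb' gz]] : exists z, coord_box x0 e z /\ - (C * M) - 2 * eta <= g (pos z).
  apply: contrapT => /forallNP no.
  have : \int[@leb R d]_z (g (pos z) * box_bump e x0 (pos z)) <= (- (C * M) - 2 * eta) * mass.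
    apply: (@bump_average_le R d e (g \o pos)) => // z1 zb1.
    by rewrite leNgt; apply/negP => h1; apply: (no z1); split=> //; exact: ltW.
  rewrite gk -/ker; apply/negP; rewrite -ltNge.
  have := mulr_gt0 eta0 mass0; move: low tail; lra.
exists (pos z, pos z'); split=> //= i.
move/coord_boxP/(_ i): zb; move/coord_boxP/(_ i): zb'.
rewrite !ler_norml => /andP[? ?] /andP[? ?]; apply/andP; split; lra.
Qed.

(** The approximate maximum points stay bounded because [f] decays; at a cluster
    point of them both approximate inequalities become exact. *)
Theorem A_at_max : exists2 x, f x = M & - (C * M) <= g x.
Proof.
have [cg _] := Afg.
pose eta n : R := M / 4 * n.+1%:R^-1.
have n1 n : 0 < n.+1%:R^-1 :> R /\ n.+1%:R^-1 <= 1 :> R.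
  by rewrite invr_gt0 ltr0n; split=> //; rewrite invf_le1 ?ltr0n// ler1n.
have eta0 n : 0 < eta n by have [? _] := n1 n; rewrite mulr_gt0// divr_gt0.
have etaM n : eta n <= M / 4.
  by have [? ?] := n1 n; rewrite /eta ler_piMr// divr_ge0// ltW.
have : forall n, exists w : vec * vec,
  [/\ forall i, `|w.2 0 i - w.1 0 i| <= 2 * eta n, M - 2 * eta n <= f w.1 &
      - (C * M) - 2 * eta n <= g w.2].
  by move=> n; apply: approximate_max => //; have := etaM n; have := M0; lra.
move=> /choice[w wP].
have M4 : 0 < M / 4 by rewrite divr_gt0.
have [r r0 far] := decay_outside_box df M4.
have wr n : vector_box 0 r (w n).1.
  apply/vector_boxP => i; rewrite [(0 : vec) 0 i]mxE subr0 leNgt; apply/negP => /ltW/far.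
  have [_ + _] := wP n; have := etaM n; have := ler_norm (f (w n).1); lra.
have Pw : ProperFilter ((fun n => (w n).1) @ \oo) by exact: fmap_proper_filter.
have Fw : \forall n \near \oo, vector_box 0 r (w n).1 by exact: nearW.
have [x [_ xc]] := compact_vector_box Pw Fw.
have close s : 0 < s -> exists n, 2 * eta n <= s /\ forall i, `|(w n).1 0 i - x 0 i| < s.
  move=> s0; have ev : \forall n \near \oo, 2 * eta n <= s.
    near=> n.
    have : n.+1%:R^-1 <= s / M by near: n; apply: near_natSinv_le; rewrite divr_gt0.
    rewrite ler_pdivlMr// /eta; set a := _^-1 => h; lra.
  have FA : \forall k \near \oo, [set v | exists n, 2 * eta n <= s /\ v = (w n).1] (w k).1.
    by near=> n; exists n; split=> //; near: n.
  have xB : nbhs x [set v | forall i, `|v 0 i - x 0 i| < s].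
    by apply/nbhs_coord; exists s.
  by have [_ [[n [hn ->]] hx]] := xc _ _ FA xB; exists n.
exists x.
  apply/eqP; rewrite eq_le (le_trans (ler_norm _) (fM x))/=.
  apply/ler_addgt0Pr => s s0.
  have s2 : 0 < s / 2 by rewrite divr_gt0.
  have [t t0 tf] := continuous_coord (@cf x) s2.
  have ts : 0 < Num.min t (s / 2) by rewrite lt_min t0.
  have [n [ns nx]] := close _ ts.
  have mt : Num.min t (s / 2) <= t by rewrite ge_min lexx.
  have := tf (w n).1 (fun i => lt_le_trans (nx i) mt).
  have [_ + _] := wP n.
  move: ns; rewrite le_min => /andP[_ ns]; rewrite ltr_norml => h /andP[_ h2]; lra.
apply/ler_addgt0Pr => s s0.
have s2 : 0 < s / 2 by rewrite divr_gt0.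
have [t t0 tg] := continuous_coord (@cg x) s2.
have ts : 0 < Num.min (t / 2) (s / 2) by rewrite lt_min !divr_gt0.
have [n [ns nx]] := close _ ts; have [wn _ gn] := wP n.
have := tg (w n).2; move: ns; rewrite le_min => /andP[nt ns] h.
have : `|g (w n).2 - g x| < s / 2.
  apply: h => i; have := wn i; have := nx i; rewrite lt_min => /andP[].
  rewrite !ltr_norml ler_norml => /andP[? ?] _ /andP[? ?]; apply/andP; split; lra.
rewrite ltr_norml => /andP[_ h2]; lra.
Unshelve. all: by end_near. Qed.

End max_principle.

(** * The sup norm and the sign symmetry *)

Section sup_norm.
Context {R : realType} {d : nat}.
Local Notation vec := 'rV[R]_d.
Local Notation tup := (d.-tuple (measurableTypeR R)).
Local Notation pos := (@rV_of_tuple R d).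
Implicit Types (x y : vec) (f g : vec -> R) (M s : R).

Lemma leb_coord_box_gt0 x (r : R) : 0 < r -> (0 < @leb R d (coord_box x r))%E.
Proof.
move=> r0; have -> : @leb R d (coord_box x r) = ((2 * r) ^+ d)%:E.
  by apply: leb_coord_box; exact: ltW.
by rewrite lte_fin exprn_gt0// mulr_gt0.
Qed.

(** A continuous function exceeding [s] at a point exceeds it on a cube, which has
    positive measure. *)
Lemma continuous_ae_le f s : continuous f ->
  {ae @leb R d, forall t, `|f (pos t)| <= s} -> forall x, `|f x| <= s.
Proof.
move=> cf [N [mN N0 fN]] x; rewrite leNgt; apply/negP => sx.
have e0 : 0 < `|f x| - s by rewrite subr_gt0.
have [r r0 rf] := continuous_coord (@cf x) e0.
have r2 : 0 < r / 2 by rewrite divr_gt0.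
have : (@leb R d (coord_box x (r / 2)) <= @leb R d N)%E.
  apply: le_measure; rewrite ?inE//; first exact: measurable_coord_box.
  move=> t /coord_boxP tb; apply: fN => /= ft.
  have : `|f (pos t) - f x| < `|f x| - s.
    by apply: rf => i; apply: (le_lt_trans (tb i)); lra.
  have := ler_dist_dist (f x) (f (pos t)); rewrite (distrC (f x)).
  have := ler_norm (`|f x| - `|f (pos t)|); lra.
rewrite N0; apply/negP; rewrite -ltNge; exact: leb_coord_box_gt0.
Qed.

Lemma Linfty_norm_max f x : continuous f -> (forall y, `|f y| <= `|f x|) ->
  Linfty_norm f = `|f x|%:E.
Proof.
move=> cf fmax; rewrite /Linfty_norm unlock.
have -> : (0 < @leb R d setT)%E.
  apply: lt_le_trans (leb_coord_box_gt0 0 (ltr01 : 0 < 1 :> R)) _.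
  by apply: le_measure; rewrite ?inE//; exact: measurable_coord_box.
apply/eqP; rewrite eq_le; apply/andP; split.
  apply/ess_supP; apply: aeW => t; rewrite /= lee_fin; exact: fmax.
rewrite leNgt; apply/negP => lt.
have [s sx hs] : exists2 s : R, s < `|f x| &
    (ess_sup (@leb R d) (abse \o (fun t => (f (pos t))%:E)) <= s%:E)%E.
  move: lt; case: ess_sup => [l| |].
  - by rewrite lte_fin => lx; exists l.
  - by [].
  - by move=> _; exists (`|f x| - 1); rewrite ?leNye// gtrDl ltrN10.
have /(continuous_ae_le cf)/(_ x) : {ae @leb R d, forall t, `|f (pos t)| <= s}.
  move/ess_supP : hs; apply: filterS => t /=.
  by rewrite lee_fin.
by rewrite leNgt sx.
Qed.

Lemma decaying_max f : continuous f -> decays_at_infinity f ->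
  exists x, forall y, `|f y| <= `|f x|.
Proof.
move=> cf df; have [f0|/existsNP[y /eqP fy]] := pselect (forall y, f y = 0).
  by exists 0 => y; rewrite !f0.
have fy0 : 0 < `|f y| by rewrite normr_gt0.
have [r r0 far] := decay_outside_box df fy0.
have [|c _ cmax] := @max_on_vector_box R d (fun v => `|f v|) 0 r r0.
  move=> v; apply: (continuous_comp (f := f) (g := fun u : R => `|u|)); first exact: cf.
  exact: norm_continuous.
have yc : `|f y| <= `|f c|.
  apply: cmax; apply/vector_boxP => i; rewrite [(0 : vec) 0 i]mxE subr0 leNgt.
  by apply/negP => /ltW/far; rewrite ltxx.
exists c => z; have [zb|/existsNP[i zi]] := pselect (vector_box 0 r z).
  exact: cmax.
apply: le_trans yc; apply/ltW/(far _ i).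
have /negP : ~ `|z 0 i| <= r.
  move=> zr; apply: zi; rewrite /= mxE in_itv/=.
  by rewrite sub0r add0r -ler_norml.
by rewrite -ltNge => /ltW.
Qed.

End sup_norm.

Section sign_symmetry.
Context {R : realType} {d : nat}.
Local Notation vec := 'rV[R]_d.
Implicit Types (f g : vec -> R).

(** No integrability is required: if one of the positive and negative parts has
    infinite integral, both sides are [0]. *)
Lemma Rintegral_opp d' (T : measurableType d') (mu : {measure set T -> \bar R}) (f : T -> R) :
  \int[mu]_t (- f t) = - \int[mu]_t f t.
Proof.
rewrite /Rintegral.
rewrite (_ : (fun t => (- f t)%:E) = (\- (EFin \o f))%E); last first.
  by apply/funext => t /=; rewrite EFinN.
rewrite integralE [in RHS]integralE funeposN funenegN.
have := @integral_ge0 _ _ R mu setT (EFin \o f)^\+%E (fun t _ => funepos_ge0 _ t).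
have := @integral_ge0 _ _ R mu setT (EFin \o f)^\-%E (fun t _ => funeneg_ge0 _ t).
case: (\int[mu]_t (EFin \o f)^\+%E t)%E => [a| |] //; case: (\int[mu]_t (EFin \o f)^\-%E t)%E => [b| |] //= _ _; rewrite ?oppr0//.
by rewrite opprB.
Qed.

Lemma is_A_of_opp gam bet lam f g : is_A_of gam bet lam f g ->
  is_A_of gam bet lam (fun x => - f x) (fun x => - g x).
Proof.
move=> [cg fg]; split=> [x|phi tphi].
  exact: (cvgN (cg x)).
have := fg phi tphi; rewrite /Rd_cintegral /Rd_integral.
set m := fourier_multiplier _ _.
under [in X in _ -> X]eq_Rintegral do rewrite mulNr.
rewrite Rintegral_opp.
have oppE (P : complex R -> R) : (forall z, P (- z) = - P z) ->
  \int[@leb R d]_t P ((- f (rV_of_tuple t))%:C%C * m (rV_of_tuple t)) =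
  - \int[@leb R d]_t P ((f (rV_of_tuple t))%:C%C * m (rV_of_tuple t)).
  move=> PN; rewrite -Rintegral_opp; apply: eq_Rintegral => t _.
  by rewrite -PN rmorphN mulNr.
rewrite !oppE; [|by case|by case].
by move=> [-> <-]; rewrite oppr0.
Qed.

(** A negative extremum of [f] is a maximum of [- f]. *)
Lemma A_at_extremum gam bet lam C f g xm :
  almost_accretive C (@A_symbol R d gam bet lam) ->
  continuous f -> decays_at_infinity f -> 0 < `|f xm| -> (forall x, `|f x| <= `|f xm|) ->
  is_A_of gam bet lam f g ->
  exists x sg, [/\ sg = 1 \/ sg = -1, sg * f x = `|f xm| & - (C * `|f xm|) <= sg * g x].
Proof.
move=> am cf df fx0 fmax Afg.
have [f0|f0] := leP 0 (f xm).
  have [x fx gx] := A_at_max am cf df fmax (esym (ger0_norm f0)) fx0 Afg.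
  by exists x, 1; rewrite !mul1r; split=> //; left.
have cNf : continuous (fun x => - f x) by move=> x; exact: (cvgN (cf x)).
have dNf : decays_at_infinity (fun x => - f x).
  by move=> e /df[r rf]; exists r => x /rf; rewrite normrN.
have Nfmax x : `|- f x| <= `|f xm| by rewrite normrN.
have [x fx gx] := A_at_max am cNf dNf Nfmax (esym (ltr0_norm f0)) fx0 (is_A_of_opp Afg).
by exists x, (-1); rewrite !mulN1r; split=> //; right.
Qed.

End sign_symmetry.

(** * The maximum principle in time *)

Section calculus_at_extrema.
Context {R : realType}.

Lemma derive_at_extremum (V : normedModType R) (f : V -> R) (x v : V) :
  (forall y, derivable f y v) -> (forall y, `|f y| <= `|f x|) -> 'D_v f x = 0.
Proof.
move=> df fmax; pose phi (u : R) := f (x + u *: v).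
have E (u : R) : (fun h : R => h^-1 *: ((f \o shift (x + u *: v)) (h *: v) - f (x + u *: v))) =
    (fun h : R => h^-1 *: ((phi \o shift u) (h *: (1 : R)) - phi u)).
  apply/funext => h /=; rewrite /phi; have -> : h *: (1 : R) = h by rewrite /GRing.scale/= mulr1.
  by rewrite scalerDl addrCA addrA (addrC x).
have dphi (u : R) : derivable phi u 1.
  by rewrite /derivable -E; exact: df.
have -> : 'D_v f x = 'D_1 phi 0.
  by rewrite /derive -E scale0r addr0.
have N11 : -1 <= 1 :> R by lra.
have i0 : (0 : R) \in `]-1, 1[ by rewrite in_itv/= ltrN10 ltr01.
have phi0 : phi 0 = f x by rewrite /phi scale0r addr0.
have [f0|f0] := leP 0 (f x).
  have phi_max (u : R) : u \in `]-1, 1[ -> phi u <= phi 0.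
    by move=> _; rewrite phi0 -(ger0_norm f0); exact: le_trans (ler_norm _) (fmax _).
  by have [_ ->] := derive1_at_max N11 (fun u _ => dphi u) i0 phi_max.
have phi_min (u : R) : u \in `]-1, 1[ -> phi 0 <= phi u.
  move=> _; rewrite phi0 -[f x]opprK -(ltr0_norm f0) lerNl.
  by apply: le_trans (fmax (x + u *: v)); rewrite -normrN ler_norm.
by have [_ ->] := derive1_at_min N11 (fun u _ => dphi u) i0 phi_min.
Qed.

Lemma derive_ge0_from_left (phi : R -> R) (c : R) : 0 < c -> derivable phi c 1 ->
  (forall s, 0 <= s -> s < c -> phi s <= phi c) -> 0 <= 'D_1 phi c.
Proof.
move=> c0 dphi le_phi; have lim_phi := @cvg_dnbhs_at_left R R _ 0 _ dphi.
apply: (cvgr_to_ge lim_phi).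
near=> h; have h0 : h < 0 by near: h; exact: nbhs_left_lt.
have hc : - c < h by near: h; apply: nbhs_left_gt; rewrite oppr_lt0.
rewrite /= /GRing.scale/= mulr1 nmulr_rge0 ?invr_lt0// subr_le0.
by apply: le_phi; lra.
Unshelve. all: by end_near. Qed.

End calculus_at_extrema.

Section space_time.
Context {R : realType} {d : nat}.
Local Notation vec := 'rV[R]_d.
Variables (theta : R -> vec -> R) (t : R) (x : vec).
Hypothesis dtheta : forall v : R * vec, derivable (fun p : R * vec => theta p.1 p.2) (t, x) v.

Lemma derivable_time : derivable (fun s => theta s x) t 1.
Proof.
have := @dtheta (1, 0); rewrite /derivable.
rewrite (_ : (fun h : R => _) = (fun h : R => h^-1 *: (((fun s => theta s x) \o shift t) (h *: (1 : R)) - theta t x)))//.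
by apply/funext => h /=; rewrite scaler0 add0r.
Qed.

Lemma derivable_space v : derivable (theta t) x v.
Proof.
have := @dtheta (0, v); rewrite /derivable.
rewrite (_ : (fun h : R => _) = (fun h : R => h^-1 *: ((theta t \o shift x) (h *: v) - theta t x)))//.
by apply/funext => h /=; rewrite scaler0 add0r.
Qed.

End space_time.

Theorem theorem1p2 (R : realType) (nu : R) (d : nat) (gamma beta lambda : R)
    (hnu : 0 <= nu) (hd : (1 <= d)%N) (hgamma0 : 0 <= gamma) (hgamma2 : gamma <= 2)
    (hbeta : 0 <= beta) (hlambda : 1 < lambda) :
  exists2 C : R, 0 < C &
    forall (v : R -> 'rV[R]_d -> 'rV[R]_d)
           (theta : R -> 'rV[R]_d -> R) (theta0 : 'rV[R]_d -> R),
      smooth_solution nu gamma beta lambda v theta theta0 ->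
      (forall t : R, 0 <= t -> decays_at_infinity (theta t)) ->
      forall t : R, 0 <= t ->
        (Linfty_norm (theta t) <= (expR (C * t))%:E * Linfty_norm theta0)%E.
Proof.
pose C0 := 2 * lambda `^ gamma * (ln lambda) `^ (- beta).
have C00 : 0 <= C0 by rewrite !mulr_ge0// powR_ge0.
have g02 : 0 <= gamma <= 2 by rewrite hgamma0.
have am := @almost_accretive_log_symbol R d hd _ _ _ hlambda g02 hbeta.
pose C := nu * C0 + 1.
have C_gt0 : 0 < C by rewrite ltr_wpDl// mulr_ge0.
exists C => // v theta theta0 [smooth cont cN init [Atheta pde]] decay.
have ctheta t : 0 <= t -> continuous (theta t).
  move=> t0 x B hB; have /subspace_continuousP/(_ (t, x) t0)/(_ B hB) nB := cont.
  have cp : (t, y) @[y --> x] --> ((t, x) : R * 'rV[R]_d).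
    move=> D; exact: (@cvg_pair _ _ _ (nbhs x) (nbhs t) (nbhs x) _ _ _ (fun=> t) id
      (cvg_cst t) cvg_id D).
  have := cp _ nB; apply: (@filterS _ (nbhs x)) => y; apply; exact: t0.
have attained t : 0 <= t -> exists x, (forall y, `|theta t y| <= `|theta t x|) /\
    Linfty_norm (theta t) = `|theta t x|%:E.
  move=> t0; have [x xmax] := decaying_max (ctheta t t0) (decay t t0).
  by exists x; split=> //; exact: Linfty_norm_max (ctheta t t0) xmax.
pose N t := fine (Linfty_norm (theta t)).
have LN t : 0 <= t -> Linfty_norm (theta t) = (N t)%:E.
  by move=> /attained[x [_ E]]; rewrite /N E.
have N0 t : 0 <= t -> 0 <= N t.
  by move=> /attained[x [_ E]]; rewrite /N E.
have theta0E : theta 0 = theta0 by apply/funext.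
move=> t1 t10; rewrite -theta0E !LN// -EFinM lee_fin leNgt; apply/negP => big.
(* if the bound failed at t1, the damped norm G would have a maximum over [0, t1]
   at some positive time c *)
pose G t := expR (- (C * t)) * N t.
have cG : {within `[0, t1], continuous G}.
  apply/subspace_continuousP => s; rewrite /= in_itv/= => /andP[s0 s1].
  apply: cvgM.
    apply: cvg_within_filter; apply: (@continuous_comp R R R (fun u : R => - (C * u)) expR).
      by apply: cvgN; apply: cvgM; [exact: cvg_cst|exact: cvg_id].
    exact: continuous_expR.
  have sub : `[0, t1] `<=` `[0, +oo[ by move=> u; rewrite /= !in_itv/= => /andP[->].
  have /subspace_continuousP/(_ s) := continuous_subspaceW sub cN.
  rewrite /= in_itv/= s0 s1 => /(_ isT) h.
  by apply: fine_cvg; rewrite -(LN s s0).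
have [c c01 Gmax] := EVT_max t10 cG.
move: c01; rewrite in_itv/= => /andP[c0 c1].
have G0 : G 0 = N 0 by rewrite /G mulr0 oppr0 expR0 mul1r.
have Gc : N 0 < G c.
  apply: (@lt_le_trans _ _ (G t1)); last by apply: Gmax; rewrite in_itv/= t10 lexx.
  by rewrite /G expRN ltr_pdivlMl// expR_gt0.
have {c0} c0 : 0 < c by rewrite lt_neqAle c0 andbT; apply/eqP => E; move: Gc; rewrite -E G0 ltxx.
have [xm [xmax NE]] := attained c (ltW c0).
have Nc : N c = `|theta c xm| by rewrite /N NE.
have M0 : 0 < `|theta c xm|.
  rewrite -Nc -(pmulr_rgt0 _ (expR_gt0 (- (C * c)))).
  exact: le_lt_trans (N0 0 (lexx 0)) Gc.
have [Ac eqn] := pde c c0.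
have dth x w : derivable (fun p : R * 'rV[R]_d => theta p.1 p.2) (c, x) w.
  by have [_] := smooth [::] (c, x) c0; apply.
have [x [sg [sg1 sgx sgA]]] := A_at_extremum am (ctheta c (ltW c0)) (decay c (ltW c0)) M0 xmax Ac.
have absx : `|theta c x| = `|theta c xm|.
  rewrite -[RHS]normr_id -sgx normrM; case: sg1 => ->; by rewrite ?normrN normr1 mul1r.
have grad0 : dotmul (v c x) (gradient (theta c) x) = 0.
  rewrite /dotmul big1// => i _; rewrite mxE derive_at_extremum ?mulr0//.
    by move=> y; exact: derivable_space.
  by move=> y; rewrite absx.
(* at x the equation bounds the time derivative by nu * C0 times the norm, while
   the maximality of G at c forces it to be at least C times the norm *)
have := eqn x; rewrite grad0 addr0 /time_derivative derive1E => eqx.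
have dpsi := derivable_time (dth x).
pose phi (s : R) := expR (- (C * s)) * (sg * theta s x).
have Dphi : is_derive c (1 : R) phi (expR (- (C * c)) * (sg * 'D_1 (fun s => theta s x) c - C * `|theta c xm|)).
  have dexp : is_derive c (1 : R) (fun s : R => expR (0 - C * s)) (expR (0 - C * c) * - C).
    exact: (@is_derive1_comp R expR (fun s => 0 - C * s) c _ _ (is_derive_expR _) (is_derive_affine 0 C c)).
  have dth1 : is_derive c (1 : R) (fun s => theta s x) ('D_1 (fun s => theta s x) c).
    by apply: DeriveDef.
  have dsg : is_derive c (1 : R) (fun s => sg * theta s x) (sg * 'D_1 (fun s => theta s x) c).
    exact: (is_deriveZ sg dth1).
  have := is_deriveM dexp dsg.
  rewrite (_ : _ * _ = phi); last by apply/funext => s; rewrite /phi !fctE sub0r.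
  move=> h; apply: (is_derive_eq h); rewrite /GRing.scale/= sgx sub0r; ring.
have : 0 <= 'D_1 phi c.
  apply: derive_ge0_from_left => // s s0 sc.
  rewrite {2}/phi sgx -Nc -/(G c); apply: (@le_trans _ _ (G s)); last first.
    by apply: Gmax; rewrite in_itv/= s0 (le_trans (ltW sc)).
  rewrite /phi /G ler_pM2l ?expR_gt0//.
  have [y [ymax Ny]] := attained s s0.
  have -> : N s = `|theta s y| by rewrite /N Ny.
  apply: le_trans (ymax x); apply: le_trans (ler_norm _) _.
  by rewrite normrM; case: sg1 => ->; rewrite ?normrN normr1 mul1r.
have [_ ->] := Dphi.
rewrite pmulr_rge0 ?expR_gt0// subr_ge0 => low.
have : sg * 'D_1 (fun s => theta s x) c = - (nu * (sg * Atheta c x)).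
  by rewrite mulrCA -mulrN; congr (_ * _); apply/eqP; rewrite -addr_eq0 eqx.
move=> E; move: low; rewrite E; apply/negP; rewrite -ltNge.
have : nu * - (C0 * `|theta c xm|) <= nu * (sg * Atheta c x) by rewrite ler_wpM2l.
by rewrite /C; lra.
Qed.
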